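(* Under the assumptions on the random data and on the discretisation parameters stated in the context, $\Phi^h(\omega,\cdot)$ exists for all $\omega\in\Omega$, and for any $1\le p<r\le p_*$ there exists a constant $C_{p,r}>0$, independent of $h$ and $f$, such that $$\|\phi-\Phi^h\|_{L_p(\Omega;L_\infty)}\ \le\ C_{p,r}\,\|f\|_{L_r(\Omega;\mathrm C^\eta_{pw})}\,h^\eta .$$
   Context: Spaces. For an interval $I\subset[0,1]$, $\mathrm C(I)$ is the space of uniformly continuous functions on $I$ with the sup norm, $\mathrm C=\mathrm C([0,1])$; for $0<\xi\le1$, $\mathrm C^\xi(I)$ is the H\''older space with norm $\|g\|_\infty+\sup_{x\ne y\in I}|g(x)-g(y)|/|x-y|^\xi$. Fix a partition $0=c_1<\dots<c_J=1$, $J\ge2$. $\mathrm C^\xi_{pw}$ is the space of $g\in L_\infty[0,1]$ with $g|_{(c_j,c_{j+1})}\in\mathrm C^\xi(c_j,c_{j+1})$ for $1\le j\le J-1$ (value at $c_j$: limit from the right for $j<J$, from the left for $j=J$), normed by $\|g\|_{\xi,pw}=\max_{1\le j\le J-1}\|g\|_{\mathrm C^\xi(c_j,c_{j+1})}$. For a normed space $X$ and a probability space $(\Omega,\mathbb P)$, $L_p(\Omega;X)$ is the Bochner space with $\|g\|^p_{L_p(\Omega;X)}=\int_\Omega\|g\|_X^p\,d\mathbb P$. Random data. $\sigma_S,\sigma,f$ are random fields on $[0,1]$; $\sigma_A=\sigma-\sigma_S$; $\sigma_S,\sigma_A,\sigma$ are positive-valued (for every $\omega$ with positive infimum, and realisations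 of $\sigma,\sigma_S,f$ in $\mathrm C_{pw}^\eta$). For some $\eta\in(0,1)$: (a) $\sigma,\sigma_S\in L_p(\Omega;\mathrm C^\eta_{pw})$ for all $p\in[1,\infty)$; (b) $((\sigma_S)_{\min})^{-1},((\sigma_A)_{\min})^{-1}\in L_p(\Omega)$ for all $p\in[1,\infty)$; (c) $f\in L_{p_*}(\Omega;\mathrm C^\eta_{pw})$ for some $p_*\in(1,\infty]$. Subscripts $\min,\max$ denote infimum and supremum over $[0,1]$; $\overline a=\max\{1,a\}$, $\underline a=\min\{a,1\}$. Exact solution (pathwise). $\phi=\phi(\omega,\cdot)$ is the scalar flux $\phi(x)=\frac12\int_{-1}^1\psi(x,\mu)\,d\mu$ of the solution of $\mu\,\partial_x\psi+\sigma\psi=\sigma_S\phi+f$, $x\in(0,1)$, $\mu\in[-1,1]$, with $\psi(0,\mu)=0$ for $\mu>0$, $\psi(1,\mu)=0$ for $\mu<0$; equivalently the unique solution of $\phi(x)=\frac12\int_0^1E_1(|\int_x^y\sigma|)(\sigma_S\phi+f)(y)\,dy$, with $E_1(z)=\int_1^\infty e^{-tz}\,dt/t$. Discrete solution for deterministic data. Meshes $0=x_0<\dots<x_M=1$ contain all $c_j$; $I_j=(x_{j-1},x_j)$, $h_j=|I_j|$, diameter $h=\max_jh_j\le\rho\min_jh_j$ with $\rho\ge1$ fixed. The double Gauss rule has nodes $\mu_{\pm k}=\pm\mu_k$ and weights $w_{\pm k}=w_k$, $k=1,\dots,N$, where $(\mu_k,w_k)_{k=1}^N$ is the $N$-point Gauss--Legendre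 rule on $[0,1]$. $V^h$ is the space of continuous piecewise linear functions on the mesh; $\mathcal P^hv$ is piecewise constant, equal on $I_j$ to $v$ at the midpoint of $I_j$. For $\mu\ne0$, $\mathcal S^h_\mu g=u^h\in V^h$ is defined by $\int_{I_j}(\mu\frac{du^h}{dx}+(\mathcal P^h\sigma)u^h)=\int_{I_j}g$, $j=1,\dots,M$, with $u^h(0)=0$ if $\mu>0$, $u^h(1)=0$ if $\mu<0$; $\mathcal K^{h,N}g=\frac12\sum_{|k|=1}^Nw_k\mathcal S^h_{\mu_k}g$. The discrete solution $\phi^{h,N}\in V^h$ solves $\phi^{h,N}=\mathcal K^{h,N}\mathcal P^h(\sigma_S\phi^{h,N}+f)$ (this is the discrete-ordinates/diamond-difference scheme). Stability condition. $\mathcal R_1(\sigma,\sigma_S)=2\overline{\sigma_{\max}}^{1/2}\frac{\sigma_{\max}}{\sigma_{\min}}(1-\|\sigma_S/\sigma\|_\infty)^{-1}$ and $\mathcal R_3(\sigma,\sigma_S)=K\frac{(\sigma_S)_{\max}}{(\sigma_S)_{\min}}\big(\frac{\overline{\sigma_{\max}}}{\underline{\sigma_{\min}}}\big)^3\overline{\|\sigma\|_{\eta,pw}}\,\mathcal R_1(\sigma,\sigma_S)$. The stability condition for $(h,N)$ is $$(h^\eta+h\log N+N^{-1})^{-1}\ge\mathcal R_3(\sigma,\sigma_S).\qquad(\ast)$$ Here $K\ge1$ is a fixed constant, independent of the data, the mesh and $N$, such that for all admissible deterministic data, all meshes $0=x_0<\dots<x_M=1$ that contain all $c_j$ and satisfy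 $\max_jh_j\le\rho\min_jh_j$, and all $N\ge2$, $(\ast)$ implies that $I-\mathcal K^{h,N}\mathcal P^h\sigma_S$ is invertible on $\mathrm C$ with norm of the inverse at most $c\rho\frac{\overline{\sigma_{\max}}}{\sigma_{\min}}\frac{(\sigma_S)_{\max}}{(\sigma_S)_{\min}}\overline{(\sigma_S)_{\max}}\,\mathcal R_1(\sigma,\sigma_S)$, with $c$ independent of the data, the mesh and $N$. Choice of parameters. For each mesh diameter $h$, $N=N(h)=\lceil c_0h^{-\eta}\rceil$ with $c_0>0$ independent of $h,\omega$ and large enough that $\log N(h)\ge1$. Let $0<h<1$ be deterministic. For $\omega\in\Omega$, $h_\omega^{\max}$ is the largest value of $h$ for which $(\ast)$ holds with $\sigma=\sigma(\omega,\cdot)$, $\sigma_S=\sigma_S(\omega,\cdot)$ and $N=N(h_\omega^{\max})$; $h_\omega=\min\{h,h_\omega^{\max}\}$; and $\Phi^h(\omega,x)=\phi^{h_\omega,N(h_\omega)}(\omega,x)$, computed on a mesh $0=x_0<\dots<x_M=1$ of diameter $\max_jh_j=h_\omega$ that contains all $c_j$ and satisfies $\max_jh_j\le\rho\min_jh_j$. *)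

(* Defs.v *)
From mathcomp Require Import all_boot all_order all_algebra.
From mathcomp Require Import all_classical all_reals all_analysis.

Set Implicit Arguments.
Unset Strict Implicit.
Unset Printing Implicit Defensive.

Import Order.TTheory GRing.Theory Num.Theory.
Import numFieldTopology.Exports numFieldNormedType.Exports.

Local Open Scope classical_set_scope.
Local Open Scope ring_scope.

Section Deterministic.
Context {R : realType}.
Implicit Types (cs xs : seq R) (g v u sigma sigmaS f phi : R -> R).
Implicit Types (eta xi rho K h m : R) (mu w : nat -> nat -> R) (j k N : nat).

Definition sup01 g : R := sup [set g x | x in `[0, 1]].
Definition inf01 g : R := inf [set g x | x in `[0, 1]].
Definition supnorm01 g : R := sup01 (fun x => `|g x|).

Definition C01 g : Prop := {within `[(0 : R), 1], continuous g}.

(* The essential supremum of |g| over [0,1]; g \_ A vanishes outside A. *)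
Definition Linf01 g : \bar R :=
  'N[@lebesgue_measure R]_(+oo%E)[EFin \o (g \_ `[0, 1])].

(* As in [itv_partition 0 1 xs], the list xs stands for the points 0 :: xs, with
   last point 1. The cells are numbered from 0: cell j = ]left_pt j, right_pt j[. *)
Definition left_pt xs j : R := (0 :: xs)`_j.
Definition right_pt xs j : R := xs`_j.
Definition cell xs j : set R := `]left_pt xs j, right_pt xs j[.
Definition cell_length xs j : R := right_pt xs j - left_pt xs j.
Definition midpoint xs j : R := (left_pt xs j + right_pt xs j) / 2.
Definition diameter xs : R := \big[Num.max/0]_(j < size xs) cell_length xs j.

Definition mesh rho cs xs : Prop :=
  [/\ itv_partition 0 1 xs, {subset cs <= xs} &
      forall j, (j < size xs)%N -> diameter xs <= rho * cell_length xs j].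

Definition holder_norm xi (I : set R) g : \bar R :=
  (ereal_sup [set `|g x|%:E | x in I] +
   ereal_sup [set (`|g z.1 - g z.2| / `|z.1 - z.2| `^ xi)%:E |
                z in [set z : R * R | [/\ I z.1, I z.2 & z.1 != z.2]]])%E.

Definition pw_norm xi cs g : \bar R :=
  \big[maxe/0%E]_(j < size cs) holder_norm xi (cell cs j) g.

Definition Cpw xi cs : set (R -> R) :=
  [set g | [/\ (pw_norm xi cs g < +oo)%E,
    forall j, (j < size cs)%N ->
      g x @[x --> (left_pt cs j)^'+] --> g (left_pt cs j) &
    g x @[x --> (1 : R)^'-] --> g 1]].

(* A positive value of [inf01] forces boundedness below, since [inf] of a set
   that is not bounded below is 0. *)
Definition admissible eta cs sigma sigmaS : Prop :=
  [/\ Cpw eta cs sigma, Cpw eta cs sigmaS,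
      0 < inf01 sigma, 0 < inf01 sigmaS & 0 < inf01 (sigma \- sigmaS)].

(* At z = 0 the integral diverges and E1 0 is the junk value 0; in
   [scalar_flux] this concerns the single point y = x only. *)
Definition E1 (z : R) : R :=
  \int[@lebesgue_measure R]_(t in `[1, +oo[) (expR (- (t * z)) / t).

Definition optical_depth sigma (x y : R) : R :=
  `|\int[@lebesgue_measure R]_(s in `[Num.min x y, Num.max x y]) sigma s|.

Definition scalar_flux sigma sigmaS f phi : Prop :=
  [/\ measurable_fun `[(0 : R), 1] phi,
      exists B : R, forall x, x \in `[0, 1] -> `|phi x| <= B &
      forall x, x \in `[0, 1] ->
        phi x = 2^-1 * \int[@lebesgue_measure R]_(y in `[0, 1])
          (E1 (optical_depth sigma x y) * (sigmaS y * phi y + f y))].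

(* Exactness in degree at most 2N - 1 characterises the N-point Gauss-Legendre
   rule on [0,1]; the nodes are listed in increasing order. *)
Definition gauss_legendre N (mu w : nat -> R) : Prop :=
  [/\ forall k, (k < N)%N -> 0 < mu k < 1,
      forall k l, (k < l < N)%N -> mu k < mu l &
      forall q : {poly R}, (size q <= N.*2)%N ->
        \sum_(k < N) w k * q.[mu k] =
        \int[@lebesgue_measure R]_(x in `[0, 1]) q.[x]].

Definition Vh xs : set (R -> R) :=
  [set v | C01 v /\
    forall j, (j < size xs)%N ->
      exists a b : R, forall x, cell xs j x -> v x = a + b * x].

(* The value at the mesh nodes is irrelevant: only integrals of [Ph] are used. *)
Definition Ph xs v (x : R) : R :=
  \sum_(j < size xs) v (midpoint xs j) * \1_(cell xs j) x.

(* u = S^h_m g, for m != 0. Functions are defined on all of R, so that u is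
   determined on [0,1] only; hence the relational form. *)
Definition is_Sh xs sigma m g u : Prop :=
  [/\ Vh xs u,
      forall j, (j < size xs)%N ->
        \int[@lebesgue_measure R]_(x in cell xs j)
           (m * derive1 u x + Ph xs sigma x * u x) =
        \int[@lebesgue_measure R]_(x in cell xs j) g x,
      0 < m -> u 0 = 0 &
      m < 0 -> u 1 = 0].

(* v = K^{h,N} g on [0,1], for the double Gauss rule with positive nodes
   mu N 0, ..., mu N N.-1; u true and u false carry the directions mu and -mu. *)
Definition is_Kh mu w xs N sigma g v : Prop :=
  exists u : bool -> nat -> R -> R,
    (forall k, (k < N)%N ->
       is_Sh xs sigma (mu N k) g (u true k) /\
       is_Sh xs sigma (- mu N k) g (u false k)) /\
    (forall x, x \in `[0, 1] ->
       v x = 2^-1 * \sum_(k < N) w N k * (u true k x + u false k x)).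

Definition discrete_solution mu w xs N sigma sigmaS f v : Prop :=
  Vh xs v /\ is_Kh mu w xs N sigma (Ph xs (sigmaS \* v \+ f)) v.

(* I - K^{h,N} P^h sigmaS is invertible on C([0,1]) and its inverse has norm at
   most B; the equation (I - K^{h,N} P^h sigmaS) v = g is written as
   K^{h,N} P^h (sigmaS v) = v - g. *)
Definition invertible_with_bound mu w xs N sigma sigmaS (B : R) : Prop :=
  forall g, C01 g ->
  exists v,
    [/\ C01 v,
        is_Kh mu w xs N sigma (Ph xs (sigmaS \* v)) (v \- g),
        supnorm01 v <= B * supnorm01 g &
        forall v', C01 v' ->
          is_Kh mu w xs N sigma (Ph xs (sigmaS \* v')) (v' \- g) ->
          forall x, x \in `[0, 1] -> v' x = v x].

Definition R1 sigma sigmaS : R :=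
  2 * Num.sqrt (Num.max 1 (sup01 sigma)) * (sup01 sigma / inf01 sigma) *
  (1 - supnorm01 (fun x => sigmaS x / sigma x))^-1.

Definition R3 eta K cs sigma sigmaS : R :=
  K * (sup01 sigmaS / inf01 sigmaS) *
  (Num.max 1 (sup01 sigma) / Num.min (inf01 sigma) 1) ^+ 3 *
  Num.max 1 (fine (pw_norm eta cs sigma)) * R1 sigma sigmaS.

Definition stability_condition eta K cs sigma sigmaS h N : Prop :=
  R3 eta K cs sigma sigmaS <= (h `^ eta + h * ln N%:R + N%:R^-1)^-1.

Definition stability_constant mu w eta rho cs K : Prop :=
  exists c : R, forall sigma sigmaS xs N,
    admissible eta cs sigma sigmaS -> mesh rho cs xs -> (2 <= N)%N ->
    stability_condition eta K cs sigma sigmaS (diameter xs) N ->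
    invertible_with_bound mu w xs N sigma sigmaS
      (c * rho * (Num.max 1 (sup01 sigma) / inf01 sigma) *
       (sup01 sigmaS / inf01 sigmaS) * Num.max 1 (sup01 sigmaS) *
       R1 sigma sigmaS).

Definition Nh eta (c0 : R) h : nat := `|Num.ceil (c0 * h `^ (- eta))|%N.

(* A supremum rather than a maximum: because of the ceiling in [Nh] the set
   need not have a greatest element. When it has one, this is it. *)
Definition h_max eta K (c0 : R) cs sigma sigmaS : R :=
  sup [set h | 0 < h <= 1 /\
               stability_condition eta K cs sigma sigmaS h (Nh eta c0 h)].

End Deterministic.

Section Random.
Context {R : realType} {d : measure_display} {Omega : measurableType d}.
Variable P : probability Omega R.
Implicit Types (s : Omega -> R -> R) (X : set (R -> R)) (nrm : (R -> R) -> \bar R).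

Definition random_field s : Prop :=
  forall x, x \in `[0, 1] -> measurable_fun [set: Omega] (s ^~ x).

Definition simple_field X s : Prop :=
  exists (n : nat) (A : 'I_n -> set Omega) (g : 'I_n -> R -> R),
    [/\ forall i, measurable (A i), forall i, X (g i) &
        forall omega x, s omega x = \sum_(i < n) \1_(A i) omega * g i x].

Definition strongly_measurable X nrm s : Prop :=
  exists a : nat -> Omega -> R -> R,
    (forall n, simple_field X (a n)) /\
    {ae P, forall omega, nrm (a n omega \- s omega) @[n --> \oo] --> 0%E}.

(* The norm of L_p(Omega; X), for the norm nrm on X. *)
Definition bochner_norm nrm (p : \bar R) s : \bar R :=
  Lnorm P p (fun omega => nrm (s omega)).

Definition in_bochner X nrm (p : \bar R) s : Prop :=
  strongly_measurable X nrm s /\ (bochner_norm nrm p s < +oo)%E.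

Definition random_cross_sections (eta : R) (cs : seq R)
    (sigma sigmaS : Omega -> R -> R) : Prop :=
  [/\ random_field sigma /\ random_field sigmaS,
      forall omega, admissible eta cs (sigma omega) (sigmaS omega),
      forall p : R, 1 <= p ->
        in_bochner (Cpw eta cs) (pw_norm eta cs) p%:E sigma /\
        in_bochner (Cpw eta cs) (pw_norm eta cs) p%:E sigmaS &
      forall p : R, 1 <= p ->
        (fun omega => (inf01 (sigmaS omega))^-1) \in Lfun P p%:E /\
        (fun omega => (inf01 (sigma omega \- sigmaS omega))^-1)
          \in Lfun P p%:E].

Definition random_source (eta : R) (cs : seq R) (pstar : \bar R)
    (f : Omega -> R -> R) : Prop :=
  [/\ random_field f, forall omega, Cpw eta cs (f omega) &
      in_bochner (Cpw eta cs) (pw_norm eta cs) pstar f].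

Definition h_omega (eta K c0 : R) (cs : seq R)
    (sigma sigmaS : Omega -> R -> R) (h : R) (omega : Omega) : R :=
  Num.min h (h_max eta K c0 cs (sigma omega) (sigmaS omega)).

Definition mesh_choice (eta rho K c0 : R) (cs : seq R)
    (sigma sigmaS : Omega -> R -> R) (h : R) (T : Omega -> seq R) : Prop :=
  forall omega, mesh rho cs (T omega) /\
    diameter (T omega) = h_omega eta K c0 cs sigma sigmaS h omega.

(* v = Phi^h(omega, .), computed on the mesh T omega. *)
Definition sample_solution (mu w : nat -> nat -> R) (eta K c0 : R) (cs : seq R)
    (sigma sigmaS f : Omega -> R -> R) (h : R) (T : Omega -> seq R)
    (omega : Omega) (v : R -> R) : Prop :=
  discrete_solution mu w (T omega)
    (Nh eta c0 (h_omega eta K c0 cs sigma sigmaS h omega))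
    (sigma omega) (sigmaS omega) (f omega) v.

End Random.

(* Main.v *)
(* Pathwise, the scheme is stable whether or not the stability condition holds:
   summation by parts along each diamond-difference sweep shows that
   g |-> K^{h,N} g is nonexpansive from l2 with weight h/sigma to l2 with weight
   h*sigma, so composing with sigma_S < sigma gives a contraction with constant
   1 - L^-2, where L >= 1 bounds the norms of sigma, sigma_S and the inverses of
   their minima.  This yields existence and uniqueness, and reduces the error to
   the consistency error K g - K^{h,N} g for the exact source g.

   The consistency error splits in two.  The exact flux is an angular integral
   over mu of functions F with |F mu - F nu| <= c |sqrt mu - sqrt nu| / sqrt mu;
   a polynomial approximation of Jackson type in this weight, with the exactness
   and the positivity of the Gauss rule, gives an angular error O(1/N) = O(h^eta).
   For fixed mu the sweep is compared with the exact transport: large cells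
   (relative to mu) are damped at a geometric rate away from the finitely many
   jumps, small cells are consistent, and the error is
   O(h^eta mu^(-max(eta,1/2))), which the Gauss weights sum uniformly in N.

   All constants are powers of L(omega), which has moments of every order, so
   Hoelder's inequality between L_p and L_r concludes. *)

(* Grazing directions, mu near 0, shape the proof. A diamond cell that is optically thick for mu has
   a negative amplification factor, so the discrete operator need not obey a maximum principle;
   stability is therefore sought in l2, and the return to nodal values costs mu^(-1/2). Every loss
   has the form mu^(-s) with s < 1, and is harmless because the Gauss weights sum mu^(-s) uniformly
   in N. That fact rests on exactness alone: the rule underestimates the integral of 1/(t + x) for
   each t > 0, and x^(-s) is dominated by a superposition of such resolvents at dyadic t. The
   square-root weight in the Jackson inequality is the one that the substitution mu = sin^2(theta/2)
   turns into a plain Lipschitz condition in the angle. The contraction constant 1 - L^-2 comes from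
   sigma - sigma_S >= 1/L and sigma <= L. In the sample space the error is not shown to be
   measurable in omega. It is dominated pathwise by a measurable product, and integrals of
   nonnegative functions are monotone without measurability. *)
Require Import Defs.
From mathcomp Require Import all_boot all_order all_algebra.
From mathcomp Require Import all_classical all_reals all_analysis.
From mathcomp Require Import measurable_realfun ess_sup_inf ring lra zify.

Set Implicit Arguments.
Unset Strict Implicit.
Unset Printing Implicit Defensive.

Import Order.TTheory GRing.Theory Num.Theory.
Import numFieldTopology.Exports numFieldNormedType.Exports.

Local Open Scope classical_set_scope.
Local Open Scope ring_scope.

Lemma le_of_eq d (T : porderType d) (x y : T) : x = y -> (x <= y)%O.
Proof. by move->. Qed.

(** * A weighted Jackson inequality *)

Section Jackson.
Context {R : realType}.
Implicit Types (t u A mu nu : R) (f g F : R -> R) (n m q : nat).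

(** Even trigonometric polynomials only, of degree less than m: evenness is what makes them
    polynomials in sin^2(t/2). *)
Definition is_trig_poly m f :=
  exists a : nat -> R, forall t, f t = \sum_(q < m) a q * cos (q%:R * t).

Lemma trig_polyD m f g :
  is_trig_poly m f -> is_trig_poly m g -> is_trig_poly m (fun t => f t + g t).
Proof.
move=> [a fE] [b gE]; exists (fun q => a q + b q) => t.
by rewrite fE gE -big_split; apply: eq_bigr => q _ /=; rewrite mulrDl.
Qed.

Lemma trig_polyZ m c f : is_trig_poly m f -> is_trig_poly m (fun t => c * f t).
Proof.
move=> [a fE]; exists (fun q => c * a q) => t.
by rewrite fE mulr_sumr; apply: eq_bigr => q _; rewrite mulrA.
Qed.

Lemma trig_poly_sum m (I : Type) (r : seq I) (f : I -> R -> R) :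
  (forall i, is_trig_poly m (f i)) -> is_trig_poly m (fun t => \sum_(i <- r) f i t).
Proof.
move=> fP; elim: r => [|i r IH].
  exists (fun=> 0) => t; rewrite big_nil big1 // => q _; exact: mul0r.
have [a aE] := trig_polyD (fP i) IH.
by exists a => t; rewrite big_cons aE.
Qed.

Lemma trig_poly_cos m q : (q < m)%N -> is_trig_poly m (fun t => cos (q%:R * t)).
Proof.
move=> qm; exists (fun p => (p == q)%:R) => t.
rewrite (bigD1 (Ordinal qm)) //= eqxx mul1r big1 ?addr0 // => i.
by rewrite -val_eqE /= => /negbTE ->; rewrite mul0r.
Qed.

Lemma cosM t u : cos t * cos u = 2^-1 * (cos (t + u) + cos (t - u)).
Proof. rewrite cosB cosD; lra. Qed.

Lemma trig_poly_cosM m1 m2 q1 q2 : (q1 < m1)%N -> (q2 < m2)%N ->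
  is_trig_poly (m1 + m2).-1 (fun t => cos (q1%:R * t) * cos (q2%:R * t)).
Proof.
wlog le12 : m1 m2 q1 q2 / (q1 <= q2)%N => [hw|] lt1 lt2.
  case: (leqP q1 q2) => [|/ltnW] le; first exact: hw.
  have [a aE] := hw _ _ _ _ le lt2 lt1.
  by exists a => t; rewrite mulrC aE addnC.
have h1 : (q2 + q1 < (m1 + m2).-1)%N by lia.
have h2 : (q2 - q1 < (m1 + m2).-1)%N by lia.
have [a aE] := trig_polyZ 2^-1 (trig_polyD (trig_poly_cos h1) (trig_poly_cos h2)).
exists a => t; rewrite -aE mulrC cosM natrD natrB //.
by congr (_ * (cos _ + cos _)); ring.
Qed.

Lemma trig_polyM m1 m2 f g : is_trig_poly m1 f -> is_trig_poly m2 g ->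
  is_trig_poly (m1 + m2).-1 (fun t => f t * g t).
Proof.
move=> [a fE] [b gE].
have [c cE] : is_trig_poly (m1 + m2).-1
    (fun t => \sum_(i <- index_enum 'I_m1) \sum_(j <- index_enum 'I_m2)
       (a i * b j * (cos (i%:R * t) * cos (j%:R * t)))).
  apply: trig_poly_sum => i; apply: trig_poly_sum => j.
  by apply: trig_polyZ; exact: trig_poly_cosM.
exists c => t; rewrite -cE fE gE big_distrl /=; apply: eq_bigr => i _.
by rewrite big_distrr /=; apply: eq_bigr => j _; ring.
Qed.

(** This is the Chebyshev polynomial T_q taken at 1 - 2x, since cos t = 1 - 2 sin^2(t/2). Two
    consecutive degrees are carried through the induction for the three-term recurrence. *)
Lemma cos_poly q : exists2 p : {poly R}, (size p <= q.+1)%N &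
  forall t, p.[sin (t / 2) ^+ 2] = cos (q%:R * t).
Proof.
pose C : {poly R} := 1%:P - 2%:P * 'X.
have CE t : C.[sin (t / 2) ^+ 2] = cos t.
  have -> : cos t = cos (t / 2 + t / 2) by congr cos; field.
  rewrite hornerD hornerN hornerM !hornerC hornerX cosD -!expr2 cos2sin2; ring.
have sC : (size C <= 2)%N.
  rewrite (leq_trans (size_polyD _ _)) // geq_max size_polyN (leq_trans (size_polyC_leq1 _)) //=.
  by rewrite mul_polyC (leq_trans (size_scale_leq _ _)) // size_polyX.
have [] : (exists2 p : {poly R}, (size p <= q.+1)%N &
   forall t, p.[sin (t / 2) ^+ 2] = cos (q%:R * t)) /\
  (exists2 p : {poly R}, (size p <= q.+2)%N &
   forall t, p.[sin (t / 2) ^+ 2] = cos (q.+1%:R * t)); last by [].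
elim: q => [|q [[p1 s1 E1] [p2 s2 E2]]].
  split; first by exists 1 => [|t]; rewrite ?size_poly1 // hornerE mul0r cos0.
  by exists C => // t; rewrite mul1r.
split; first by exists p2.
exists (2%:P * C * p2 - p1) => [|t].
  rewrite (leq_trans (size_polyD _ _)) // geq_max size_polyN.
  rewrite (leq_trans s1) ?andbT; last by rewrite leqW.
  rewrite -mulrA mul_polyC (leq_trans (size_scale_leq _ _)) //.
  by rewrite (leq_trans (size_polyMleq _ _)) //; lia.
rewrite hornerD hornerN 2!hornerM E1 E2 CE hornerC.
rewrite -mulrA cosM [q.+1%:R * t]mulrC [q.+2%:R * t]mulrC.
have -> : t + t * q.+1%:R = t * q.+2%:R by rewrite -(natr1 q.+1); ring.
have -> : t - t * q.+1%:R = - (q%:R * t) by rewrite -(natr1 q); ring.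
by rewrite cosN; field.
Qed.

(** Multiplied by 2 sin a with a = q pi / L, the sum telescopes over a whole number of periods; 0 <
    q < L gives 0 < a < pi, so sin a does not vanish. *)
Lemma sum_cos_grid L q t : (0 < q < L)%N ->
  \sum_(i < L) cos (q%:R * (t + 2 * pi * i%:R / L%:R)) = 0.
Proof.
case/andP=> q0 qL; have L0 : (0 < L)%N by exact: leq_trans qL.
have LR : (L%:R : R) != 0 by rewrite pnatr_eq0 -lt0n.
pose a : R := q%:R * pi / L%:R.
have sa : sin a != 0.
  rewrite gt_eqF //; apply: sin_gt0_pi; rewrite /a.
  rewrite divr_gt0 ?mulr_gt0 ?pi_gt0 ?ltr0n //=.
  by rewrite ltr_pdivrMr ?ltr0n // mulrC ltr_pM2l ?pi_gt0 // ltr_nat.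
suff : \sum_(i < L) (sin (q%:R * t + a * 2 * i.+1%:R - a) -
    sin (q%:R * t + a * 2 * i%:R - a)) =
  2 * sin a * \sum_(i < L) cos (q%:R * (t + 2 * pi * i%:R / L%:R)).
  rewrite -(big_mkord xpredT (fun i => sin (q%:R * t + a * 2 * i.+1%:R - a) -
    sin (q%:R * t + a * 2 * i%:R - a))) telescope_sumr //.
  have -> : q%:R * t + a * 2 * L%:R - a = (q%:R * t - a) + pi *+ 2 *+ q.
    by rewrite -mulr_natr -(mulr_natr pi) /a; field.
  rewrite (periodicn (@sinD2pi R)).
  rewrite mulr0 addr0 subrr => /esym/eqP; rewrite mulf_eq0 mulf_eq0 (negbTE sa).
  by rewrite pnatr_eq0 /= => /eqP.
rewrite mulr_sumr; apply: eq_bigr => i _.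
have -> : q%:R * (t + 2 * pi * i%:R / L%:R) = q%:R * t + a * 2 * i%:R.
  by rewrite /a; field.
set b := _ + a * 2 * i%:R.
have -> : q%:R * t + a * 2 * i.+1%:R - a = b + a by rewrite /b -natr1; ring.
by rewrite sinB sinD; ring.
Qed.

(** Below degree L the grid sum sees only the constant term, hence does not feel the shift t. *)
Lemma trig_poly_grid_const L m f t : (0 < L)%N -> (m <= L)%N -> is_trig_poly m f ->
  \sum_(i < L) f (t + 2 * pi * i%:R / L%:R) = \sum_(i < L) f (2 * pi * i%:R / L%:R).
Proof.
move=> L0 mL [a fE]; under eq_bigr do rewrite fE; under [RHS]eq_bigr do rewrite fE.
rewrite exchange_big [RHS]exchange_big /=; apply: eq_bigr => q _.
rewrite -!mulr_sumr; congr (_ * _).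
have [->|q0] := posnP q; first by under eq_bigr do rewrite mul0r; under [RHS]eq_bigr do rewrite mul0r.
have qL : (0 < q < L)%N by rewrite q0 (leq_trans (ltn_ord q)).
rewrite sum_cos_grid //; under eq_bigr do rewrite -[X in cos (_ * X)]add0r.
by rewrite sum_cos_grid.
Qed.

(** The squared modulus of the sum of exp(ikt) over k < n, that is, n times the classical Fejer
    kernel. *)
Definition fejer n t : R :=
  (\sum_(k < n) cos (k%:R * t)) ^+ 2 + (\sum_(k < n) sin (k%:R * t)) ^+ 2.

Lemma fejer_ge0 n t : 0 <= fejer n t.
Proof. by rewrite addr_ge0 ?sqr_ge0. Qed.

Lemma fejerE n t : fejer n t = \sum_(j < n) \sum_(k < n) cos ((j%:R - k%:R) * t).
Proof.
rewrite /fejer !expr2 !big_distrlr /= -big_split /=; apply: eq_bigr => j _.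
rewrite -big_split /=; apply: eq_bigr => k _.
by rewrite mulrBl cosB.
Qed.

Lemma fejer_trig n : is_trig_poly n (fejer n).
Proof.
have [a aE] : is_trig_poly n (fun t => \sum_(j <- index_enum 'I_n)
    \sum_(k <- index_enum 'I_n) cos ((maxn j k - minn j k)%N%:R * t)).
  apply: trig_poly_sum => j; apply: trig_poly_sum => k; apply: trig_poly_cos.
  have := ltn_ord j; have := ltn_ord k; lia.
exists a => t; rewrite fejerE -aE; apply: eq_bigr => j _; apply: eq_bigr => k _.
case: (leqP j k) => le; last by rewrite natrB // ltnW.
by rewrite natrB // -[LHS]cosN -mulNr opprB.
Qed.

Lemma fejer0 n : fejer n 0 = n%:R ^+ 2.
Proof.
rewrite fejerE; under eq_bigr do under eq_bigr do rewrite mulr0 cos0.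
by rewrite !sumr_const !card_ord expr2 mulr_natr.
Qed.

Lemma fejer_average L n t : (0 < L)%N -> (n <= L)%N ->
  \sum_(i < L) fejer n (t + 2 * pi * i%:R / L%:R) = L%:R * n%:R.
Proof.
move=> L0 nL; under eq_bigr do rewrite fejerE.
rewrite exchange_big /=.
transitivity (\sum_(j < n) (L%:R : R)); last first.
  by rewrite sumr_const card_ord mulr_natr.
apply: eq_bigr => j _; rewrite exchange_big /= (bigD1 j) //= [X in _ + X]big1 => [|k kj].
  rewrite addr0; under eq_bigr do rewrite subrr mul0r cos0.
  by rewrite sumr_const card_ord.
have jn := ltn_ord j; have kn := ltn_ord k.
have /orP[lt|lt] : (j < k)%N || (k < j)%N by rewrite -neq_ltn eq_sym.
  under eq_bigr do rewrite -cosN -mulNr opprB -natrB ?(ltnW lt) //.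
  by apply: sum_cos_grid; lia.
under eq_bigr do rewrite -natrB ?(ltnW lt) //.
by apply: sum_cos_grid; lia.
Qed.

(** In closed form the left side is sin^2(nt/2). The two sums telescope once multiplied by 2
    sin(t/2). *)
Lemma fejer_sin n t : sin (t / 2) ^+ 2 * fejer n t <= 1.
Proof.
have C k : \sum_(i < k) cos (i%:R * t) * (2 * sin (t / 2)) =
    sin (k%:R * t - t / 2) + sin (t / 2).
  elim: k => [|k IH]; first by rewrite big_ord0 mul0r sub0r sinN addNr.
  rewrite big_ord_recr /= IH (_ : k.+1%:R * t - t / 2 = k%:R * t + t / 2); last first.
    by rewrite -natr1; field.
  by rewrite sinB sinD; ring.
have S k : \sum_(i < k) sin (i%:R * t) * (2 * sin (t / 2)) =
    cos (t / 2) - cos (k%:R * t - t / 2).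
  elim: k => [|k IH]; first by rewrite big_ord0 mul0r sub0r cosN subrr.
  rewrite big_ord_recr /= IH (_ : k.+1%:R * t - t / 2 = k%:R * t + t / 2); last first.
    by rewrite -natr1; field.
  by rewrite cosB cosD; ring.
have := C n; have := S n; rewrite /fejer -!mulr_suml => {S}S {C}C.
rewrite -(ler_pM2l (_ : 0 < 4 :> R)) //.
set a := n%:R * t - t / 2 in C S.
set x := \sum_(i < n) cos _ in C *; set y := \sum_(i < n) sin _ in S *.
set s := sin (t / 2) in C S *; set c := cos (t / 2) in S.
have -> : 4 * (s ^+ 2 * (x ^+ 2 + y ^+ 2)) =
   (x * (2 * s)) ^+ 2 + (y * (2 * s)) ^+ 2 by ring.
rewrite C S.
have h1 : cos a ^+ 2 + sin a ^+ 2 = 1 by rewrite cos2Dsin2.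
have h2 : c ^+ 2 + s ^+ 2 = 1 by rewrite cos2Dsin2.
have := sqr_ge0 (sin a - s); have := sqr_ge0 (cos a + c).
nra.
Qed.

(** The squared kernel has degree below 2n, so the grid may be moved to contain the angle 0, whose
    single term is already n^4. *)
Lemma jackson_average n t : (0 < n)%N ->
  n%:R ^+ 4 <= \sum_(i < n.*2) fejer n (t + 2 * pi * i%:R / n.*2%:R) ^+ 2.
Proof.
move=> n0; have L0 : (0 < n.*2)%N by lia.
have [a aE] := trig_polyM (fejer_trig n) (fejer_trig n).
rewrite (@trig_poly_grid_const _ (n + n).-1 (fun t => fejer n t ^+ 2)) //; first last.
- by exists a => u; rewrite -aE expr2.
- lia.
rewrite (bigD1 (Ordinal L0)) //= mulr0 mul0r fejer0 -exprM lerDl.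
by apply: sumr_ge0 => i _; apply: exprn_ge0; exact: fejer_ge0.
Qed.

(** With s the sine, s <= (n/2) s^2 + 1/(2n). In the quadratic part [fejer_sin] removes one Fejer
    factor and the other averages to n, which gives n^3, at most 1/n times the total mass by
    [jackson_average]. The two parts contribute 1 and 1/2 to the constant 3/2. *)
Lemma jackson_moment n t : (0 < n)%N ->
  \sum_(i < n.*2) `|sin ((t + 2 * pi * i%:R / n.*2%:R) / 2)| *
     fejer n (t + 2 * pi * i%:R / n.*2%:R) ^+ 2 <=
  3 / 2 / n%:R * \sum_(i < n.*2) fejer n (t + 2 * pi * i%:R / n.*2%:R) ^+ 2.
Proof.
move=> n0; have nR : 0 < (n%:R : R) by rewrite ltr0n.
set th := fun i => _; set J := fun i => fejer n (t + 2 * pi * i%:R / n.*2%:R).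
have hi (i : 'I_n.*2) : `|sin ((t + 2 * pi * i%:R / n.*2%:R) / 2)| * J i ^+ 2 <=
    n%:R / 2 * J i + (2 * n%:R)^-1 * J i ^+ 2.
  set s := `|_|; have := fejer_sin n (t + 2 * pi * i%:R / n.*2%:R).
  rewrite -/(J i) -(real_normK (num_real (sin _))) -/s => h.
  have J0 : 0 <= J i by exact: fejer_ge0.
  have s0 : 0 <= s by exact: normr_ge0.
  have h2 : s <= n%:R / 2 * s ^+ 2 + (2 * n%:R)^-1.
    rewrite -subr_ge0 (_ : _ - s = (n%:R * s - 1) ^+ 2 / (2 * n%:R)); last first.
      by field; rewrite gt_eqF.
    by rewrite divr_ge0 ?sqr_ge0 // mulr_ge0 // ltW.
  have h3 : s * J i ^+ 2 <= (n%:R / 2 * s ^+ 2 + (2 * n%:R)^-1) * J i ^+ 2.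
    by apply: ler_wpM2r => //; exact: sqr_ge0.
  apply: (le_trans h3); rewrite mulrDl lerD2r.
  have -> : n%:R / 2 * s ^+ 2 * J i ^+ 2 = n%:R / 2 * J i * (s ^+ 2 * J i) by ring.
  by rewrite ler_piMr // mulr_ge0 // divr_ge0 // ltW.
apply: (le_trans (ler_sum _ (fun i _ => hi i))).
rewrite big_split /= -!mulr_sumr -/(J _) fejer_average; [|lia|lia].
have := jackson_average t n0; set Sg := \sum_(i < n.*2) _ => hS.
rewrite -(ler_pM2r nR).
have -> : 3 / 2 / n%:R * Sg * n%:R = 3 / 2 * Sg by field; rewrite gt_eqF.
have -> : (n%:R / 2 * (n.*2%:R * n%:R) + (2 * n%:R)^-1 * Sg) * n%:R =
   n%:R ^+ 4 + Sg / 2.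
  by rewrite -mul2n natrM; field; rewrite gt_eqF.
lra.
Qed.

Lemma abs_sinB t u : `| `|sin t| - `|sin u| | <= `|sin (t - u)|.
Proof.
have h a b : `|sin a| <= `|sin (a - b)| + `|sin b| :> R.
  rewrite -{1}(subrK b a) [sin (_ + b)]sinD.
  apply: (le_trans (ler_normD _ _)); rewrite !normrM.
  have c1 x : `|cos x| <= 1 :> R by rewrite ler_norml cos_geN1 cos_le1.
  apply: lerD; first by rewrite ler_piMr.
  by rewrite ler_piMl.
rewrite ler_norml; have := h t u; have := h u t.
by rewrite -[sin (u - t)]opprK -sinN opprB normrN; lra.
Qed.

(* The convolution of [F] with the square of the Fejer kernel, taken over a
   uniform grid of the angle [t], where [mu = sin^2 (t / 2)]; evenness in [t]
   makes it a polynomial in [mu]. *)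
Lemma weighted_jackson n F A : (0 < n)%N -> 0 <= A ->
  (forall mu nu, 0 < mu <= 1 -> 0 <= nu <= 1 ->
    Num.sqrt mu * `|F mu - F nu| <= A * `|Num.sqrt mu - Num.sqrt nu|) ->
  exists2 p : {poly R}, (size p <= n.*2)%N &
    forall mu, 0 < mu <= 1 -> Num.sqrt mu * `|F mu - p.[mu]| <= 3 / 2 * A / n%:R.
Proof.
move=> n0 A0 hF; have nR : 0 < (n%:R : R) by rewrite ltr0n.
pose J t := fejer n t ^+ 2; pose th i : R := 2 * pi * i%:R / n.*2%:R.
pose S := \sum_(i < n.*2) J (th i).
have JT : is_trig_poly n.*2 J.
  have [a aE] := trig_polyM (fejer_trig n) (fejer_trig n).
  exists (fun q => if (q < (n + n).-1)%N then a q else 0) => t.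
  rewrite /J expr2 aE -addnn (big_ord_widen _ (fun q => a q * cos (q%:R * t)) (leq_pred _)).
  rewrite big_mkcond /=; apply: eq_bigr => i _.
  by case: ifP; rewrite // mul0r.
have JS t : \sum_(i < n.*2) J (t + th i) = S.
  by apply: trig_poly_grid_const JT => //; lia.
have Jneg t : J (- t) = J t.
  by case: JT => a aE; rewrite !aE; apply: eq_bigr => q _; rewrite mulrN cosN.
have JS' t : \sum_(i < n.*2) J (t - th i) = S.
  rewrite -(JS (- t)); apply: eq_bigr => i _.
  by rewrite -[in RHS]Jneg opprD !opprK.
have S0 : 0 < S.
  have := jackson_average 0 n0; rewrite (JS 0); apply: lt_le_trans.
  by rewrite exprn_gt0.
pose G i := F (sin (th i / 2) ^+ 2).
have [a aE] := JT.
have /choice[q qP] : forall k, exists p : {poly R}, (size p <= k.+1)%N /\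
    forall t, p.[sin (t / 2) ^+ 2] = cos (k%:R * t).
  by move=> k; have [p ? ?] := cos_poly k; exists p.
pose p : {poly R} := S^-1 *: \sum_(i < n.*2) G i *: \sum_(k < n.*2)
   (a k * cos (k%:R * th i)) *: q k.
exists p.
  rewrite (leq_trans (size_scale_leq _ _)) //.
  apply: (big_ind (fun p : {poly R} => (size p <= n.*2)%N)); first by rewrite size_poly0.
    by move=> x y hx hy; rewrite (leq_trans (size_polyD _ _)) // geq_max hx.
  move=> i _; rewrite (leq_trans (size_scale_leq _ _)) //.
  apply: (big_ind (fun p : {poly R} => (size p <= n.*2)%N)); first by rewrite size_poly0.
    by move=> x y hx hy; rewrite (leq_trans (size_polyD _ _)) // geq_max hx.
  move=> k _; rewrite (leq_trans (size_scale_leq _ _)) //.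
  by rewrite (leq_trans (qP k).1).
move=> mu /andP[mu0 mu1].
have sm : 0 < Num.sqrt mu <= 1 by rewrite sqrtr_gt0 mu0 -sqrtr1 ler_wsqrtr.
pose t := 2 * asin (Num.sqrt mu).
have st : sin (t / 2) = Num.sqrt mu.
  rewrite /t (_ : 2 * _ / 2 = asin (Num.sqrt mu)); last by field.
  by rewrite asinK // in_itv /=; apply/andP; split; lra.
have mt : mu = sin (t / 2) ^+ 2 by rewrite st sqr_sqrtr // ltW.
(* Averaging over both signs of [th i] leaves cos(kt) cos(k th i) at each frequency, hence a
   polynomial in mu = sin^2(t/2). *)
pose Ke i := 2^-1 * (J (t - th i) + J (t + th i)).
have Ke0 i : 0 <= Ke i.
  by rewrite mulr_ge0 ?invr_ge0 // addr_ge0 // sqr_ge0.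
have KeS : \sum_(i < n.*2) Ke i = S.
  by rewrite -mulr_sumr big_split /= JS JS'; field.
have pE : p.[mu] = S^-1 * \sum_(i < n.*2) G i * Ke i.
  rewrite hornerZ horner_sum; congr (_ * _); apply: eq_bigr => i _.
  rewrite hornerZ horner_sum; congr (_ * _).
  rewrite /Ke !aE -big_split /= mulr_sumr; apply: eq_bigr => k _.
  by rewrite hornerZ mt (qP k).2 (mulrBr k%:R) cosB (mulrDr k%:R) cosD; field.
have -> : F mu - p.[mu] = S^-1 * \sum_(i < n.*2) (F mu - G i) * Ke i.
  rewrite pE; under [in RHS]eq_bigr do rewrite mulrBl.
  by rewrite sumrB -mulr_sumr KeS; field; rewrite gt_eqF.
rewrite normrM gtr0_norm ?invr_gt0 // mulrCA mulrC ler_pdivrMr //.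
(* Since sqrt mu = |sin(t/2)|, the hypothesis on [F] bounds the difference by the sine of half of t
   - th i and also of t + th i; each half of [Ke] is paired with its own shift. *)
have hk i : Num.sqrt mu * `|(F mu - G i) * Ke i| <=
   A / 2 * (`|sin ((t - th i) / 2)| * J (t - th i) +
            `|sin ((t + th i) / 2)| * J (t + th i)).
  rewrite normrM (ger0_norm (Ke0 i)) mulrA.
  have h1 : Num.sqrt mu * `|F mu - G i| <=
     A * `| `|sin (t / 2)| - `|sin (th i / 2)| |.
    have := hF mu (sin (th i / 2) ^+ 2); rewrite mu0 mu1 sqr_ge0 /= => /(_ isT).
    rewrite sin2cos2 gerBl sqr_ge0 -sin2cos2 sqrtr_sqr => /(_ isT).
    by rewrite st (gtr0_norm (andP sm).1).
  have h2 : `| `|sin (t / 2)| - `|sin (th i / 2)| | <= `|sin ((t - th i) / 2)|.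
    by rewrite (le_trans (abs_sinB _ _)) // mulrBl.
  have h3 : `| `|sin (t / 2)| - `|sin (th i / 2)| | <= `|sin ((t + th i) / 2)|.
    have := abs_sinB (t / 2) (- (th i / 2)).
    by rewrite sinN normrN opprK mulrDl.
  have j1 : 0 <= J (t - th i) by exact: sqr_ge0.
  have j2 : 0 <= J (t + th i) by exact: sqr_ge0.
  apply: (le_trans (ler_wpM2r (Ke0 i) h1)); rewrite /Ke.
  set D := `| _ - _ | in h2 h3 *.
  have -> : A * D * (2^-1 * (J (t - th i) + J (t + th i))) =
     A / 2 * (D * J (t - th i) + D * J (t + th i)) by field.
  apply: ler_wpM2l; first by rewrite divr_ge0.
  by apply: lerD; apply: ler_wpM2r.
rewrite (le_trans (ler_wpM2l _ (ler_norm_sum _ _ _))) ?sqrtr_ge0 //.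
rewrite mulr_sumr.
apply: (le_trans (ler_sum _ (fun (i : 'I_n.*2) _ => hk i))).
rewrite -mulr_sumr big_split /=.
have m1 := jackson_moment t n0; rewrite -!/(th _) -!/(J _) in m1.
have m2 := jackson_moment (- t) n0.
have e2 : \sum_(i < n.*2) `|sin ((- t + th i) / 2)| * J (- t + th i) =
    \sum_(i < n.*2) `|sin ((t - th i) / 2)| * J (t - th i).
  apply: eq_bigr => i _; rewrite -(Jneg (- t + _)) opprD opprK; congr (_ * _).
  by rewrite -normrN -sinN -mulNr opprD opprK.
rewrite -[X in X <= _]/(\sum_(i < n.*2) `|sin ((- t + th i) / 2)| * J (- t + th i)) e2 in m2.
rewrite -[X in _ <= _ * X]/(\sum_(i < n.*2) J (- t + th i)) JS in m2.
rewrite -[X in X <= _]/(\sum_(i < n.*2) `|sin ((t + th i) / 2)| * J (t + th i)) in m1.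
rewrite -[X in _ <= _ * X]/(\sum_(i < n.*2) J (t + th i)) JS in m1.
set x := \sum_(i < _) _ in m2 *; set y := \sum_(i < _) _ in m1 *.
have -> : 3 / 2 * A / n%:R * S = A / 2 * (3 / 2 / n%:R * S + 3 / 2 / n%:R * S) by field; rewrite gt_eqF.
by apply: ler_wpM2l; [rewrite divr_ge0|exact: lerD].
Qed.

End Jackson.

(** * Gauss quadrature *)

Section Integrals.
Context {R : realType}.
Local Notation leb := (@lebesgue_measure R).
Implicit Types (a b s t x : R) (f g F : R -> R).

Lemma FTC_C1 f F a b : a <= b -> (forall x, a <= x <= b -> is_derive x 1 F (f x)) ->
  (forall x, a <= x <= b -> {for x, continuous f}) ->
  \int[leb]_(x in `[a, b]) f x = F b - F a.
Proof.
rewrite le_eqVlt => /predU1P[->|ab] dF cf.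
  by rewrite set_itv1 Rintegral_set1 subrr.
rewrite /Rintegral (continuous_FTC2 (F := F)) //.
- apply/subspace_continuousP => x /= xab; apply: cvg_within_filter.
  by apply: cf; move: xab; rewrite in_itv.
- split.
  + move=> x; rewrite in_itv /= => /andP[ax xb].
    by have [] := dF x; rewrite ?ltW.
  + apply: cvg_at_right_filter; apply: differentiable_continuous.
    by apply/derivable1_diffP; have [] := dF a; rewrite ?lexx ?ltW.
  + apply: cvg_at_left_filter; apply: differentiable_continuous.
    by apply/derivable1_diffP; have [] := dF b; rewrite ?lexx ?ltW.
- move=> x; rewrite in_itv /= => /andP[ax xb].
  rewrite derive1E; have d := dF x; rewrite !ltW // in d.
  by have /@derive_val := d isT.
Qed.

Lemma continuous_integrable f a b : {in `[a, b], forall x, {for x, continuous f}} ->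
  leb.-integrable `[a, b] (EFin \o f).
Proof.
move=> cf; apply: continuous_compact_integrable; first exact: segment_compact.
apply/subspace_continuousP => x /= xab; apply: cvg_within_filter.
by apply: cf; rewrite inE.
Qed.

Lemma integrable_EFinZ (D : set R) c f : measurable D -> leb.-integrable D (EFin \o f) ->
  leb.-integrable D (EFin \o (fun x => c * f x)).
Proof.
move=> mD intf; rewrite (_ : EFin \o _ = (fun x => c%:E * (EFin \o f) x)%E) //.
exact: integrableZl.
Qed.

Lemma integrable_EFinB (D : set R) f g : measurable D -> leb.-integrable D (EFin \o f) ->
  leb.-integrable D (EFin \o g) -> leb.-integrable D (EFin \o (fun x => f x - g x)).
Proof.
move=> mD fi gi; rewrite (_ : EFin \o _ = ((EFin \o f) \- (EFin \o g))%E) //.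
exact: integrableB.
Qed.

Lemma integral_poly_monomial (k : nat) : \int[leb]_(x in `[0, 1]) x ^+ k = k.+1%:R^-1.
Proof.
pose p : {poly R} := k.+1%:R^-1 *: 'X^(k.+1).
have pE x : p^`().[x] = x ^+ k.
  rewrite derivZ derivXn /= hornerZ hornerMn hornerXn -[x ^+ k *+ _]mulr_natl mulrA mulVf ?mul1r //.
transitivity (p.[1] - p.[0]); last first.
  by rewrite !hornerZ !hornerXn expr1n expr0n /= mulr1 mulr0 subr0.
apply: FTC_C1 => // x _; first by rewrite -pE; exact: is_derive_poly.
exact: exprn_continuous.
Qed.

Lemma cvg_powRN a : 0 < a -> t `^ (- a) @[t --> +oo] --> (0 : R).
Proof.
move=> a0; apply/cvgr0Pnorm_le => e e0.
exists ((e^-1) `^ a^-1); split; first exact: num_real.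
move=> t /= et; have t0 : 0 < t by apply: le_lt_trans et; exact: powR_ge0.
rewrite ger0_norm ?powR_ge0 // powRN -[leRHS]invrK lef_pV2 ?posrE ?invr_gt0 ?powR_gt0 //.
apply: (@le_trans _ _ ((e^-1 `^ a^-1) `^ a)).
  by rewrite -powRrM mulVf ?gt_eqF // powRr1 // invr_ge0 ltW.
by apply: ge0_ler_powR; rewrite ?nnegrE ?powR_ge0 // ltW.
Qed.

Lemma integral_powR_tail a : 0 < a ->
  (\int[leb]_(t in `[1%R, +oo[) ((t `^ (- (1 + a)))%:E) = (a^-1)%:E)%E.
Proof.
move=> a0; pose F t := (- a^-1) * t `^ (- a).
have dF t : 0 < t -> is_derive t 1 F (t `^ (- (1 + a))).
  move=> t0; have := is_deriveZ (- a^-1) (is_derive1_powR (- a) t0).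
  rewrite /F /GRing.scale /= mulrA mulrNN mulVf ?gt_eqF // mul1r opprD addrC.
  by [].
rewrite (ge0_continuous_FTC2y (F := F) (l := 0)) //.
- by rewrite /F powR1 mulr1 sub0e -EFinN opprK.
- by move=> t _; exact: powR_ge0.
- apply/subspace_continuousP => x /=; rewrite in_itv /= andbT => x1.
  apply: cvg_within_filter; apply: differentiable_continuous.
  have x0 : 0 < x by apply: lt_le_trans x1.
  by apply/derivable1_diffP; have [] := is_derive1_powR (- (1 + a)) x0.
- rewrite -[X in _ --> X](mulr0 (- a^-1)); apply: cvgM; first exact: cvg_cst.
  exact: cvg_powRN.
- by move=> t t1; have [] := dF t (lt_trans ltr01 t1).
- apply: cvg_at_right_filter; apply: differentiable_continuous.
  by apply/derivable1_diffP; have [] := dF 1 ltr01.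
- move=> t; rewrite in_itv /= andbT => t1; rewrite derive1E.
  exact: (@derive_val _ _ _ _ _ _ _ (dF t (lt_trans ltr01 t1))).
Qed.

Lemma integrable_powR_tail a : 0 < a ->
  leb.-integrable `[1%R, +oo[ (fun t => (t `^ (- (1 + a)))%:E).
Proof.
move=> a0; apply/integrableP; split.
  apply/measurable_EFinP; apply: measurable_funTS; exact: measurable_powR.
under eq_integral do rewrite abse_EFin ger0_norm ?powR_ge0 //.
by rewrite integral_powR_tail // ltry.
Qed.

Lemma Rintegral_powR_tail a : 0 < a ->
  \int[leb]_(t in `[1, +oo[) (t `^ (- (1 + a))) = a^-1.
Proof. by move=> a0; rewrite /Rintegral integral_powR_tail. Qed.

Lemma powR_tail_inv (k : nat) t : 0 < t -> (t^-1) ^+ 2 * (t^-1) ^+ k = t `^ (- (1 + k.+1%:R)).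
Proof.
move=> t0; rewrite -exprD exprVn (_ : 1 + k.+1%:R = k.+2%:R :> R); last by rewrite -(natr1 k.+1) addrC.
by rewrite powR_invn // ltW.
Qed.

Lemma integrable_sum_fun (D : set R) (mD : measurable D) (I : Type) (r : seq I) (f : I -> R -> R) :
  (forall i, leb.-integrable D (EFin \o f i)) ->
  leb.-integrable D (EFin \o (fun x => \sum_(i <- r) f i x)).
Proof.
move=> fi; rewrite (_ : EFin \o _ = (fun x => \sum_(i <- r) (f i x)%:E)%E); last first.
  by apply/funext => x; rewrite /= sumEFin.
by apply: integrable_sum => // i _; exact: fi.
Qed.

Lemma Rintegral_sum (D : set R) (mD : measurable D) (I : Type) (r : seq I) (f : I -> R -> R) :
  (forall i, leb.-integrable D (EFin \o f i)) ->
  \int[leb]_(x in D) (\sum_(i <- r) f i x) = \sum_(i <- r) \int[leb]_(x in D) f i x.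
Proof.
move=> fi; elim: r => [|i r IH].
  rewrite big_nil; under eq_Rintegral do rewrite big_nil.
  by rewrite Rintegral_cst // mul0r.
rewrite big_cons -IH -RintegralD //; last exact: integrable_sum_fun.
by apply: eq_Rintegral => x _; rewrite big_cons.
Qed.

(** The substitution x = 1/t, checked on monomials, where both sides are 1/(k + 1). It moves
    integrals over directions in [0,1] to the half-line on which [E1] is defined. *)
Lemma integrable_poly_tail (p : {poly R}) :
  leb.-integrable `[1%R, +oo[ (EFin \o (fun t => (t^-1) ^+ 2 * p.[t^-1])) /\
  \int[leb]_(t in `[1, +oo[) ((t^-1) ^+ 2 * p.[t^-1]) = \int[leb]_(x in `[0, 1]) p.[x].
Proof.
pose m (i : nat) t : R := p`_i * t `^ (- (1 + i.+1%:R)).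
have im i : leb.-integrable `[1%R, +oo[ (EFin \o m i).
  by apply: integrable_EFinZ => //; apply: integrable_powR_tail; rewrite ltr0n.
have ix (i : nat) : leb.-integrable `[0%R, 1%R] (EFin \o (fun x => p`_i * x ^+ i)).
  apply: continuous_integrable => x _; apply: cvgM; first exact: cvg_cst.
  exact: exprn_continuous.
have E : {in `[1, +oo[, forall t, (t^-1) ^+ 2 * p.[t^-1] = \sum_(i < size p) m i t}.
  move=> t; rewrite in_itv /= andbT => t1; rewrite horner_coef mulr_sumr.
  apply: eq_bigr => i _; rewrite mulrCA powR_tail_inv //.
  exact: lt_le_trans t1.
split.
  have IS := integrable_sum_fun _ (index_enum 'I_(size p)) (fun i : 'I_(size p) => im i).
  apply: eq_integrable (IS _) => //.
  by move=> t; rewrite inE /= => /E ->.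
transitivity (\int[leb]_(t in `[1, +oo[) (\sum_(i < size p) m i t)).
  by apply: eq_Rintegral => t; rewrite inE /= => /E.
rewrite Rintegral_sum //.
under [RHS]eq_Rintegral do rewrite horner_coef.
rewrite Rintegral_sum //; apply: eq_bigr => i _.
rewrite RintegralZl //; last by apply: integrable_powR_tail; rewrite ltr0n.
rewrite RintegralZl //; last by apply: continuous_integrable => x _; exact: exprn_continuous.
by rewrite Rintegral_powR_tail ?ltr0n // integral_poly_monomial.
Qed.

End Integrals.

(** * Weights, singular powers and the error of the Gauss rule *)

Section Gauss.
Context {R : realType}.
Local Notation leb := (@lebesgue_measure R).
Implicit Types (mu w : nat -> R) (s t x A : R) (F : R -> R) (k N : nat).

Lemma horner_integrable (p : {poly R}) : leb.-integrable `[0%R, 1%R] (EFin \o (fun x => p.[x])).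
Proof. by apply: continuous_integrable => x _; exact: continuous_horner. Qed.

(** The rule is exact on the square of the k-th Lagrange polynomial, of degree 2N - 2, and only the
    k-th node contributes. *)
Lemma gauss_weight_ge0 N mu w k : gauss_legendre N mu w -> (k < N)%N -> 0 <= w k.
Proof.
move=> [mu01 mu_lt wE] kN.
pose p : {poly R} := \prod_(i < N | i != k :> nat) ('X - (mu i)%:P).
have pk : p.[mu k] != 0.
  rewrite horner_prod; apply/prodf_neq0 => i /eqP ik; rewrite !hornerE subr_eq0.
  have /orP[lt|lt] : (i < k)%N || (k < i)%N by rewrite -neq_ltn; apply/eqP.
    by rewrite gt_eqF // mu_lt // lt.
  by rewrite lt_eqF // mu_lt // lt /=.
have sp : (size (p ^+ 2)%R <= N.*2)%N.
  rewrite (leq_trans (size_poly_exp_leq _ _)) //.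
  have -> : p = \prod_(i <- enum (predC1 (Ordinal kN))) ('X - (mu i)%:P).
    by rewrite big_enum /=; apply: eq_bigl => i; rewrite !inE -val_eqE.
  by rewrite size_prod_XsubC -cardE cardC1 card_ord; lia.
have := wE _ sp; rewrite (bigD1 (Ordinal kN)) //= big1 ?addr0 => [E|i ik]; last first.
  rewrite horner_exp horner_prod (bigD1 i) //=.
  by rewrite hornerXsubC subrr mul0r expr0n mulr0.
suff : 0 <= w k * p.[mu k] ^+ 2.
  by rewrite pmulr_lge0 // exprn_even_gt0.
rewrite -horner_exp E; apply: Rintegral_ge0 => x _; rewrite horner_exp; exact: sqr_ge0.
Qed.

Lemma gauss_weight_sum N mu w : (0 < N)%N -> gauss_legendre N mu w ->
  \sum_(k < N) w k = 1.
Proof.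
move=> N0 [_ _ wE]; have := wE 1; rewrite size_poly1 double_gt0 => /(_ N0).
under eq_bigr do rewrite hornerC mulr1.
move=> ->; under eq_Rintegral do rewrite hornerC.
rewrite Rintegral_cst // mul1r.
transitivity (fine (lebesgue_measure `[0%R, 1%R] : \bar R)); first by [].
by rewrite lebesgue_measure_itv /= lte_fin ltr01 /= subr0.
Qed.

(** With [om] the node polynomial, (om(-t)^2 - om(x)^2) / (t + x) is a polynomial of degree at most
    2N - 1, so it is integrated exactly. It equals om(-t)^2 / (t + x) at the nodes and lies below it
    on [0,1], so the rule underestimates the integral of 1/(t + x). *)
Lemma gauss_resolvent N mu w t : gauss_legendre N mu w -> 0 < t ->
  \sum_(k < N) w k / (t + mu k) <= ln (1 + t^-1).
Proof.
move=> [mu01 mu_lt wE] t0.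
pose om : {poly R} := \prod_(i < N) ('X - (mu i)%:P).
have so : size om = N.+1 by rewrite size_prod_XsubC -[in RHS](size_enum_ord N) enumT.
have omt : om.[- t] ^+ 2 > 0.
  rewrite exprn_even_gt0 //= horner_prod; apply/prodf_neq0 => i _.
  rewrite !hornerE lt_eqF //.
  by have /andP[+ _] := mu01 i (ltn_ord i); lra.
pose q : {poly R} := (om.[- t] ^+ 2)%:P - om ^+ 2.
have /factor_theorem[q1 qE] : root q (- t).
  by rewrite rootE !hornerE subrr.
rewrite polyCN opprK in qE.
have qv x : 0 <= x -> q1.[x] = (om.[- t] ^+ 2 - om.[x] ^+ 2) / (t + x).
  move=> x0; have : q.[x] = q1.[x] * (t + x) by rewrite qE !hornerE addrC.
  rewrite !hornerE => ->; rewrite mulfK // gt_eqF //; lra.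
have sq1 : (size q1 <= N.*2)%N.
  have [->|q10] := eqVneq q1 0; first by rewrite size_poly0.
  have : (size q <= N.*2.+1)%N.
    rewrite (leq_trans (size_polyD _ _)) // geq_max size_polyN.
    rewrite (leq_trans (size_polyC_leq1 _)) //=.
    by rewrite (leq_trans (size_poly_exp_leq _ _)) // so; lia.
  by rewrite qE -[t]opprK polyCN size_Mmonic ?monicXsubC // size_XsubC addn2 ltnS.
have h1 : \sum_(k < N) w k * q1.[mu k] = om.[- t] ^+ 2 * \sum_(k < N) w k / (t + mu k).
  rewrite mulr_sumr; apply: eq_bigr => k _.
  rewrite qv; last by have /andP[/ltW] := mu01 k (ltn_ord k).
  have -> : om.[mu k] = 0.
    by rewrite horner_prod (bigD1 k) //= !hornerE subrr mul0r.
  by rewrite expr0n /= subr0; ring.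
have cont : {in `[0, 1], forall x, {for x, continuous (fun x => (t + x)^-1)}}.
  move=> x; rewrite in_itv /= => /andP[x0 _]; apply: cvgV; first by rewrite gt_eqF //; lra.
  by apply: cvgD; [exact: cvg_cst|exact: cvg_id].
have ic : leb.-integrable `[0%R, 1%R] (EFin \o (fun x => (t + x)^-1)).
  exact: continuous_integrable.
have h2 : \int[leb]_(x in `[0, 1]) q1.[x] <=
    \int[leb]_(x in `[0, 1]) (om.[- t] ^+ 2 * (t + x)^-1).
  apply: le_Rintegral => //; first exact: horner_integrable.
    exact: integrable_EFinZ.
  move=> x /=; rewrite in_itv /= => /andP[x0 _]; rewrite qv //.
  apply: ler_wpM2r; first by rewrite invr_ge0; lra.
  by rewrite gerBl sqr_ge0.
have h3 : \int[leb]_(x in `[0, 1]) (t + x)^-1 = ln (t + 1) - ln (t + 0).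
  apply: (FTC_C1 (F := fun x => ln (t + x))) => // x xb.
  have tx : 0 < t + x by case/andP: xb; lra.
  have := is_derive1_comp (is_derive1_ln tx) (is_deriveD (is_derive_cst t x 1) (is_derive_id x 1)).
  by rewrite /GRing.scale /= add0r mulr1.
rewrite -(ler_pM2l omt) -h1 wE // (le_trans h2) // RintegralZl // h3 addr0.
rewrite ler_pM2l // -ln_div ?posrE //; last by lra.
by rewrite mulrDl divff ?gt_eqF // mul1r.
Qed.

Lemma ln_le_powR x s : 0 < s -> 1 <= x -> ln x <= s^-1 * x `^ s.
Proof.
move=> s0 x1; rewrite mulrC ler_pdivlMr // mulrC -ln_powR.
by apply: ltW; apply: ln_sublinear; rewrite powR_gt0 //; lra.
Qed.

(** One term suffices: for 2^-(j+1) <= x < 2^-j the j-th resolvent exceeds 2^j / 2, so four times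
    the j-th term is at least 2 times 2^(sj), which bounds x^-s. *)
Lemma powR_le_resolvents s J x : 0 < s < 1 -> 2^-1 ^+ J <= x <= 1 ->
  x `^ (- s) <= 4 * \sum_(j < J.+1) (2 `^ s / 2) ^+ j / (2^-1 ^+ j + x).
Proof.
move=> /andP[s0 s1]; have q0 : 0 <= 2 `^ s / 2 :> R by rewrite divr_ge0 ?powR_ge0.
have q1 : 2 `^ s <= 2 :> R.
  by rewrite -[leRHS]powRr1 //; apply: ler_powR; lra.
elim: J => [|J IH] /andP[xJ x1].
  have -> : x = 1 by apply/eqP; rewrite eq_le x1.
  rewrite powR1 big_ord_recr big_ord0 /= !expr0 add0r (_ : 1 + 1 = 2) //; lra.
have x0 : 0 < x by apply: lt_le_trans xJ; rewrite exprn_gt0.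
have pos j : 0 <= (2 `^ s / 2) ^+ j / (2^-1 ^+ j + x).
  by rewrite divr_ge0 ?exprn_ge0 // addr_ge0 ?exprn_ge0 // ltW.
rewrite big_ord_recr mulrDr /=.
have [le|lt] := leP (2^-1 ^+ J) x.
  by rewrite (le_trans (IH _)) ?le // lerDl mulr_ge0.
rewrite big_ord_recr mulrDr /= -addrA ler_wpDl //.
  by rewrite mulr_ge0 // sumr_ge0 // => i _.
rewrite (@le_trans _ _ (4 * ((2 `^ s / 2) ^+ J / (2^-1 ^+ J + x)))) //; last first.
  by rewrite lerDl mulr_ge0.
have h : x `^ (- s) <= 2 `^ s * (2 `^ s) ^+ J.
  rewrite -exprS powRN -[leRHS]invrK lef_pV2 ?posrE ?powR_gt0 ?invr_gt0 ?exprn_gt0 ?powR_gt0 //.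
  have -> : 2 `^ s ^- J.+1 = (2^-1 ^+ J.+1) `^ s.
    by rewrite exprVn -(powR_invn _ (powR_ge0 2 s)) -(powR_invn _ (ler0n R 2)) powRAC.
  by apply: ge0_ler_powR; rewrite ?nnegrE ?exprn_ge0 // ltW.
apply: (le_trans h); rewrite expr_div_n mulrA ler_pdivlMr; last first.
  by rewrite addr_gt0 // exprn_gt0.
rewrite -exprVn.
set Q := (2 `^ s) ^+ J; have Q0 : 0 <= Q by rewrite exprn_ge0 // powR_ge0.
set e := 2^-1 ^+ J in lt *.
have e0 : 0 < e by rewrite exprn_gt0.
have h1 : 2 `^ s * Q * (e + x) <= 2 * Q * (e + x).
  by rewrite ler_wpM2r ?ler_wpM2r //; lra.
have h2 : 2 * Q * (e + x) <= 2 * Q * (e + e).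
  by rewrite ler_wpM2l ?mulr_ge0 //; lra.
lra.
Qed.

(** After [powR_le_resolvents] the j-th resolvent carries the factor 2^((s-1)j) = q^(2j), and its
    quadrature sum is at most ln(1 + 2^j). The logarithm is absorbed by q^-j, up to a constant, and
    a geometric series in q remains. *)
Lemma gauss_powR s : 0 < s < 1 -> exists2 C : R, 0 < C &
  forall N mu w, gauss_legendre N mu w -> \sum_(k < N) w k * mu k `^ (- s) <= C.
Proof.
move=> s01; have /andP[s0 s1] := s01; pose a : R := (1 - s) / 2; have a0 : 0 < a by rewrite /a; lra.
pose q : R := 2 `^ (- a).
have q0 : 0 < q by rewrite powR_gt0.
have q1 : q < 1.
  by rewrite /q powRN invf_lt1 ?powR_gt0 // -[X in X < _](congr1 (fun g => g a) (@powR1 R)) gt0_ltr_powR ?nnegrE //; lra.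
have qq : 2 `^ s / 2 = q ^+ 2.
  rewrite -powR_mulrn ?ltW // /q -powRrM -{2}[2]powRr1 // -powRN -powRD ?pnatr_eq0 ?implybT //.
  by congr (_ `^ _); rewrite /a; field.
exists (4 * (2 / a * (1 - q)^-1)); first by rewrite !mulr_gt0 ?invr_gt0 // subr_gt0.
move=> N mu w gl; have [mu01 _ _] := gl.
(* [J] depends on the smallest node of the rule; the final bound is that of the full geometric
   series and does not depend on [J]. *)
have [J hJ] : exists J, forall k, (k < N)%N -> 2^-1 ^+ J <= mu k.
  have h k : exists j, (k < N)%N -> 2^-1 ^+ j <= mu k.
    have [kN|] := ltnP k N; last by exists 0%N.
    have /andP[m0 _] := mu01 k kN.
    have : (fun n => (2^-1 : R) ^+ n) @ \oo --> (0 : R).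
      by apply: cvg_expr; rewrite ger0_norm ?invr_ge0 //; lra.
    move=> /cvgr0Pnorm_le /(_ _ m0)[j _ /(_ j (leqnn j))] /=.
    by rewrite ger0_norm ?exprn_ge0 // => le; exists j.
  have [j jP] := choice h.
  exists (\sum_(k < N) j k)%N => k kN; apply: le_trans (jP k kN).
  apply: ler_wiXn2l; [lra|lra|].
  by rewrite (bigD1 (Ordinal kN)) //= leq_addr.
have h1 k : (k < N)%N -> w k * mu k `^ (- s) <=
    4 * \sum_(j < J.+1) q ^+ 2 ^+ j * (w k / (2^-1 ^+ j + mu k)).
  move=> kN; have wk := gauss_weight_ge0 gl kN; have /andP[m0 m1] := mu01 k kN.
  have := @powR_le_resolvents s J (mu k) s01; rewrite hJ // ltW // => /(_ isT) h.
  apply: (le_trans (ler_wpM2l wk h)); rewrite mulrCA mulr_sumr qq.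
  by apply: le_of_eq; congr (_ * _); apply: eq_bigr => j _; ring.
apply: (le_trans (ler_sum _ (fun (k : 'I_N) _ => h1 k (ltn_ord k)))).
rewrite -mulr_sumr ler_wpM2l // exchange_big /=.
have h2 (j : nat) : \sum_(k < N) q ^+ 2 ^+ j * (w k / (2^-1 ^+ j + mu k)) <= 2 / a * q ^+ j.
  rewrite -mulr_sumr.
  have := @gauss_resolvent N mu w (2^-1 ^+ j) gl; rewrite exprn_gt0 // => /(_ isT) h.
  rewrite exprVn invrK in h.
  have p1 : 1 <= 2 ^+ j :> R by apply: exprn_ege1; lra.
  have h3 : ln (1 + 2 ^+ j) <= a^-1 * (2 * (2 `^ a) ^+ j).
    apply: (le_trans (ln_le_powR a0 _)); first by lra.
    rewrite ler_wpM2l ?invr_ge0 ?(ltW a0) //.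
    apply: (@le_trans _ _ ((2 * 2 ^+ j) `^ a)).
      by apply: ge0_ler_powR; rewrite ?nnegrE ?(ltW a0) //; lra.
    rewrite powRM ?exprn_ge0 //; apply: ler_pM; rewrite ?powR_ge0 //.
      by rewrite -[leRHS]powRr1 //; apply: ler_powR; rewrite /a; lra.
    by rewrite -(powR_mulrn j (powR_ge0 _ _)) -(powR_mulrn j (ler0n R 2)) powRAC.
  have -> : 2 / a * q ^+ j = q ^+ 2 ^+ j * (a^-1 * (2 * (2 `^ a) ^+ j)).
    have -> : 2 `^ a = q^-1 by rewrite /q powRN invrK.
    rewrite exprVn -exprM mulnC exprM expr2; field.
    by rewrite !gt_eqF ?exprn_gt0.
  rewrite ler_wpM2l ?exprn_ge0 ?(ltW q0) //.
  by rewrite exprVn; exact: le_trans h h3.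
apply: (le_trans (ler_sum _ (fun (j : 'I_J.+1) _ => h2 j))).
have q1' : 0 < 1 - q by rewrite subr_gt0.
rewrite -mulr_sumr; apply: ler_wpM2l; first by rewrite divr_ge0 // ltW.
rewrite -(ler_pM2l q1') divff ?gt_eqF //.
have := subrX1 q J.+1; set S := \sum_(i < J.+1) _ => E.
have : 0 <= q ^+ J.+1 by rewrite exprn_ge0 // ltW.
lra.
Qed.

(** The weighted Jackson polynomial with n = N has size at most 2N, so the rule integrates it
    exactly. The remainder is of order mu^(-1/2) A / N: the quadrature sum costs the constant of
    [gauss_powR] at 1/2, and the integral costs 2. *)
Lemma gauss_error : exists2 C : R, 0 < C &
  forall N mu w F A, (0 < N)%N -> gauss_legendre N mu w -> 0 <= A ->
  (forall x y : R, 0 < x <= 1 -> 0 <= y <= 1 ->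
    Num.sqrt x * `|F x - F y| <= A * `|Num.sqrt x - Num.sqrt y|) ->
  leb.-integrable `[1%R, +oo[ (EFin \o (fun t => (t^-1) ^+ 2 * F t^-1)) ->
  `|\sum_(k < N) w k * F (mu k) - \int[leb]_(t in `[1, +oo[) ((t^-1) ^+ 2 * F t^-1)| <=
  C * (A / N%:R).
Proof.
have [|C C0 hC] := @gauss_powR 2^-1; first by apply/andP; split; lra.
exists (3 / 2 * (C + 2)); first by rewrite mulr_gt0 // addr_gt0.
move=> N mu w F A N0 gl A0 hF iF; have [mu01 _ wE] := gl.
have [p sp hp] := weighted_jackson N0 A0 hF.
have [ip pE] := integrable_poly_tail p.
set B := 3 / 2 * A / N%:R in hp.
have B0 : 0 <= B by rewrite divr_ge0 // mulr_ge0 // divr_ge0.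
have hp2 x : 0 < x <= 1 -> `|F x - p.[x]| <= B * x `^ (- 2^-1).
  move=> /andP[x0 x1]; rewrite powRN powR12_sqrt ?(ltW x0) // ler_pdivlMr ?sqrtr_gt0 // mulrC.
  by apply: hp; rewrite x0.
have h1 : `|\sum_(k < N) w k * F (mu k) - \sum_(k < N) w k * p.[mu k]| <= B * C.
  rewrite -sumrB (le_trans (ler_norm_sum _ _ _)) //.
  apply: (@le_trans _ _ (\sum_(k < N) B * (w k * mu k `^ (- 2^-1)))); last first.
    by rewrite -mulr_sumr ler_wpM2l // hC.
  apply: ler_sum => k _; have wk := gauss_weight_ge0 gl (ltn_ord k).
  have /andP[m0 m1] := mu01 k (ltn_ord k).
  rewrite -mulrBr normrM ger0_norm // mulrCA ler_wpM2l // hp2 // m0 ltW //.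
have h2 : `|\int[leb]_(t in `[1, +oo[) ((t^-1) ^+ 2 * p.[t^-1]) -
    \int[leb]_(t in `[1, +oo[) ((t^-1) ^+ 2 * F t^-1)| <= B * 2.
  rewrite -RintegralB //.
  have iD : leb.-integrable `[1%R, +oo[ (EFin \o (fun t =>
     (t^-1) ^+ 2 * p.[t^-1] - (t^-1) ^+ 2 * F t^-1)).
    exact: integrable_EFinB.
  have i2 : leb.-integrable `[1%R, +oo[ (EFin \o (fun t => B * t `^ (- (1 + 2^-1)))).
    by apply: integrable_EFinZ => //; exact: integrable_powR_tail.
  apply: (le_trans (le_normr_Rintegral _ iD)) => //.
  apply: (@le_trans _ _ (\int[leb]_(t in `[1, +oo[) (B * t `^ (- (1 + 2^-1))))).
    apply: le_Rintegral => //; first exact: integrable_norm.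
    move=> t /=; rewrite in_itv /= andbT => t1; have t0 : 0 < t by lra.
    rewrite -mulrBr normrM ger0_norm ?exprn_ge0 ?invr_ge0 ?(ltW t0) // distrC.
    have ht : 0 < t^-1 <= 1 by rewrite invr_gt0 t0 invf_le1.
    apply: (le_trans (ler_wpM2l _ (hp2 _ ht))); first by rewrite exprn_ge0 // invr_ge0 ltW.
    rewrite mulrCA ler_wpM2l // -[t^-1]powR_inv1 ?(ltW t0) // -powR_mulrn ?powR_ge0 // -!powRrM.
    rewrite -powRD; last by apply/implyP => _; rewrite gt_eqF.
    by rewrite (_ : -1 * 2%:R + -1 * - 2^-1 = - (1 + 2^-1) :> R) //; field.
  rewrite RintegralZl //; last exact: integrable_powR_tail.
  by rewrite Rintegral_powR_tail ?invrK.
rewrite pE -wE // in h2.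
have := ler_normD (\sum_(k < N) w k * F (mu k) - \sum_(k < N) w k * p.[mu k])
  (\sum_(k < N) w k * p.[mu k] - \int[leb]_(t in `[1, +oo[) ((t^-1) ^+ 2 * F t^-1)).
rewrite addrA subrK => /le_trans; apply.
rewrite (le_trans (lerD h1 h2)) //; apply: le_of_eq.
by rewrite /B; ring.
Qed.

End Gauss.

(** * Diamond-difference sweeps *)

Section Sweeps.
Context {R : realType}.
Implicit Types (h s g f u psi : nat -> R) (m Z G rho : R) (i j k M N n : nat).

(** [u] is indexed by nodes, and [h], [s], [g] by cells; the mean of two consecutive values of [u]
    stands for the midpoint value of a piecewise linear function. *)
Definition sweep M m h s g u :=
  u 0%N = 0 /\ forall j, (j < M)%N ->
    m * (u j.+1 - u j) + h j * s j * ((u j + u j.+1) / 2) = h j * g j.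

(** For sequences indexed by the M cells; the M + 1 nodes are reversed by j |-> M - j instead. *)
Definition revn M (v : nat -> R) j := v (M.-1 - j)%N.

(* The direction [false] is the sweep for [- m], which starts from the node [M]. *)
Definition dsweep M m h s g (b : bool) u :=
  if b then sweep M m h s g u
  else sweep M m (revn M h) (revn M s) (revn M g) (fun j => u (M - j)%N).

Lemma dsweep_false M m h s g u : u M = 0 ->
  (forall j, (j < M)%N ->
    - m * (u j.+1 - u j) + h j * s j * ((u j + u j.+1) / 2) = h j * g j) ->
  dsweep M m h s g false u.
Proof.
move=> u0 hu; split=> /= [|j jM]; first by rewrite subn0.
have e : (M - j = (M.-1 - j).+1)%N by lia.
have := hu (M.-1 - j)%N; rewrite -e subnS predn_sub => /(_ ltac:(lia)) <-.
by rewrite /revn; ring.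
Qed.

Lemma dsweep_falseE M m h s g u : dsweep M m h s g false u ->
  u M = 0 /\ (forall j, (j < M)%N ->
    - m * (u j.+1 - u j) + h j * s j * ((u j + u j.+1) / 2) = h j * g j).
Proof.
case=> /=; rewrite subn0 => u0 hu; split=> // j jM.
have := hu (M.-1 - j)%N ltac:(lia); rewrite /revn.
have -> : (M.-1 - (M.-1 - j) = j)%N by lia.
have -> : (M - (M.-1 - j).+1 = j)%N by lia.
have -> : (M - (M.-1 - j) = j.+1)%N by lia.
by move=> <-; ring.
Qed.

Lemma sum_revn M (F : nat -> R) : \sum_(j < M) F (M.-1 - j)%N = \sum_(j < M) F j.
Proof.
rewrite [RHS](reindex_inj rev_ord_inj) /=; apply: eq_bigr => j _.
by congr F; lia.
Qed.

Section Energy.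
Variables (M : nat) (m : R) (h s g u : nat -> R).
Hypotheses (m0 : 0 < m) (h0 : forall j, (j < M)%N -> 0 < h j)
  (s0 : forall j, (j < M)%N -> 0 < s j).

(** Each cell equation is tested with the mean of its two nodal values: the transport term becomes a
    difference of squares and telescopes. *)
Lemma sweep_energy j : sweep M m h s g u -> (j <= M)%N ->
  m / 2 * u j ^+ 2 + \sum_(i < j) h i * s i * ((u i + u i.+1) / 2) ^+ 2 =
  \sum_(i < j) h i * g i * ((u i + u i.+1) / 2).
Proof.
case=> u0 hu; elim: j => [|j IH] jM; first by rewrite !big_ord0 u0; ring.
by rewrite !big_ord_recr /= -IH 1?ltnW // -mulrA -(hu j jM) /=; field.
Qed.

(** Young's inequality with two parameters: c = 1/2 absorbs half of the dissipation and yields the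
    nonexpansive l2 bound, c = 1 absorbs all of it and leaves the nodal value bounded by a quarter
    of the source norm. *)
Lemma sweep_bounds : sweep M m h s g u ->
  \sum_(i < M) h i * s i * ((u i + u i.+1) / 2) ^+ 2 <= \sum_(i < M) h i * g i ^+ 2 / s i /\
  forall j, (j <= M)%N -> m * u j ^+ 2 <= 2^-1 * \sum_(i < M) h i * g i ^+ 2 / s i.
Proof.
move=> hu.
have pos i : (i < M)%N -> 0 <= h i * g i ^+ 2 / s i.
  move=> iM; have hi := ltW (h0 iM); have si := ltW (s0 iM).
  by rewrite divr_ge0 // mulr_ge0 // sqr_ge0.
have young i (c : R) : (i < M)%N -> 0 < c ->
    h i * g i * ((u i + u i.+1) / 2) <=
    c * (h i * s i * ((u i + u i.+1) / 2) ^+ 2) + (4 * c)^-1 * (h i * g i ^+ 2 / s i).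
  move=> iM c0; set y := _ / 2.
  have hi := h0 iM; have si := s0 iM.
  rewrite -subr_ge0 (_ : _ - _ = h i / (4 * c * s i) * (2 * c * s i * y - g i) ^+ 2).
    by rewrite mulr_ge0 ?sqr_ge0 // divr_ge0 ?ltW // !mulr_gt0.
  by field; rewrite !gt_eqF.
split.
  have := sweep_energy hu (leqnn M); set E := \sum_(i < M) _ => e.
  have h1 : E <= \sum_(i < M) h i * g i * ((u i + u i.+1) / 2).
    by rewrite -e lerDr mulr_ge0 ?sqr_ge0 // divr_ge0 // ltW.
  have h2 := le_trans h1 (ler_sum _ (fun (i : 'I_M) _ => young i 2^-1 (ltn_ord i) ltac:(lra))).
  rewrite big_split /= -!mulr_sumr -/E in h2.
  have e4 : (4 / 2)^-1 = 2^-1 :> R by field.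
  rewrite e4 in h2; lra.
move=> j jM; have := sweep_energy hu jM; set E := \sum_(i < j) _ => e.
have h2 : \sum_(i < j) h i * g i * ((u i + u i.+1) / 2) <=
    \sum_(i < j) (1 * (h i * s i * ((u i + u i.+1) / 2) ^+ 2) + (4 * 1)^-1 * (h i * g i ^+ 2 / s i)).
  by apply: ler_sum => i _; exact: young (leq_trans (ltn_ord i) jM) ltr01.
rewrite big_split /= -!mulr_sumr -/E -e mul1r mulr1 in h2.
have h3 : \sum_(i < j) h i * g i ^+ 2 / s i <= \sum_(i < M) h i * g i ^+ 2 / s i.
  rewrite (big_ord_widen M (fun i => h i * g i ^+ 2 / s i) jM) big_mkcond /=.
  by apply: ler_sum => i _; case: ifP => // _; exact: pos.
lra.
Qed.

End Energy.

Lemma dsweep_bounds M m h s g u b : 0 < m ->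
  (forall j, (j < M)%N -> 0 < h j) -> (forall j, (j < M)%N -> 0 < s j) ->
  dsweep M m h s g b u ->
  \sum_(i < M) h i * s i * ((u i + u i.+1) / 2) ^+ 2 <= \sum_(i < M) h i * g i ^+ 2 / s i /\
  forall j, (j <= M)%N -> m * u j ^+ 2 <= 2^-1 * \sum_(i < M) h i * g i ^+ 2 / s i.
Proof.
move=> m0 h0 s0; case: b => [|hu]; first exact: sweep_bounds.
have h1 : forall j, (j < M)%N -> 0 < revn M h j by move=> j jM; apply: h0; lia.
have h2 : forall j, (j < M)%N -> 0 < revn M s j by move=> j jM; apply: s0; lia.
have [] := sweep_bounds m0 h1 h2 hu.
rewrite (sum_revn M (fun i => h i * g i ^+ 2 / s i)) => e1 e2; split.
  apply: le_trans e1; rewrite -(sum_revn M (fun i => h i * s i * ((u i + u i.+1) / 2) ^+ 2)).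
  apply: le_of_eq; apply: eq_bigr => i _; rewrite /revn.
  have := ltn_ord i => iM.
  have -> : (M - i = (M.-1 - i).+1)%N by lia.
  have -> : (M - i.+1 = (M.-1 - i))%N by lia.
  by rewrite [u _.+1 + _]addrC.
by move=> j jM; have := e2 (M - j)%N; rewrite subKn // => -> //; exact: leq_subr.
Qed.

Lemma jensen_sqr N (w x : nat -> R) : (forall k, (k < N)%N -> 0 <= w k) ->
  \sum_(k < N) w k = 1 -> (\sum_(k < N) w k * x k) ^+ 2 <= \sum_(k < N) w k * x k ^+ 2.
Proof.
move=> w0 w1; set y := \sum_(k < N) _.
have : 0 <= \sum_(k < N) w k * (x k - y) ^+ 2.
  by apply: sumr_ge0 => k _; rewrite mulr_ge0 ?w0 ?sqr_ge0.
have -> : \sum_(k < N) w k * (x k - y) ^+ 2 =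
   \sum_(k < N) (w k * x k ^+ 2 + (w k * x k * (- 2 * y) + w k * y ^+ 2)).
  by apply: eq_bigr => k _; ring.
rewrite !big_split /= -!mulr_suml w1 -/y; lra.
Qed.

Definition sweep_rec m h s g := fix v j : R := if j is j'.+1 then
  ((m - h j' * s j' / 2) * v j' + h j' * g j') / (m + h j' * s j' / 2) else 0.

Lemma sweep_recP M m h s g : 0 < m -> (forall j, (j < M)%N -> 0 < h j) ->
  (forall j, (j < M)%N -> 0 < s j) -> sweep M m h s g (sweep_rec m h s g).
Proof.
move=> m0 hh ss; split => // j jM /=.
have : 0 < m + h j * s j / 2 by rewrite addr_gt0 // divr_gt0 // mulr_gt0 ?hh ?ss.
by move=> p; field; apply: lt0r_neq0; lra.
Qed.

Lemma sweep_rec_unique M m h s g u : 0 < m -> (forall j, (j < M)%N -> 0 < h j) ->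
  (forall j, (j < M)%N -> 0 < s j) -> sweep M m h s g u ->
  forall j, (j <= M)%N -> u j = sweep_rec m h s g j.
Proof.
move=> m0 hh ss [u0 hu]; elim=> [//|j IH] jM /=.
have p : 0 < m + h j * s j / 2 by rewrite addr_gt0 // divr_gt0 // mulr_gt0 ?hh ?ss.
rewrite -IH 1?ltnW //; apply/eqP; rewrite eq_sym -subr_eq0; apply/eqP.
have := hu j jM => e; apply: (mulIf (lt0r_neq0 p)); rewrite mul0r mulrBl mulfVK ?gt_eqF //; lra.
Qed.

Lemma sweep_rec_sum m h s n (a : nat -> R) (G : nat -> nat -> R) j :
  sweep_rec m h s (fun j => \sum_(i < n) a i * G i j) j =
  \sum_(i < n) a i * sweep_rec m h s (G i) j.
Proof.
elim: j => [|j IH] /=; first by rewrite big1 // => i _; rewrite mulr0.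
rewrite IH !mulr_sumr -big_split /= mulr_suml; apply: eq_bigr => i _; ring.
Qed.

Section DiscreteOperator.
Variables (M N : nat) (h s mu w : nat -> R).
Hypotheses (h0 : forall j, (j < M)%N -> 0 < h j) (s0 : forall j, (j < M)%N -> 0 < s j)
  (mu0 : forall k, (k < N)%N -> 0 < mu k) (w0 : forall k, (k < N)%N -> 0 <= w k)
  (w1 : \sum_(k < N) w k = 1).

Definition discrete_Kh g (W : nat -> R) := exists u : bool -> nat -> nat -> R,
  (forall k b, (k < N)%N -> dsweep M (mu k) h s g b (u b k)) /\
  forall i, (i <= M)%N -> W i = 2^-1 * \sum_(k < N) w k * (u true k i + u false k i).

(** The sum over directions is a convex combination, so Jensen's inequality transfers the bound of a
    single sweep. *)
Lemma discrete_Kh_l2 g W : discrete_Kh g W ->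
  \sum_(i < M) h i * s i * ((W i + W i.+1) / 2) ^+ 2 <= \sum_(i < M) h i * g i ^+ 2 / s i.
Proof.
move=> [u [hu WE]].
pose ub b k i := (u b k i + u b k i.+1) / 2.
have jensen i : (i < M)%N -> ((W i + W i.+1) / 2) ^+ 2 <=
    \sum_(k < N) w k * (2^-1 * (ub true k i ^+ 2 + ub false k i ^+ 2)).
  move=> iM; have -> : (W i + W i.+1) / 2 = \sum_(k < N) w k * ((ub true k i + ub false k i) / 2).
    rewrite !WE // 1?ltnW // -mulrDr -big_split /= mulrC mulr_sumr mulr_sumr.
    by apply: eq_bigr => k _; rewrite /ub; field.
  apply: (le_trans (jensen_sqr (fun k => (ub true k i + ub false k i) / 2) w0 w1)); apply: ler_sum => k _.
  rewrite ler_wpM2l ?w0 //; have := sqr_ge0 (ub true k i - ub false k i); lra.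
have h1 (i : 'I_M) : h i * s i * ((W i + W i.+1) / 2) ^+ 2 <=
    \sum_(k < N) w k * (2^-1 * (h i * s i * ub true k i ^+ 2 + h i * s i * ub false k i ^+ 2)).
  have iM := ltn_ord i.
  apply: (le_trans (ler_wpM2l _ (jensen i iM))); first by rewrite ltW // mulr_gt0 ?h0 ?s0.
  by rewrite mulr_sumr; apply: le_of_eq; apply: eq_bigr => k _; ring.
apply: (le_trans (ler_sum _ (fun (i : 'I_M) _ => h1 i))); rewrite exchange_big /=.
rewrite -[leRHS]mul1r -[X in _ <= X * _]w1 mulr_suml; apply: ler_sum => k _.
rewrite -mulr_sumr ler_wpM2l ?w0 // -mulr_sumr big_split /=.
have [e1 _] := dsweep_bounds (mu0 (ltn_ord k)) h0 s0 (hu k true (ltn_ord k)).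
have [e2 _] := dsweep_bounds (mu0 (ltn_ord k)) h0 s0 (hu k false (ltn_ord k)).
rewrite -!/(ub _ _ _) in e1 e2; lra.
Qed.

(** The energy controls m u^2 at every node, so l2 data give nodal values at the price mu^(-1/2), a
    power that the Gauss weights sum. *)
Lemma discrete_Kh_sup g W i : discrete_Kh g W -> (i <= M)%N ->
  `|W i| <= (\sum_(k < N) w k * mu k `^ (- 2^-1)) *
    Num.sqrt (\sum_(j < M) h j * g j ^+ 2 / s j).
Proof.
move=> [u [hu WE]] iM; rewrite WE //; set S := \sum_(j < M) _.
have hb k b : (k < N)%N -> `|u b k i| <= mu k `^ (- 2^-1) * Num.sqrt S.
  move=> kN; have m0 := mu0 kN; have [_ /(_ i iM)] := dsweep_bounds m0 h0 s0 (hu k b kN).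
  rewrite -/S => e; have S0 : 0 <= S.
    have : 0 <= mu k * u b k i ^+ 2 by rewrite mulr_ge0 ?sqr_ge0 // ltW.
    lra.
  rewrite powRN powR12_sqrt ?(ltW m0) // -sqrtr_sqr [leRHS]mulrC ler_pdivlMr ?sqrtr_gt0 //.
  rewrite -sqrtrM ?sqr_ge0 // ler_wsqrtr // mulrC (le_trans e) //; lra.
rewrite normrM ger0_norm ?invr_ge0 // mulr_suml.
rewrite (le_trans (ler_wpM2l _ (ler_norm_sum _ _ _))) ?invr_ge0 // mulr_sumr.
apply: ler_sum => k _; have kN := ltn_ord k.
rewrite normrM ger0_norm ?w0 // -mulrA mulrCA ler_wpM2l ?w0 //.
have := hb k true kN; have := hb k false kN; have := ler_normD (u true k i) (u false k i).
lra.
Qed.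

(* In the [l2] space weighted by [h s] the operator is nonexpansive from [g / s];
   hence the contraction with constant [kappa], unconditionally in [h] and [N]. *)
Lemma discrete_Kh_contraction (kappa : R) (g W d r : nat -> R) : 0 < kappa < 1 ->
  discrete_Kh g W -> (forall j, (j < M)%N -> `|g j| <= kappa * s j * `|d j|) ->
  (forall j, (j < M)%N -> d j = (W j + W j.+1) / 2 + r j) ->
  (1 - kappa) ^+ 2 * \sum_(j < M) h j * s j * d j ^+ 2 <= \sum_(j < M) h j * s j * r j ^+ 2.
Proof.
move=> /andP[k0 k1] KW gd dE; have k1' : 0 < 1 - kappa by lra.
have e1 := discrete_Kh_l2 KW.
have e2 : \sum_(j < M) h j * g j ^+ 2 / s j <= kappa ^+ 2 * \sum_(j < M) h j * s j * d j ^+ 2.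
  rewrite mulr_sumr; apply: ler_sum => j _; have jM := ltn_ord j.
  have hj := h0 jM; have sj := s0 jM.
  rewrite ler_pdivrMr // -(real_normK (num_real (g j))) -(real_normK (num_real (d j))).
  have -> : kappa ^+ 2 * (h j * s j * `|d j| ^+ 2) * s j = h j * (kappa * s j * `|d j|) ^+ 2 by ring.
  by rewrite ler_wpM2l ?(ltW hj) // ler_sqr ?nnegrE // ?gd // !mulr_ge0 // ltW.
(* The weighted inequality (a + b)^2 <= a^2 / kappa + b^2 / (1 - kappa): the factor 1 / kappa still
   leaves kappa < 1 after multiplication by kappa^2. *)
have e3 : \sum_(j < M) h j * s j * d j ^+ 2 <=
    kappa^-1 * \sum_(j < M) h j * s j * ((W j + W j.+1) / 2) ^+ 2 +
    (1 - kappa)^-1 * \sum_(j < M) h j * s j * r j ^+ 2.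
  rewrite !mulr_sumr -big_split /=; apply: ler_sum => j _; have jM := ltn_ord j.
  rewrite dE //; set a := _ / 2; set b := r j.
  rewrite -subr_ge0 (_ : _ - _ = h j * s j / (kappa * (1 - kappa)) * ((1 - kappa) * a - kappa * b) ^+ 2).
    by rewrite mulr_ge0 ?sqr_ge0 // divr_ge0 ?mulr_ge0 // ltW ?h0 ?s0.
  by field; rewrite !gt_eqF.
set D := \sum_(j < M) h j * s j * d j ^+ 2 in e2 e3 *.
set Q := \sum_(j < M) h j * s j * r j ^+ 2 in e3 *.
have e4 : D <= kappa * D + (1 - kappa)^-1 * Q.
  apply: (le_trans e3); rewrite lerD2r ler_pdivrMl //.
  by rewrite mulrA -expr2; exact: le_trans e1 e2.
have e5 : (1 - kappa) * D <= (1 - kappa)^-1 * Q by lra.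
by rewrite expr2 -mulrA -ler_pdivlMl.
Qed.

Definition dsweep_sol m g (b : bool) j : R :=
  if b then sweep_rec m h s g j
  else sweep_rec m (revn M h) (revn M s) (revn M g) (M - j)%N.

Lemma dsweep_solP m g b : 0 < m -> dsweep M m h s g b (dsweep_sol m g b).
Proof.
move=> m0; case: b; first exact: sweep_recP.
have [||e1 e2] := @sweep_recP M m (revn M h) (revn M s) (revn M g) m0.
- by move=> j jM; apply: h0; lia.
- by move=> j jM; apply: s0; lia.
split; rewrite /dsweep_sol; first by rewrite subn0 subnn.
by move=> j jM; rewrite !subKn ?e2 // ltnW.
Qed.

Lemma dsweep_unique m g b u : 0 < m -> dsweep M m h s g b u ->
  forall j, (j <= M)%N -> u j = dsweep_sol m g b j.
Proof.
move=> m0; case: b => [|hu] j jM; first by move/sweep_rec_unique; exact.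
have e : forall j, (j <= M)%N -> u (M - j)%N = _ := sweep_rec_unique m0 _ _ hu.
rewrite /dsweep_sol -e ?subKn ?leq_subr // => i iM; [apply: h0|apply: s0]; lia.
Qed.

Definition Kh_sol g i : R :=
  2^-1 * \sum_(k < N) w k * (dsweep_sol (mu k) g true i + dsweep_sol (mu k) g false i).

Lemma Kh_solP g : discrete_Kh g (Kh_sol g).
Proof.
exists (fun b k => dsweep_sol (mu k) g b); split => // k b kN.
by apply: dsweep_solP; exact: mu0.
Qed.

Lemma Kh_sol_unique g W : discrete_Kh g W -> forall i, (i <= M)%N -> W i = Kh_sol g i.
Proof.
move=> [u [hu WE]] i iM; rewrite WE //; congr (_ * _); apply: eq_bigr => k _.
by rewrite (dsweep_unique _ (hu k true _)) ?mu0 // (dsweep_unique _ (hu k false _)) ?mu0.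
Qed.

Lemma Kh_sol_sum n (a : nat -> R) (G : nat -> nat -> R) i :
  Kh_sol (fun j => \sum_(l < n) a l * G l j) i = \sum_(l < n) a l * Kh_sol (G l) i.
Proof.
rewrite /Kh_sol /dsweep_sol; under eq_bigr => k _.
  rewrite sweep_rec_sum (@sweep_rec_sum _ _ _ n a (fun l => revn M (G l))) -big_split mulr_sumr.
  over.
rewrite exchange_big /= mulr_sumr; apply: eq_bigr => l _.
rewrite mulrCA; congr (_ * _); rewrite mulr_sumr; apply: eq_bigr => k _; ring.
Qed.

Lemma Kh_sol_ext g1 g2 : (forall j, (j < M)%N -> g1 j = g2 j) ->
  forall i, (i <= M)%N -> Kh_sol g1 i = Kh_sol g2 i.
Proof.
move=> e; apply: Kh_sol_unique; have [u [hu WE]] := Kh_solP g1.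
exists u; split=> // k [] kN; have := hu k _ kN.
  by move=> /(_ true) [u0 hs]; split=> // j jM; rewrite hs // e.
move=> /(_ false) [u0 hs]; split=> // j jM; rewrite hs // /revn e //; lia.
Qed.

Lemma Kh_solD g1 g2 i : Kh_sol (fun j => g1 j + g2 j) i = Kh_sol g1 i + Kh_sol g2 i.
Proof.
have := Kh_sol_sum 2 (fun=> 1) (fun l => if l is 0%N then g1 else g2) i.
rewrite big_ord_recl big_ord1 /= !mul1r => <-; congr Kh_sol; apply/funext => j.
by rewrite big_ord_recl big_ord1 /= !mul1r.
Qed.

Lemma Kh_sol0 i : Kh_sol (fun=> 0) i = 0.
Proof.
transitivity (Kh_sol (fun j => \sum_(l < 0) 0 * 0) i).
  by congr Kh_sol; apply/funext => j; rewrite big_ord0.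
by rewrite (Kh_sol_sum 0 (fun=> 0) (fun _ _ => 0)) big_ord0.
Qed.

(** The contraction with [r] = 0 annihilates the cell means of the difference. This makes its source
    vanish, and applying the operator once more annihilates the nodal values. *)
Lemma discrete_fixpoint_unique (kappa : R) c g W W' : 0 < kappa < 1 ->
  (forall j, (j < M)%N -> `|c j| <= kappa * s j) ->
  (forall i, (i <= M)%N -> W i = Kh_sol (fun j => c j * ((W j + W j.+1) / 2) + g j) i) ->
  (forall i, (i <= M)%N -> W' i = Kh_sol (fun j => c j * ((W' j + W' j.+1) / 2) + g j) i) ->
  forall i, (i <= M)%N -> W i = W' i.
Proof.
move=> k01 ck hW hW'.
pose D i := W i - W' i; pose d j := (D j + D j.+1) / 2.
have KD : discrete_Kh (fun j => c j * d j) D.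
  have [u [hu uE]] := Kh_solP (fun j => c j * d j).
  exists u; split=> // i iM; rewrite -uE // /D hW // hW' //.
  apply/eqP; rewrite subr_eq -Kh_solD; apply/eqP; apply: Kh_sol_ext => // j jM.
  rewrite /d /D; ring.
have := discrete_Kh_contraction k01 KD (d := d) (r := fun=> 0).
have -> : \sum_(j < M) h j * s j * 0 ^+ 2 = 0.
  by rewrite big1 // => j _; rewrite expr0n mulr0.
move=> hd.
have d0 j : (j < M)%N -> d j = 0.
  move=> jM; have : (1 - kappa) ^+ 2 * \sum_(j < M) h j * s j * d j ^+ 2 <= 0.
    apply: hd => i iM; last by rewrite addr0.
    by rewrite normrM ler_wpM2r ?ck.
  rewrite pmulr_rle0; last by rewrite exprn_gt0 //; case/andP: k01; lra.
  rewrite (bigD1 (Ordinal jM)) //= => le.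
  have p : 0 <= \sum_(i < M | i != Ordinal jM) h i * s i * d i ^+ 2.
    apply: sumr_ge0 => i _; have hi := ltW (h0 (ltn_ord i)); have si := ltW (s0 (ltn_ord i)).
    by rewrite mulr_ge0 ?sqr_ge0 // mulr_ge0.
  have : h j * s j * d j ^+ 2 <= 0 by lra.
  rewrite pmulr_rle0 ?mulr_gt0 ?h0 ?s0 // => le2; apply/eqP.
  by rewrite -sqrf_eq0 eq_le le2 sqr_ge0.
move=> i iM; apply/eqP; rewrite -subr_eq0 -/(D i).
rewrite (Kh_sol_unique KD) // (@Kh_sol_ext _ (fun=> 0)) ?Kh_sol0 // => j jM.
by rewrite d0 // mulr0.
Qed.

(** The unknowns are the M cell means, on which the equation is a square linear system; uniqueness
    gives injectivity, hence invertibility. The matrix [A] acts on row vectors from the right. *)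
Lemma discrete_fixpoint_exists (kappa : R) c g : 0 < kappa < 1 ->
  (forall j, (j < M)%N -> `|c j| <= kappa * s j) ->
  exists W, forall i, (i <= M)%N ->
    W i = Kh_sol (fun j => c j * ((W j + W j.+1) / 2) + g j) i.
Proof.
move=> k01 ck; pose av (W : nat -> R) j := (W j + W j.+1) / 2.
pose B (l j : nat) : R := av (Kh_sol (fun i => c i * (i == l)%:R)) j.
pose A : 'M[R]_M := \matrix_(l < M, j < M) ((l == j)%:R - B l j).
pose ext (v : 'rV[R]_M) (j : nat) : R := if insub j is Some i then v 0 i else 0.
have extE v (j : 'I_M) : ext v j = v 0 j by rewrite /ext valK.
have AE (v : 'rV[R]_M) (j : 'I_M) :
    (v *m A) 0 j = v 0 j - av (Kh_sol (fun i => c i * ext v i)) j.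
  rewrite mxE; under eq_bigr do rewrite mxE mulrBr.
  rewrite sumrB (bigD1 j) //= eqxx mulr1 big1 ?addr0 => [|l /negbTE ->]; last exact: mulr0.
  congr (_ - _); have e i : (i <= M)%N -> Kh_sol (fun i => c i * ext v i) i =
      \sum_(l < M) ext v l * Kh_sol (fun i => c i * (i == l)%:R) i.
    move=> iM; rewrite -(Kh_sol_sum M (ext v) (fun l i => c i * (i == l)%:R)).
    apply: Kh_sol_ext => // k kM; rewrite (bigD1 (Ordinal kM)) //= eqxx mulr1 big1 ?addr0.
      by rewrite mulrC.
    by move=> l lk; rewrite [k == l]eq_sym -[k]/(val (Ordinal kM)) val_eqE (negbTE lk) !mulr0.
  rewrite /av !e // 1?ltnW // -big_split /= mulr_suml; apply: eq_bigr => l _.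
  by rewrite extE /B /av; ring.
have Aunit : A \in unitmx.
  rewrite -row_free_unit; apply: inj_row_free => v vA.
  have h1 i : (i <= M)%N -> Kh_sol (fun i => c i * ext v i) i = 0.
    have e0 : forall i, (i <= M)%N -> (0 : R) = Kh_sol (fun j => c j * ((0 + 0) / 2) + 0) i.
      move=> k kM; rewrite (@Kh_sol_ext _ (fun=> 0)) ?Kh_sol0 // => j jM.
      by rewrite !addr0 mul0r mulr0.
    move=> iM; apply: (@discrete_fixpoint_unique kappa c (fun=> 0) _ (fun=> 0) k01 ck _ e0 _ iM).
    move=> k kM; apply: Kh_sol_ext => // j jM; rewrite addr0; congr (_ * _).
    have := AE v (Ordinal jM); rewrite vA mxE -extE /= => /esym/eqP.
    by rewrite subr_eq0 => /eqP ->.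
  apply/rowP => j; rewrite mxE.
  have := AE v j; rewrite vA mxE => /esym/eqP; rewrite subr_eq0 => /eqP ->.
  by rewrite /av !h1 // 1?ltnW // addr0 mul0r.
pose v : 'rV[R]_M := (\row_j av (Kh_sol g) j) *m invmx A.
exists (Kh_sol (fun j => c j * ext v j + g j)) => i iM.
apply: Kh_sol_ext => // j jM; congr (_ * _ + _).
have := AE v (Ordinal jM); rewrite /v mulmxKV // mxE -/v -extE /= => /eqP.
rewrite eq_sym subr_eq => /eqP ->; rewrite /av !Kh_solD; ring.
Qed.

End DiscreteOperator.
End Sweeps.

(** * The error of one sweep against exact transport *)

Section SweepError.
Context {R : realType}.
Implicit Types (h s g u psi : nat -> R) (m L G rho : R) (i j k M N n : nat).

(** The defect is measured in units of 1 - r j, so the ball of radius D is invariant and no factor M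
    appears. *)
Lemma damped_error (r delta e : nat -> R) (D : R) M : 0 <= D ->
  (forall j, (j < M)%N -> 0 <= r j) -> e 0%N = 0 ->
  (forall j, (j < M)%N -> e j.+1 = r j * e j + delta j) ->
  (forall j, (j < M)%N -> `|delta j| <= (1 - r j) * D) ->
  forall j, (j <= M)%N -> `|e j| <= D.
Proof.
move=> D0 r0 e0 er dr; elim=> [|j IH] jM; first by rewrite e0 normr0.
rewrite er // (le_trans (ler_normD _ _)) // normrM (ger0_norm (r0 j jM)).
have h1 := ler_wpM2l (r0 j jM) (IH (ltnW jM)); have h2 := dr j jM.
by apply: le_trans (lerD h1 h2) _; rewrite -mulrDl addrC subrK mul1r.
Qed.

(** The increments D are summed either over the j steps or as a geometric series. Which bound is
    better depends on the number of cells, so both are kept; a jump costs 2 Gam in either case. *)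
Lemma damped_jumps (q D Gam : R) (a jump : nat -> R) M : 0 <= q < 1 -> 0 <= D -> 0 <= Gam ->
  (forall j, 0 <= jump j) -> a 0%N <= Gam ->
  (forall j, (j.+1 < M)%N -> a j.+1 <= q * a j + D + 2 * Gam * jump j) ->
  (forall j, (j < M)%N -> a j <= Gam + 2 * Gam * \sum_(i < j) jump i + D * j%:R) /\
  (forall j, (j < M)%N -> a j <= Gam + 2 * Gam * \sum_(i < j) jump i + D / (1 - q)).
Proof.
move=> /andP[q0 q1] D0 G0 jump0 a0 ar; have q1' : 0 < 1 - q by lra.
have Dq : q * (D / (1 - q)) + D = D / (1 - q) by field; rewrite gt_eqF.
have Dq0 : 0 <= D / (1 - q) by rewrite divr_ge0 // ltW.
have S0 j : 0 <= Gam + 2 * Gam * \sum_(i < j) jump i.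
  by rewrite addr_ge0 // mulr_ge0 ?mulr_ge0 // sumr_ge0.
split; elim=> [|j IH] jM; first by rewrite big_ord0; lra.
- rewrite big_ord_recr /= -natr1; have := ar j jM; have := IH (ltnW jM).
  have := S0 j; set sr := \sum_(i < j) jump i => S0j.
  set j0 := j%:R; have jj : 0 <= j0 by rewrite ler0n.
  have Dj : 0 <= D * j0 by rewrite mulr_ge0.
  move=> h1 h2; have h3 := ler_wpM2l q0 h1.
  have : q * (Gam + 2 * Gam * sr + D * j0) <= Gam + 2 * Gam * sr + D * j0.
    by apply: ler_piMl; [exact: addr_ge0|exact: ltW].
  lra.
- by rewrite big_ord0; lra.
- rewrite big_ord_recr /=; have := ar j jM; have := IH (ltnW jM).
  have := S0 j; set sr := \sum_(i < j) jump i => S0j.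
  move=> h1 h2; have h3 := ler_wpM2l q0 h1.
  have : q * (Gam + 2 * Gam * sr) <= Gam + 2 * Gam * sr.
    by apply: ler_piMl; [|exact: ltW].
  lra.
Qed.

(** The factor is near 1 when x is much smaller than m and near -1 when it is much larger; the
    minimum records the weak damping at both ends. *)
Lemma cayley_damping (m x : R) : 0 < m -> 0 < x ->
  `|(m - x) / (m + x)| <= 1 - 2 * Num.min m x / (m + x).
Proof.
move=> m0 x0; have p : 0 < m + x by lra.
rewrite normrM (gtr0_norm (_ : 0 < (m + x)^-1)) ?invr_gt0 // ler_pdivrMr //.
rewrite mulrBl mul1r mulfVK ?gt_eqF //.
have [le|lt] := leP m x; [rewrite ler0_norm|rewrite ger0_norm]; lra.
Qed.

(* One cell of the diamond scheme against the exact transport, whose transmission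
   is [ej] and whose source is [rj]. *)
Lemma cell_defect (m L G H E X hj sj gj pj ej rj : R) : 0 < m -> 1 <= L -> 0 <= G ->
  0 < H -> 0 <= E <= X -> H / m <= 2 * X -> 0 < hj <= H -> L^-1 <= sj <= L ->
  hj * sj / 2 <= m -> `|gj| <= G -> `|pj| <= L * G ->
  `|ej - (1 - hj * sj / m)| <= hj / m * (L ^+ 2 * (H / m) + L * E) ->
  `|rj - hj * gj / m| <= hj / m * (G * (L * (H / m) + E)) ->
  let r := (m - hj * sj / 2) / (m + hj * sj / 2) in
  `|(ej - r) * pj + (rj - (1 - r) * (gj / sj))| <= (1 - r) * (20 * L ^+ 4 * G * X).
Proof.
move=> m0 L1 G0 H0 /andP[E0 HX] HmX /andP[hj0 hjH] /andP[sj1 sj2] xm gG pg erE srE.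
have L0 : 0 < L by lra.
have sj0 : 0 < sj by apply: lt_le_trans sj1; rewrite invr_gt0.
have X0 : 0 <= X by lra.
move=> /=; set x := hj * sj / 2 in xm *; set r := (m - x) / (m + x).
have x0 : 0 < x by rewrite divr_gt0 ?mulr_gt0.
have xh : hj / (2 * L) <= x.
  by rewrite /x invfM mulrCA mulrC ler_wpM2r // ler_wpM2l // ltW.
have p : 0 < m + x by lra.
set t := hj / m; have t0 : 0 < t by rewrite divr_gt0.
have tz : t * sj = 2 * (x / m) by rewrite /t /x; field; rewrite gt_eqF.
set y := x / m in tz; have y0 : 0 < y by rewrite divr_gt0.
have y1 : y <= 1 by rewrite ler_pdivrMr // mul1r.
have p1 : 1 <= 1 + y by rewrite lerDl ltW.
have p0 : 0 < 1 + y by exact: lt_le_trans p1.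
have LHm : 0 <= L * (H / m) by rewrite mulr_ge0 ?divr_ge0 // ltW.
have rE : r = (1 - y) / (1 + y).
  by rewrite /r /y; field; rewrite !gt_eqF // addrC.
have r1 : 1 - r = 2 * y / (1 + y) by rewrite rE; field; rewrite gt_eqF.
have yt : t / L <= 2 * y.
  rewrite /y /t mulrAC (mulrC 2) -[x / m * 2]mulrAC ler_pM2r ?invr_gt0 //.
  by move: xh; rewrite invfM; lra.
have yt2 : 2 * y <= t * L by rewrite -tz ler_pM2l.
have yy : y <= L * (H / m) / 2.
  rewrite mulrA mulrAC /y ler_pM2r ?invr_gt0 // /x.
  by rewrite ler_pM2r // mulrC; apply: ler_pM; rewrite ?(ltW sj0) ?(ltW hj0).
(* The defects come out proportional to t = hj / m; this bound trades t for 1 - r, the unit in which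
   [damped_error] measures them. *)
have one_r : t / (2 * L) <= 1 - r.
  rewrite r1 ler_pdivlMr //.
  have : 0 <= t / L by rewrite divr_ge0 // ltW.
  by rewrite invfM; nra.
have rz : `|r - (1 - t * sj)| <= 2 * y ^+ 2.
  have -> : r - (1 - t * sj) = 2 * y ^+ 2 / (1 + y).
    by rewrite rE tz; field; rewrite gt_eqF.
  rewrite ger0_norm; last by rewrite divr_ge0 ?(ltW p0) // mulr_ge0 ?sqr_ge0.
  by rewrite ler_pdivrMr // ler_peMr // mulr_ge0 ?sqr_ge0.
have y2 : 2 * y ^+ 2 <= t * (L ^+ 2 * (H / m)) / 2.
  have -> : t * (L ^+ 2 * (H / m)) / 2 = (t * L) * (L * (H / m) / 2) by ring.
  rewrite expr2 mulrA; apply: ler_pM => //; last exact: ltW.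
  by rewrite mulr_ge0 // ltW.
have te : hj * sj / m = t * sj by rewrite /t mulrAC.
have te' : hj * gj / m = t * gj by rewrite /t mulrAC.
have d1 : `|ej - r| <= t * (2 * L ^+ 2 * (H / m) + L * E).
  move: erE; rewrite te -/t => ee.
  have -> : ej - r = (ej - (1 - t * sj)) - (r - (1 - t * sj)) by ring.
  apply: (le_trans (ler_normB _ _)).
  have h0 : 0 <= t * (L ^+ 2 * (H / m)).
    by rewrite mulr_ge0 ?(ltW t0) // expr2 -mulrA mulr_ge0 ?(ltW L0).
  by rewrite -mulrA mulrDr; lra.
have d2 : `|rj - (1 - r) * (gj / sj)| <= t * (G * (2 * L * (H / m) + E)).
  move: srE; rewrite te' -/t => ee.
  have -> : rj - (1 - r) * (gj / sj) = (rj - t * gj) + y / (1 + y) * (t * gj).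
    rewrite r1; have -> : t = 2 * y / sj by rewrite -tz mulfK ?gt_eqF.
    by field; rewrite !gt_eqF.
  apply: (le_trans (ler_normD _ _)).
  have tg : `|t * gj| <= t * G by rewrite normrM gtr0_norm // ler_wpM2l // ltW.
  have yl : `|y / (1 + y)| <= L * (H / m).
    rewrite ger0_norm; last by rewrite divr_ge0 // ltW.
    rewrite ler_pdivrMr //; apply: (le_trans yy); apply: (@le_trans _ _ (L * (H / m))).
      by rewrite ler_pdivrMr // ler_peMr // ler1n.
    by rewrite ler_peMr.
  have e2 : `|y / (1 + y) * (t * gj)| <= L * (H / m) * (t * G).
    by rewrite normrM; apply: ler_pM.
  apply: (le_trans (lerD ee e2)); apply: le_of_eq; ring.
apply: (@le_trans _ _ (t / (2 * L) * (20 * L ^+ 4 * G * X))); last first.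
  by rewrite ler_wpM2r // !mulr_ge0 ?exprn_ge0 ?powR_ge0 ?(ltW L0).
have f1 : `|(ej - r) * pj| <= t * (5 * L ^+ 2 * X) * (L * G).
  rewrite normrM; apply: ler_pM => //; apply: (le_trans d1); rewrite ler_wpM2l ?(ltW t0) //.
  have a1 : L ^+ 2 * (H / m) <= L ^+ 2 * (2 * X) by rewrite ler_wpM2l // exprn_ge0 // ltW.
  have a2 : L * E <= L ^+ 2 * X.
    by apply: ler_pM => //; [exact: ltW|rewrite expr2 ler_peMr // ltW].
  lra.
have f2 : `|rj - (1 - r) * (gj / sj)| <= t * (G * (5 * L * X)).
  apply: (le_trans d2); rewrite ler_wpM2l ?(ltW t0) // ler_wpM2l //.
  have a1 : L * (H / m) <= L * (2 * X) by rewrite ler_wpM2l // ltW.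
  have a2 : 1 * E <= L * X by apply: ler_pM; rewrite ?powR_ge0.
  lra.
apply: (le_trans (ler_normD _ _)); apply: (le_trans (lerD f1 f2)).
have -> : t / (2 * L) * (20 * L ^+ 4 * G * X) = t * (G * (10 * L ^+ 3 * X)).
  by field; rewrite gt_eqF.
have -> : t * (5 * L ^+ 2 * X) * (L * G) + t * (G * (5 * L * X)) = t * (G * ((5 * L ^+ 3 + 5 * L) * X)).
  by ring.
rewrite ler_wpM2l ?(ltW t0) // ler_wpM2l // ler_wpM2r //.
have : 0 <= L * (L ^+ 2 - 1) by rewrite mulr_ge0 ?(ltW L0) // subr_ge0 exprn_ege1.
have : 0 <= L * L ^+ 2 by rewrite mulr_ge0 ?exprn_ge0 // ltW.
lra.
Qed.

Section OneDirection.
Variables (M n : nat) (m L G rho H eta sig : R) (h s g u psi er sr : nat -> R) (jump : nat -> bool).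
Hypotheses (L1 : 1 <= L) (rho1 : 1 <= rho) (H01 : 0 < H <= 1) (m01 : 0 < m <= 1)
  (eta01 : 0 < eta < 1) (sig_eta : eta <= sig) (sig_half : 2^-1 <= sig) (G0 : 0 <= G)
  (hH : forall j, (j < M)%N -> 0 < h j <= H /\ H <= rho * h j)
  (h1 : \sum_(j < M) h j = 1)
  (sL : forall j, (j < M)%N -> L^-1 <= s j <= L)
  (gG : forall j, (j < M)%N -> `|g j| <= G)
  (s_holder : forall j, (j.+1 < M)%N -> ~~ jump j -> `|s j.+1 - s j| <= L * H `^ eta)
  (g_holder : forall j, (j.+1 < M)%N -> ~~ jump j -> `|g j.+1 - g j| <= G * H `^ eta)
  (jump_n : (\sum_(j < M.-1) jump j <= n)%N)
  (uP : sweep M m h s g u)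
  (psi0 : psi 0%N = 0) (psiE : forall j, (j < M)%N -> psi j.+1 = er j * psi j + sr j)
  (psiG : forall j, (j <= M)%N -> `|psi j| <= L * G)
  (erE : forall j, (j < M)%N ->
     `|er j - (1 - h j * s j / m)| <= h j / m * (L ^+ 2 * (H / m) + L * H `^ eta))
  (srE : forall j, (j < M)%N ->
     `|sr j - h j * g j / m| <= h j / m * (G * (L * (H / m) + H `^ eta))).

Local Notation X := (H `^ eta * m `^ (- sig)).

Lemma X_ge (t : R) : 0 <= t <= sig -> H `^ eta * m `^ (- t) <= X.
Proof.
by move=> /andP[t0 ts]; rewrite ler_wpM2l ?powR_ge0 //; apply: ger_powR; rewrite ?lerN2.
Qed.

Lemma ratio_powR : (H / m) `^ eta <= X.
Proof.
case/andP: H01 m01 => H0 _ /andP[m0 _]; case/andP: eta01 => e0 _.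
rewrite powRM ?invr_ge0 ?(ltW H0) ?(ltW m0) // -powR_inv1 ?(ltW m0) // -powRrM mulN1r.
by apply: X_ge; rewrite sig_eta ltW.
Qed.

(** In this regime every amplification factor is nonnegative and the cells are consistent:
    [cell_defect] bounds the local defect, [damped_error] sums it. *)
Lemma sweep_error_large : L * H / 2 <= m ->
  forall j, (j <= M)%N -> `|psi j - u j| <= 20 * L ^+ 4 * G * X.
Proof.
move: (L1) (G0) => L1' G0' mH; case/andP: (H01) => H0 H1; case/andP: (m01) => m0 m1; case/andP: (eta01) => e0 e1.
have L0 : 0 < L by exact: lt_le_trans L1.
have HX : H `^ eta <= X.
  have := @X_ge 0; rewrite oppr0 powRr0 mulr1; apply.
  by rewrite lexx (le_trans _ sig_eta) // ltW.
have X0 : 0 <= X by apply: le_trans HX; exact: powR_ge0.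
(* H / m is at most 2 here, so splitting off the power 1 - eta of H / m costs a factor of at most
   2. *)
have HmX : H / m <= 2 * X.
  have Hm : 0 < H / m by rewrite divr_gt0.
  have Hm2 : H / m <= 2 by rewrite ler_pdivrMr //; nra.
  rewrite -{1}[H / m]powRr1 ?(ltW Hm) // -{1}(subrK eta 1) powRD; last first.
    by apply/implyP => _; rewrite gt_eqF.
  apply: ler_pM; rewrite ?powR_ge0 ?ratio_powR //.
  apply: (@le_trans _ _ (2 `^ (1 - eta))).
    by apply: ge0_ler_powR; rewrite ?nnegrE //; lra.
  by rewrite -[leRHS]powRr1 //; apply: ler_powR; lra.
pose x j := h j * s j / 2; pose r j := (m - x j) / (m + x j).
case: uP => u0 hu.
have xP j : (j < M)%N -> 0 < x j /\ x j <= m.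
  move=> jM; have [/andP[hj hjH] _] := hH jM; have /andP[sj1 sj2] := sL jM.
  have zi : 0 < L^-1 by rewrite invr_gt0.
  have e2 : h j * s j <= H * L by apply: ler_pM => //; lra.
  by rewrite /x; split; [rewrite divr_gt0 ?mulr_gt0 // (lt_le_trans zi)|lra].
apply: (@damped_error r (fun j => (er j - r j) * psi j + (sr j - (1 - r j) * (g j / s j)))).
- by rewrite !mulr_ge0 ?exprn_ge0 ?powR_ge0 ?(ltW L0).
- by move=> j jM; have [x0 xm] := xP j jM; rewrite divr_ge0 //; lra.
- by rewrite psi0 u0 subrr.
- move=> j jM; have [x0 xm] := xP j jM; have := hu j jM => ue.
  have [/andP[hj _] _] := hH jM; have /andP[sj _] := sL jM.
  have sj0 : 0 < s j by apply: lt_le_trans sj; rewrite invr_gt0.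
  have p : 0 < m + x j by lra.
  have ur : u j.+1 = r j * u j + (1 - r j) * (g j / s j).
    have -> : u j.+1 = ((m - x j) * u j + h j * g j) / (m + x j).
      by apply: (mulIf (lt0r_neq0 p)); rewrite mulfVK ?gt_eqF //; rewrite /x; lra.
    rewrite /r /x; field.
    by rewrite (gt_eqF sj0) lt0r_neq0 //; move: p; rewrite /x; lra.
  by rewrite psiE // ur; ring.
move=> j jM; have [x0 xm] := xP j jM.
have [hj _] := hH jM.
apply: (cell_defect m0 L1 G0 H0 _ HmX hj (sL jM) xm (gG jM) (psiG (ltnW jM)) (erE jM) (srE jM)).
by rewrite powR_ge0.
Qed.

(** Here L X >= 1, so an error of order one is affordable and it is enough to bound [u]. The factors
    may be close to -1, so [u] is compared with the local equilibrium [gam] = g / s, whose variation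
    between neighbouring cells is of order H^eta away from the jumps. *)
Lemma sweep_error_small : m < L * H / 2 ->
  forall j, (j <= M)%N -> `|psi j - u j| <= (3 + 2 * n%:R + 2 * rho) * L ^+ 5 * G * X.
Proof.
move: (L1) (G0) (rho1) => L1' G0' rho1' mH; case/andP: (H01) => H0 H1.
case/andP: (m01) => m0 m1; case/andP: (eta01) => e0 e1.
have L0 : 0 < L by lra.
have rho0 : 0 < rho by lra.
have H_eta : 0 <= H `^ eta by exact: powR_ge0.
have HX : H `^ eta * m `^ (- 2^-1) <= X by apply: X_ge; rewrite sig_half invr_ge0 ler0n.
have LX : 1 <= L * X.
  apply: (@le_trans _ _ (L * (H / m) `^ eta)); last by rewrite ler_wpM2l ?ratio_powR // ltW.
  have Hm0 : 0 <= H / m by rewrite divr_ge0 // ltW.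
  have a1 : 1 <= L * (H / m) by rewrite mulrA ler_pdivlMr //; lra.
  apply: (@le_trans _ _ ((L * (H / m)) `^ eta)).
    have one : 1 `^ eta = 1 by rewrite powR1.
    by rewrite -[leLHS]one; apply: ge0_ler_powR; rewrite ?nnegrE //; lra.
  rewrite powRM ?(ltW L0) // ler_wpM2r ?powR_ge0 //.
  by rewrite -[leRHS]powRr1 ?(ltW L0) //; apply: ler_powR => //; exact: ltW.
have X0 : 0 <= X by rewrite mulr_ge0 // powR_ge0.
pose gam j := g j / s j.
have sP j : (j < M)%N -> [/\ 0 < s j, L^-1 <= s j, s j <= L & (s j)^-1 <= L].
  move=> jM; have /andP[a b] := sL jM.
  have s0 : 0 < s j by apply: lt_le_trans a; rewrite invr_gt0.
  by split => //; rewrite -[leRHS]invrK lef_pV2 ?posrE ?invr_gt0.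
have gamG j : (j < M)%N -> `|gam j| <= L * G.
  move=> jM; have [s0 _ _ si] := sP j jM.
  rewrite /gam normrM mulrC (gtr0_norm (_ : 0 < (s j)^-1)) ?invr_gt0 //.
  by apply: ler_pM; rewrite ?normr_ge0 ?invr_ge0 ?gG // ltW.
set D := 2 * L ^+ 3 * G * H `^ eta.
have D0 : 0 <= D by rewrite !mulr_ge0 ?exprn_ge0 ?powR_ge0 ?(ltW L0).
have gamD j : (j.+1 < M)%N -> ~~ jump j -> `|gam j.+1 - gam j| <= D.
  move=> jM nj; have [s0 _ _ si] := sP j (ltnW jM); have [s0' _ _ si'] := sP _ jM.
  have -> : gam j.+1 - gam j = (g j.+1 - g j) * (s j.+1)^-1 +
     g j * ((s j.+1)^-1 * (s j)^-1 * (s j - s j.+1)).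
    by rewrite /gam; field; rewrite !gt_eqF.
  apply: (le_trans (ler_normD _ _)).
  have i0 : 0 < (s j)^-1 by rewrite invr_gt0.
  have i0' : 0 < (s j.+1)^-1 by rewrite invr_gt0.
  have b1 : `|(g j.+1 - g j) * (s j.+1)^-1| <= G * H `^ eta * L.
    rewrite normrM (gtr0_norm i0'); apply: ler_pM => //; [exact: ltW|exact: g_holder].
  have b2 : `|g j * ((s j.+1)^-1 * (s j)^-1 * (s j - s j.+1))| <= G * (L * L * (L * H `^ eta)).
    rewrite normrM; apply: ler_pM => //; first exact: gG (ltnW jM).
    rewrite !normrM (gtr0_norm i0) (gtr0_norm i0') distrC.
    apply: ler_pM; rewrite ?mulr_ge0 ?(ltW i0) ?(ltW i0') //; last exact: s_holder.
    by apply: ler_pM => //; exact: ltW.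
  apply: (le_trans (lerD b1 b2)); rewrite /D.
  have GH : 0 <= G * H `^ eta by rewrite mulr_ge0.
  have -> : 2 * L ^+ 3 * G * H `^ eta = G * H `^ eta * (2 * L ^+ 3) by ring.
  have -> : G * H `^ eta * L + G * (L * L * (L * H `^ eta)) = G * H `^ eta * (L + L ^+ 3) by ring.
  rewrite ler_wpM2l //.
  have : L * 1 <= L * L ^+ 2 by rewrite ler_wpM2l ?(ltW L0) // exprn_ege1.
  lra.
pose x j := h j * s j / 2.
(* A lower bound for the damping 2 min(m, x) / (m + x), from x >= m / (rho L^2) and m + x <= L H. *)
set del := 2 * m / (rho * L ^+ 3 * H).
have del0 : 0 < del by rewrite divr_gt0 ?mulr_gt0 ?exprn_gt0.
case: uP => u0 hu.
have rP j : (j < M)%N -> [/\ u j.+1 - gam j = (m - x j) / (m + x j) * (u j - gam j) &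
   `|(m - x j) / (m + x j)| <= 1 - del].
  move=> jM; have [/andP[hj hjH] hr] := hH jM; have [s0 s1 s2 _] := sP j jM.
  have x0 : 0 < x j by rewrite divr_gt0 // mulr_gt0.
  have p : 0 < m + x j by lra.
  split.
    have -> : u j.+1 = ((m - x j) * u j + h j * g j) / (m + x j).
      by apply: (mulIf (lt0r_neq0 p)); rewrite mulfVK ?gt_eqF //; have := hu j jM; rewrite /x; lra.
    rewrite /gam; move: p; rewrite /x => p; field.
    by rewrite (gt_eqF s0) lt0r_neq0 //; lra.
  apply: (le_trans (cayley_damping m0 x0)); rewrite lerD2l lerN2.
  have xL : x j <= L * H / 2.
    by rewrite /x ler_pM2r // mulrC; apply: ler_pM; rewrite ?(ltW s0) ?(ltW hj).
  have pL : m + x j <= L * H by lra.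
  have xl : m / (rho * L ^+ 2) <= x j.
    rewrite ler_pdivrMr ?mulr_gt0 ?exprn_gt0 //.
    have c1 : H * L^-1 <= rho * h j * s j by apply: ler_pM => //; rewrite ?invr_ge0 ltW.
    have c2 : H * L^-1 * L ^+ 2 <= rho * h j * s j * L ^+ 2 by rewrite ler_wpM2r ?exprn_ge0 // ltW.
    have e : H * L^-1 * L ^+ 2 = L * H by field; rewrite gt_eqF.
    rewrite /x; lra.
  have ml : m / (rho * L ^+ 2) <= m.
    rewrite ler_pdivrMr ?mulr_gt0 ?exprn_gt0 // ler_peMr ?(ltW m0) //.
    by rewrite -[leLHS]mulr1; apply: ler_pM => //; rewrite exprn_ege1.
  have mn : m / (rho * L ^+ 2) <= Num.min m (x j) by rewrite le_min ml.
  have -> : del = 2 * (m / (rho * L ^+ 2)) / (L * H).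
    by rewrite /del; field; rewrite !gt_eqF.
  have mm : 0 <= m / (rho * L ^+ 2) by rewrite divr_ge0 ?mulr_ge0 ?exprn_ge0 // ltW.
  apply: ler_pM; [by rewrite mulr_ge0|by rewrite invr_ge0 mulr_ge0 ?(ltW L0) ?(ltW H0)|by rewrite ler_wpM2l|].
  by rewrite lef_pV2 ?posrE ?mulr_gt0.
have q01 j : (j < M)%N -> 0 <= 1 - del < 1.
  move=> jM; have [_ r1] := rP j jM.
  by rewrite (le_trans (normr_ge0 _) r1) /=; lra.
have LG0 : 0 <= L * G by rewrite mulr_ge0 // ltW.
pose J i : R := (jump i)%:R.
have aP j : (j < M)%N -> `|u j - gam j| <= L * G + 2 * (L * G) * n%:R + D * (rho * L ^+ 2 * m `^ (- 2^-1)).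
  move=> jM.
  have [|||B1 B2] := @damped_jumps (1 - del) D (L * G) (fun i => `|u i - gam i|) J M (q01 j jM) D0 LG0.
  - by move=> i; rewrite ler0n.
  - by rewrite u0 sub0r normrN gamG // (leq_ltn_trans _ jM).
  - move=> i iM.
    have [e r1] := rP i (ltnW iM).
    have -> : u i.+1 - gam i.+1 = (m - x i) / (m + x i) * (u i - gam i) + (gam i - gam i.+1).
      by rewrite -e; ring.
    rewrite (le_trans (ler_normD _ _)) // -addrA lerD //.
      by rewrite normrM ler_wpM2r.
    rewrite distrC /J; case Ej: (jump i) => /=.
      rewrite mulr1 (le_trans (ler_normB _ _)) //.
      have := gamG i.+1 iM; have := gamG i (ltnW iM); lra.
    by rewrite mulr0 addr0 gamD // Ej.
  have Jn : \sum_(i < j) J i <= n%:R.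
    rewrite -natr_sum ler_nat (leq_trans _ jump_n) //.
    have jM' : (j <= M.-1)%N by clear -jM; lia.
    rewrite (big_ord_widen _ (fun i => jump i : nat) jM') big_mkcond /=.
    by apply: leq_sum => i _; case: ifP.
  have S1 : 2 * (L * G) * \sum_(i < j) J i <= 2 * (L * G) * n%:R.
    by rewrite ler_wpM2l ?mulr_ge0 ?(ltW L0).
  (* M H <= rho bounds the product of M and 1/del by a multiple of 1/m, so the smaller of the two is
     at most of order m^(-1/2). This is where the exponent 1/2 enters [sig]. *)
  set T := rho * L ^+ 2 * m `^ (- 2^-1).
  have T0 : 0 < T by rewrite !mulr_gt0 ?exprn_gt0 ?powR_gt0.
  have T2 : T ^+ 2 = rho ^+ 2 * L ^+ 4 / m.
    have m2 : (m `^ (- 2^-1)) ^+ 2 = m^-1.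
      rewrite -powR_mulrn ?powR_ge0 // -powRrM (_ : - 2^-1 * 2%:R = -1); last by field.
      by rewrite powR_inv1 ?(ltW m0).
    by rewrite /T 2!exprMn m2; ring.
  have MH : M%:R * H <= rho.
    have : \sum_(i < M) H <= \sum_(i < M) rho * h i by apply: ler_sum => i _; have [] := hH (ltn_ord i).
    by rewrite sumr_const card_ord -mulr_sumr h1 mulr1 -[H *+ M]mulr_natl.
  have [MT|TM] := leP (M%:R) T.
    have := B1 j jM; have : D * j%:R <= D * T.
      by rewrite ler_wpM2l // (le_trans _ MT) // ler_nat ltnW.
    lra.
  have dT : 1 / del <= T.
    rewrite ler_pdivrMr // -(ler_pM2l T0) mulr1 mulrA -expr2 T2.
    have -> : rho ^+ 2 * L ^+ 4 / m * del = 2 * rho * L / H.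
      by rewrite /del; field; rewrite !gt_eqF.
    rewrite ler_pdivlMr //; have : T * H <= M%:R * H by rewrite ler_wpM2r ?(ltW H0) // ltW.
    have : rho * 1 <= rho * L by rewrite ler_wpM2l // ltW.
    have : 0 <= rho * L by rewrite mulr_ge0 // ltW.
    lra.
  have := B2 j jM; rewrite opprB addrCA subrr addr0.
  have : D / del <= D * T by rewrite -[D / del]mulr1 mulrAC -mulrA ler_wpM2l // mulrC.
  lra.
have uB j : (j <= M)%N -> `|u j| <= 2 * (L * G) + 2 * (L * G) * n%:R + D * (rho * L ^+ 2 * m `^ (- 2^-1)).
  have T0 : 0 <= D * (rho * L ^+ 2 * m `^ (- 2^-1)).
    by rewrite !mulr_ge0 ?exprn_ge0 ?powR_ge0 ?(ltW L0) ?(ltW rho0).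
  have n0 : 0 <= 2 * (L * G) * n%:R by rewrite !mulr_ge0 ?(ltW L0).
  case: j => [_|j jM]; first by rewrite u0 normr0; lra.
  have [e r1] := rP j jM; have := aP j jM; have := gamG j jM.
  (* The last node has no cell after it, so a nodal value is compared with the equilibrium of the
     cell just crossed. *)
  have : `|u j.+1 - gam j| <= `|u j - gam j|.
    by rewrite e normrM ler_piMl // (le_trans r1) // gerBl ltW.
  have := ler_normD (u j.+1 - gam j) (gam j); rewrite subrK; lra.
move=> j jM; apply: (le_trans (ler_normB _ _)).
have := uB j jM; have := psiG jM.
have -> : (3 + 2 * n%:R + 2 * rho) * L ^+ 5 * G * X =
   (3 + 2 * n%:R) * G * (L ^+ 5 * X) + 2 * rho * (L ^+ 5 * G * X) by ring.
have D1 : D * (rho * L ^+ 2 * m `^ (- 2^-1)) <= 2 * rho * (L ^+ 5 * G * X).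
  have -> : D * (rho * L ^+ 2 * m `^ (- 2^-1)) = 2 * rho * (L ^+ 5 * G * (H `^ eta * m `^ (- 2^-1))).
    by rewrite /D; ring.
  have LG5 : 0 <= L ^+ 5 * G by rewrite mulr_ge0 ?exprn_ge0 ?(ltW L0).
  have r2 : 0 <= 2 * rho by rewrite mulr_ge0 ?(ltW rho0).
  exact: (ler_wpM2l r2 (ler_wpM2l LG5 HX)).
have D2 : (3 + 2 * n%:R) * G * L <= (3 + 2 * n%:R) * G * (L ^+ 5 * X).
  rewrite ler_wpM2l ?mulr_ge0 ?addr_ge0 ?mulr_ge0 ?ler0n //.
  have -> : L ^+ 5 * X = L * (L ^+ 3 * (L * X)) by ring.
  rewrite ler_peMr ?(ltW L0) // -[leLHS]mulr1; apply: ler_pM => //.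
  by rewrite exprn_ege1.
lra.
Qed.

Lemma sweep_error j : (j <= M)%N ->
  `|psi j - u j| <= (20 + 2 * n%:R + 2 * rho) * L ^+ 5 * G * X.
Proof.
move: (L1) (G0) (rho1) => L1' G0' rho1' jM.
have X0 : 0 <= X by rewrite mulr_ge0 // powR_ge0.
have L0 : 0 <= L by lra.
have n0 : (0 : R) <= n%:R by rewrite ler0n.
have [le|lt] := leP (L * H / 2) m.
  apply: (le_trans (sweep_error_large le jM)); rewrite !ler_wpM2r //.
  apply: ler_pM; rewrite ?exprn_ge0 //; first by lra.
  by rewrite ler_weXn2l.
apply: (le_trans (sweep_error_small lt jM)); rewrite !ler_wpM2r ?exprn_ge0 //.
lra.
Qed.

End OneDirection.
End SweepError.

(** * Exact transport *)

Section RealFubini.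
Context {R : realType}.
Local Notation leb := (@lebesgue_measure R).

(** Joint integrability follows by Tonelli from the bound [b] on the slices in y. The slices in t
    are integrable only for almost every y: for the kernel of [E1] the slice y = x may fail. *)
Lemma Rfubini (A B : set R) (k : R -> R -> R) (b : R -> R) :
  measurable A -> measurable B ->
  measurable_fun (A `*` B) (fun p : R * R => k p.1 p.2) ->
  (forall t, A t -> leb.-integrable B (EFin \o k t)) ->
  (forall t, A t -> \int[leb]_(y in B) `|k t y| <= b t) ->
  leb.-integrable A (EFin \o b) ->
  leb.-integrable A (EFin \o (fun t => \int[leb]_(y in B) k t y)) /\
  \int[leb]_(y in B) \int[leb]_(t in A) k t y = \int[leb]_(t in A) \int[leb]_(y in B) k t y.
Proof.
move=> mA mB mk ik kb ib.
pose f (p : R * R) : \bar R := (((fun p => k p.1 p.2) \_ (A `*` B)) p)%:E.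
have mf : measurable_fun [set: R * R] f.
  apply/measurable_EFinP; apply/(measurable_restrictT _ _).1 => //.
  exact: measurableX.
have fE t y : f (t, y) = (((fun y => k t y) \_ B) y * \1_A t)%:E.
  rewrite /f /patch /= indicE; case: (boolP (t \in A)) => tA; case: (boolP (y \in B)) => yB.
  - by rewrite mem_set ?mulr1 //; split; [exact: set_mem tA|exact: set_mem yB].
  - rewrite memNset ?mul0r // => -[_ /= yB']; by rewrite mem_set in yB.
  - rewrite memNset ?mulr0 // => -[/= tA' _]; by rewrite mem_set in tA.
  - rewrite memNset ?mulr0 // => -[/= tA' _]; by rewrite mem_set in tA.
have fF t : (\int[leb]_y f (t, y) = (((fun t => \int[leb]_(y in B) k t y) \_ A) t)%:E)%E.
  rewrite /patch; case: (boolP (t \in A)) => tA.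
    rewrite /Rintegral fineK; last first.
      by apply: integrable_fin_num => //; apply: ik; exact: set_mem tA.
    rewrite [RHS]integral_mkcond; apply: eq_integral => y _.
    by rewrite fE indicE tA mulr1 restrict_EFin.
  rewrite (eq_integral (fun=> 0%E)) ?integral0 // => y _.
  by rewrite fE indicE (negbTE tA) mulr0.
have fabs t : (\int[leb]_y `|f (t, y)| <= ((b \_ A) t)%:E)%E.
  rewrite /patch; case: (boolP (t \in A)) => tA.
    apply: (@le_trans _ _ ((\int[leb]_(y in B) `|k t y|)%:E)); last first.
      by rewrite lee_fin; apply: kb; exact: set_mem tA.
    rewrite /Rintegral fineK; last first.
      apply: integrable_fin_num => //; apply: integrable_norm; apply: ik; exact: set_mem tA.
    rewrite [leRHS]integral_mkcond; apply: le_of_eq.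
    apply: eq_integral => y _; rewrite fE indicE tA mulr1 restrict_EFin /= /patch.
    by case: ifP => //; rewrite normr0.
  rewrite (eq_integral (fun=> 0%E)) ?integral0 // => y _.
  by rewrite fE indicE (negbTE tA) mulr0 abse0.
have imf : (leb \x leb)%E.-integrable setT f.
  apply/integrable12ltyP => //.
  have ib' : leb.-integrable setT (EFin \o (b \_ A)).
    by rewrite -restrict_EFin; apply/integrable_restrict; rewrite ?setTI.
  apply: (@le_lt_trans _ _ (\int[leb]_t ((b \_ A) t)%:E)%E); last first.
    by have := integrable_fin_num measurableT ib'; rewrite fin_numElt => /andP[].
  apply: ge0_le_integral => //.
  - by move=> t _; apply: integral_ge0 => y _.
  - have := @measurable_fun_fubini_tonelli_F _ _ _ _ R leb (abse \o f); apply => //.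
      exact: measurableT_comp.
    by move=> x; exact: abse_ge0.
  - exact: measurable_int ib'.
have eF : fubini_F leb f = EFin \o ((fun t => \int[leb]_(y in B) k t y) \_ A).
  by apply/funext => t; rewrite /fubini_F fF.
split.
  have iF : leb.-integrable setT (EFin \o ((fun t => \int[leb]_(y in B) k t y) \_ A)).
    by rewrite -eF; exact: (integrable_fubini_F imf).
  rewrite -restrict_EFin in iF.
  by have := (integrable_restrict leb mA measurableT _).2 iF; rewrite setTI.
have := Fubini imf; under eq_integral do rewrite fF.
move=> e; rewrite Rintegral_mkcond [RHS]Rintegral_mkcond /Rintegral e; congr fine.
have ae2 := ae_integrable2 imf.
have hG y : ((fun y => \int[leb]_(t in A) k t y) \_ B) y = fine (fubini_G leb f y).
  rewrite /fubini_G /patch; case: (boolP (y \in B)) => yB.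
    rewrite /Rintegral; congr fine; rewrite integral_mkcond; apply: eq_integral => t _.
    rewrite fE /patch yB indicE.
    by case: (t \in A); rewrite ?mulr1 ?mulr0.
  rewrite (eq_integral (fun=> 0%E)) ?integral0 // => t _.
  by rewrite fE /patch (negbTE yB) mul0r.
under eq_integral do rewrite hG.
apply: ae_eq_integral => //.
- apply/measurable_EFinP; apply: (@measurableT_comp _ _ _ _ _ _ fine) => //.
  exact: (measurable_fubini_G imf).
- exact: (measurable_fubini_G imf).
- apply: filterS ae2 => y iy _; rewrite /= fineK //.
  by rewrite /fubini_G; exact: integrable_fin_num iy.
Qed.

(** If the integral of [e] diverges, both sides are 0 because [fine] sends infinities to 0. This
    covers the point y = x, where [E1] takes its default value. *)
Lemma Rintegral_ge0Zr (D : set R) (e : R -> R) (c : R) : measurable D ->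
  measurable_fun D e -> (forall t, D t -> 0 <= e t) ->
  \int[leb]_(t in D) (e t * c) = (\int[leb]_(t in D) e t) * c.
Proof.
move=> mD me e0.
have E0 : (0 <= \int[leb]_(t in D) (e t)%:E)%E.
  by apply: integral_ge0 => t Dt; rewrite lee_fin e0.
have [fin|] := ltP (\int[leb]_(t in D) (e t)%:E)%E +oo%E.
  rewrite RintegralZr //; apply/integrableP; split; first exact/measurable_EFinP.
  by under eq_integral => t /set_mem Dt do rewrite gee0_abs ?lee_fin ?e0 //.
rewrite leye_eq => /eqP inf; rewrite {2}/Rintegral inf /= mul0r /Rintegral.
have pos d : 0 <= d -> (\int[leb]_(t in D) (e t * d)%:E = d%:E * +oo)%E.
  move=> d0; under eq_integral do rewrite mulrC EFinM.
  by rewrite ge0_integralZl_EFin ?inf //; exact/measurable_EFinP.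
have [c0|c0] := leP 0 c.
  rewrite pos //; have [->|cn0] := eqVneq c 0; first by rewrite mul0e.
  by rewrite gt0_muley // lte_fin lt_neqAle eq_sym cn0.
have -> : (\int[leb]_(t in D) (e t * c)%:E = \int[leb]_(t in D) - (e t * - c)%:E)%E.
  by apply: eq_integral => t _; rewrite -EFinN mulrN opprK.
rewrite integral_ge0N; last first.
  by move=> t Dt; rewrite lee_fin mulr_ge0 ?e0 // oppr_ge0 ltW.
by rewrite pos ?oppr_ge0 ?(ltW c0) // gt0_muley // lte_fin oppr_gt0.
Qed.

End RealFubini.

(** * Integration of bounded measurable functions on subintervals of [0,1] *)

Section BoundedMeasurable.
Context {R : realType}.
Local Notation leb := (@lebesgue_measure R).
Implicit Types (a b c x y B C : R) (f g : R -> R).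

Definition bounded01 B f :=
  measurable_fun `[(0 : R), 1] f /\ forall x, 0 <= x <= 1 -> `|f x| <= B.

Lemma bounded01_integrable B f a b : bounded01 B f -> 0 <= a -> b <= 1 ->
  leb.-integrable `[a, b] (EFin \o f).
Proof.
move=> [mf fB] a0 b1; apply: measurable_bounded_integrable => //.
- by rewrite /= lebesgue_measure_itv /=; case: ifP => // _; rewrite -EFinB ltry.
- apply: measurable_funS mf => // x /=; rewrite !in_itv /= => /andP[ax xb].
  by rewrite (le_trans a0 ax) (le_trans xb b1).
- exists B; split; first exact: num_real.
  move=> y By x /=; rewrite in_itv /= => /andP[ax xb].
  by rewrite (le_trans _ (ltW By)) // fB // (le_trans a0 ax) (le_trans xb b1).
Qed.

Lemma bounded01_chasles B f a b c : bounded01 B f -> 0 <= a -> a <= b -> b <= c -> c <= 1 ->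
  \int[leb]_(x in `[a, c]) f x = \int[leb]_(x in `[a, b]) f x + \int[leb]_(x in `[b, c]) f x.
Proof.
move=> bf a0 ab bc c1; have ibc := bounded01_integrable bf (le_trans a0 ab) c1.
rewrite -(@Rintegral_itv_obnd_cbnd _ b (BRight c)); last first.
  by apply: integrableS ibc => // x /=; rewrite !in_itv /= => /andP[/ltW -> ->].
rewrite -(@Rintegral_itvB _ f (BLeft a) (BRight c) b) ?bnd_simp //.
  by rewrite addrC subrK.
exact: bounded01_integrable bf a0 c1.
Qed.

Lemma bounded01_cst c : bounded01 `|c| (fun=> c).
Proof. by split=> //; exact: measurable_cst. Qed.

Lemma bounded01D B C f g : bounded01 B f -> bounded01 C g -> bounded01 (B + C) (fun x => f x + g x).
Proof.
move=> [mf fB] [mg gC]; split; first exact: measurable_funD.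
by move=> x x01; rewrite (le_trans (ler_normD _ _)) // lerD ?fB ?gC.
Qed.

Lemma bounded01M B C f g : bounded01 B f -> bounded01 C g -> bounded01 (B * C) (fun x => f x * g x).
Proof.
move=> [mf fB] [mg gC]; split; first exact: measurable_funM.
by move=> x x01; rewrite normrM ler_pM ?fB ?gC.
Qed.

Lemma bounded01_norm B f : bounded01 B f -> bounded01 B (fun x => `|f x|).
Proof.
move=> [mf fB]; split; first exact: measurableT_comp.
by move=> x x01; rewrite normr_id fB.
Qed.

Lemma bounded01_le B C f g a b : bounded01 B f -> bounded01 C g -> 0 <= a -> b <= 1 ->
  (forall x, a <= x <= b -> f x <= g x) ->
  \int[leb]_(x in `[a, b]) f x <= \int[leb]_(x in `[a, b]) g x.
Proof.
move=> bf bg a0 b1 fg; apply: le_Rintegral => //.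
- exact: bounded01_integrable bf a0 b1.
- exact: bounded01_integrable bg a0 b1.
Qed.

Lemma Rintegral_itv_cst a b c : a <= b -> \int[leb]_(x in `[a, b]) c = c * (b - a).
Proof.
move=> ab; rewrite Rintegral_cst //; congr (_ * _).
transitivity (fine (lebesgue_measure `[a, b] : \bar R)); first by [].
rewrite lebesgue_measure_itv /= lte_fin; move: ab; rewrite le_eqVlt => /predU1P[->|->] //.
by rewrite ltxx subrr.
Qed.

Lemma bounded01_norm_le B C f g a b : bounded01 B f -> bounded01 C g -> 0 <= a -> b <= 1 ->
  (forall x, a <= x <= b -> `|f x| <= g x) ->
  `|\int[leb]_(x in `[a, b]) f x| <= \int[leb]_(x in `[a, b]) g x.
Proof.
move=> bf bg a0 b1 fg.
apply: (le_trans (le_normr_Rintegral _ (bounded01_integrable bf a0 b1))) => //.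
exact: bounded01_le (bounded01_norm bf) bg a0 b1 fg.
Qed.

Lemma bounded01Z B c f a b : bounded01 B f -> 0 <= a -> b <= 1 ->
  \int[leb]_(x in `[a, b]) (c * f x) = c * \int[leb]_(x in `[a, b]) f x.
Proof. by move=> bf a0 b1; rewrite RintegralZl //; exact: bounded01_integrable bf a0 b1. Qed.

Lemma bounded01_intD B C f g a b : bounded01 B f -> bounded01 C g -> 0 <= a -> b <= 1 ->
  \int[leb]_(x in `[a, b]) (f x + g x) =
  \int[leb]_(x in `[a, b]) f x + \int[leb]_(x in `[a, b]) g x.
Proof.
by move=> bf bg a0 b1; rewrite RintegralD //; [exact: bounded01_integrable bf a0 b1|exact: bounded01_integrable bg a0 b1].
Qed.

(** Bisection produces two halves, each with a quarter of the bound, so the bound halves at every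
    step. This stands in for the fundamental theorem of calculus where the density is merely bounded
    and measurable. *)
Lemma additive_quadratic_eq0 (Phi : R -> R -> R) C :
  (forall a b c, 0 <= a -> a <= b -> b <= c -> c <= 1 -> Phi a c = Phi a b + Phi b c) ->
  (forall a b, 0 <= a -> a <= b -> b <= 1 -> `|Phi a b| <= C * (b - a) ^+ 2) ->
  forall a b, 0 <= a -> a <= b -> b <= 1 -> Phi a b = 0.
Proof.
move=> add quad.
have h n : forall a b, 0 <= a -> a <= b -> b <= 1 -> `|Phi a b| * 2 ^+ n <= C * (b - a) ^+ 2.
  elim: n => [|n IH] a b a0 ab b1; first by rewrite expr0 mulr1 quad.
  pose c := (a + b) / 2; have ac : a <= c by rewrite /c; lra.
  have cb : c <= b by rewrite /c; lra.
  rewrite (add a c b) // exprS mulrCA.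
  have h1 := IH a c a0 ac (le_trans cb b1); have h2 := IH c b (le_trans a0 ac) cb b1.
  have p : 0 <= 2 ^+ n :> R by rewrite exprn_ge0.
  have h3 := ler_wpM2r p (ler_normD (Phi a c) (Phi c b)).
  have e1 : c - a = (b - a) / 2 by rewrite /c; lra.
  have e2 : b - c = (b - a) / 2 by rewrite /c; lra.
  rewrite e1 exprMn in h1; rewrite e2 exprMn in h2.
  have -> : C * (b - a) ^+ 2 = 2 * (C * ((b - a) ^+ 2 * 2^-1 ^+ 2) + C * ((b - a) ^+ 2 * 2^-1 ^+ 2)).
    by field.
  rewrite ler_pM2l //; lra.
move=> a b a0 ab b1; apply/eqP; rewrite -normr_eq0; apply/eqP.
apply/eqP; rewrite eq_le normr_ge0 andbT leNgt; apply/negP => p.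
have := h (Num.bound (C * (b - a) ^+ 2 / `|Phi a b|)) a b a0 ab b1.
rewrite mulrC -ler_pdivlMr // leNgt => /negP; apply.
have q0 : 0 <= C * (b - a) ^+ 2 / `|Phi a b|.
  by rewrite divr_ge0 // (le_trans _ (quad a b a0 ab b1)).
apply: (lt_le_trans (archi_boundP q0)); rewrite -natrX ler_nat.
by rewrite ltnW // ltn_expl.
Qed.

(** The piecewise norms control functions only inside the open cells, so the pointwise hypothesis
    must leave out the endpoints. *)
Lemma bounded01_norm_le_oo B C f g a b : bounded01 B f -> bounded01 C g -> 0 <= a -> b <= 1 ->
  (forall x, a < x < b -> `|f x| <= g x) ->
  `|\int[leb]_(x in `[a, b]) f x| <= \int[leb]_(x in `[a, b]) g x.
Proof.
move=> bf bg a0 b1 fg.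
have sub1 : `]a, b[ `<=` `[a, b] by move=> x /=; rewrite !in_itv /= => /andP[/ltW -> /ltW ->].
have sub2 : `]a, b] `<=` `[a, b] by move=> x /=; rewrite !in_itv /= => /andP[/ltW -> ->].
have op k D : bounded01 D k -> \int[leb]_(x in `[a, b]) k x = \int[leb]_(x in `]a, b[) k x.
  move=> bk; have ik := bounded01_integrable bk a0 b1.
  rewrite -Rintegral_itv_obnd_cbnd; last exact: integrableS ik.
  by rewrite -Rintegral_itv_bndo_bndc //; exact: integrableS ik.
rewrite (op _ _ bf) (op _ _ bg).
have if' : leb.-integrable `]a, b[ (EFin \o f).
  by apply: integrableS (bounded01_integrable bf a0 b1).
apply: (le_trans (le_normr_Rintegral _ if')) => //; apply: le_Rintegral => //.
- exact: integrable_norm.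
- by apply: integrableS (bounded01_integrable bg a0 b1).
Qed.

End BoundedMeasurable.

(** * Exact transport along a direction: kernel, responses and their regularity *)

Section Transport.
Context {R : realType}.
Local Notation leb := (@lebesgue_measure R).
Implicit Types (a b c x y t L G : R) (f g sigma : R -> R).

Lemma expR_sub_bound s (K : R) : `|s| <= K -> `|expR s - 1| <= `|s| * expR K.
Proof.
move=> sK; have h1 : s <= expR s - 1 by have := expR_ge1Dx s; lra.
have h2 : expR s - 1 <= s * expR s.
  have h : 1 - s <= expR (- s) by have := expR_ge1Dx (- s); lra.
  have := ler_wpM2l (expR_ge0 s) h; rewrite -expRD subrr expR0; lra.
have K1 : 1 <= expR K.
  have := expR_ge1Dx K; have := normr_ge0 s; lra.
have sKe : expR s <= expR K by rewrite ler_expR (le_trans (ler_norm s)).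
have [s0|s0] := leP 0 s.
  rewrite (ger0_norm s0) ger0_norm; last by lra.
  by apply: (le_trans h2); exact: ler_wpM2l.
have e1 : expR s <= 1 by rewrite -(@expR0 R) ler_expR ltW.
rewrite (ltr0_norm s0) ler0_norm; last by lra.
have : - s * 1 <= - s * expR K by apply: ler_wpM2l => //; lra.
lra.
Qed.

Lemma expR_sub2_bound s (K : R) : `|s| <= K -> `|expR s - 1 - s| <= s ^+ 2 * expR K.
Proof.
move=> sK; have h1 : s <= expR s - 1 by have := expR_ge1Dx s; lra.
have h2 : expR s - 1 <= s * expR s.
  have h : 1 - s <= expR (- s) by have := expR_ge1Dx (- s); lra.
  have := ler_wpM2l (expR_ge0 s) h; rewrite -expRD subrr expR0; lra.
rewrite ger0_norm; last by lra.
have h3 : expR s - 1 - s <= s * (expR s - 1) by lra.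
apply: (le_trans h3); apply: (le_trans (ler_norm _)); rewrite normrM.
rewrite -(real_normK (num_real s)) expr2 -mulrA; apply: ler_wpM2l => //.
exact: expR_sub_bound.
Qed.

Lemma expRN_lip a b : `|expR (- a) - expR (- b)| <= `|a - b| * (expR (- a) + expR (- b)).
Proof.
wlog ab : a b / a <= b => [hw|].
  have [ab|/ltW ba] := leP a b; first exact: hw.
  by rewrite distrC (distrC a) [X in _ * X]addrC hw.
have e : expR (- b) <= expR (- a) by rewrite ler_expR lerN2.
rewrite ger0_norm ?subr_ge0 // distrC (ger0_norm (_ : 0 <= b - a)) ?subr_ge0 //.
have h : 1 - (b - a) <= expR (- (b - a)) by have := expR_ge1Dx (- (b - a)); lra.
have h2 := ler_wpM2l (expR_ge0 (- a)) h; rewrite -expRD in h2.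
have e2 : - a - (b - a) = - b by ring.
rewrite e2 in h2.
have : 0 <= (b - a) * expR (- b) by rewrite mulr_ge0 ?expR_ge0 // subr_ge0.
lra.
Qed.

Section Fixed.
Variables (sigma : R -> R) (L : R).
Hypotheses (L1 : 1 <= L) (msigma : measurable_fun `[(0 : R), 1] sigma)
  (sigmaL : forall x, 0 <= x <= 1 -> L^-1 <= sigma x <= L).

Lemma L_gt0 : 0 < L. Proof. by move: (L1) => ?; lra. Qed.

Lemma sigma_ge0 x : 0 <= x <= 1 -> 0 <= sigma x.
Proof.
move=> x01; have /andP[h _] := sigmaL x01; apply: le_trans h.
by rewrite invr_ge0 ltW // L_gt0.
Qed.

Lemma bounded_sigma : bounded01 L sigma.
Proof.
by split=> // x x01; rewrite ger0_norm ?sigma_ge0 //; have /andP[] := sigmaL x01.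
Qed.

Definition tau x := \int[leb]_(y in `[0, x]) sigma y.

Lemma tauB x y : 0 <= x -> x <= y -> y <= 1 -> tau y - tau x = \int[leb]_(z in `[x, y]) sigma z.
Proof.
by move=> x0 xy y1; rewrite /tau (bounded01_chasles bounded_sigma _ x0 xy y1) // addrC addKr.
Qed.

Lemma tau_bounds x y : 0 <= x -> x <= y -> y <= 1 -> L^-1 * (y - x) <= tau y - tau x <= L * (y - x).
Proof.
move=> x0 xy y1; rewrite tauB // -!Rintegral_itv_cst //.
have in01 z : x <= z <= y -> 0 <= z <= 1.
  by move=> /andP[xz zy]; rewrite (le_trans x0 xz) (le_trans zy y1).
apply/andP; split.
- apply: (bounded01_le (bounded01_cst _) bounded_sigma x0 y1) => z /in01 /sigmaL /andP[].
  by [].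
- apply: (bounded01_le bounded_sigma (bounded01_cst _) x0 y1) => z /in01 /sigmaL /andP[].
  by [].
Qed.

Lemma tau_le x y : 0 <= x -> x <= y -> y <= 1 -> tau x <= tau y.
Proof.
move=> x0 xy y1; rewrite -subr_ge0; have /andP[h _] := tau_bounds x0 xy y1.
by apply: le_trans h; rewrite mulr_ge0 ?invr_ge0 ?subr_ge0 // ltW // L_gt0.
Qed.

Lemma tau_lip x y : 0 <= x <= 1 -> 0 <= y <= 1 -> `|tau x - tau y| <= L * `|x - y|.
Proof.
wlog xy : x y / x <= y => [hw x01 y01|].
  have [xy|/ltW yx] := leP x y; first exact: hw.
  by rewrite distrC (distrC x) hw.
move=> /andP[x0 x1] /andP[y0 y1].
rewrite distrC ger0_norm ?subr_ge0 ?tau_le // distrC ger0_norm ?subr_ge0 //.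
by have /andP[] := tau_bounds x0 xy y1.
Qed.

Lemma optical_depthE x y : 0 <= x <= 1 -> 0 <= y <= 1 ->
  optical_depth sigma x y = `|tau x - tau y|.
Proof.
move=> /andP[x0 x1] /andP[y0 y1]; rewrite /optical_depth; have [xy|/ltW yx] := leP x y.
  by rewrite -tauB // distrC.
by rewrite -tauB.
Qed.

Lemma tau0 : tau 0 = 0.
Proof. by rewrite /tau set_itv1 Rintegral_set1. Qed.

Lemma measurable_tau : measurable_fun `[(0 : R), 1] tau.
Proof.
apply: subspace_continuous_measurable_fun => //.
apply: parameterized_integral_continuous => //.
exact: (bounded01_integrable bounded_sigma).
Qed.

Lemma tau_range x : 0 <= x <= 1 -> 0 <= tau x <= L.
Proof.
move=> /andP[x0 x1]; rewrite -tau0 tau_le //=.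
have /andP[_] := tau_bounds (lexx 0) x0 x1; rewrite tau0 !subr0 => /le_trans; apply.
by rewrite ler_piMr // ltW // L_gt0.
Qed.

Lemma bounded_expR_tau c : bounded01 (expR (`|c| * L)) (fun y => expR (c * tau y)).
Proof.
split.
  apply: measurableT_comp; first exact: measurable_expR.
  by apply: measurable_funM => //; exact: measurable_tau.
move=> x x01; rewrite ger0_norm ?expR_ge0 // ler_expR (le_trans (ler_norm _)) // normrM.
rewrite ler_wpM2l //; have /andP[t0 tL] := tau_range x01.
by rewrite ger0_norm.
Qed.

(** The chain rule for exp(c tau). The defect [Phi] is additive over adjacent intervals and,
    expanding the exponential about the left endpoint, quadratic in their length. *)
Lemma exp_tau_integral c a b : 0 <= a -> a <= b -> b <= 1 ->
  \int[leb]_(y in `[a, b]) (sigma y * (c * expR (c * tau y))) =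
  expR (c * tau b) - expR (c * tau a).
Proof.
set K := expR (`|c| * L).
have bcst : bounded01 `|c| (fun=> c) := bounded01_cst c.
have bE : bounded01 (L * (`|c| * K)) (fun y => sigma y * (c * expR (c * tau y))).
  by apply: (bounded01M bounded_sigma); apply: bounded01M => //; exact: bounded_expR_tau.
pose Phi a b := \int[leb]_(y in `[a, b]) (sigma y * (c * expR (c * tau y))) -
  (expR (c * tau b) - expR (c * tau a)).
move=> a0 ab b1; apply/eqP; rewrite -subr_eq0; apply/eqP.
apply: (@additive_quadratic_eq0 R Phi (2 * (`|c| * L) ^+ 2 * K ^+ 2)) => //; last first.
  move=> {a0 ab b1} x y x0 xy y1; have L0 := L_gt0.
  have x01 : 0 <= x <= 1 by rewrite x0 (le_trans xy).
  have y01 : 0 <= y <= 1 by rewrite y1 (le_trans x0).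
  have K0 : 0 <= K by exact: expR_ge0.
  have diff z : x <= z <= y -> `|c * tau z - c * tau x| <= `|c| * L * (y - x).
    move=> /andP[xz zy]; rewrite -mulrBr normrM -mulrA ler_wpM2l //.
    have z01 : 0 <= z <= 1 by rewrite (le_trans x0 xz) (le_trans zy y1).
    apply: (le_trans (tau_lip z01 x01)); rewrite ler_wpM2l ?(ltW L0) // ger0_norm; lra.
  have diffK z : x <= z <= y -> `|c * tau z - c * tau x| <= `|c| * L.
    move=> xzy; apply: (le_trans (diff z xzy)); rewrite ler_piMr ?mulr_ge0 ?(ltW L0) //; lra.
  have cx : expR (c * tau x) <= K by have [_ h] := bounded_expR_tau c; have := h x x01; rewrite ger0_norm ?expR_ge0.
  have bD : bounded01 (L * (`|c| * (K + K))) (fun z => sigma z * (c * (expR (c * tau z) - expR (c * tau x)))).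
    apply: (bounded01M bounded_sigma); apply: bounded01M => //; apply: bounded01D.
      exact: bounded_expR_tau.
    have [m1 m2] := bounded01_cst (- expR (c * tau x)); split=> // z z01.
    by rewrite (le_trans (m2 z z01)) // normrN ger0_norm ?expR_ge0.
  have -> : Phi x y = \int[leb]_(z in `[x, y]) (sigma z * (c * (expR (c * tau z) - expR (c * tau x)))) -
      expR (c * tau x) * (expR (c * tau y - c * tau x) - 1 - (c * tau y - c * tau x)).
    have -> : \int[leb]_(z in `[x, y]) (sigma z * (c * (expR (c * tau z) - expR (c * tau x)))) =
       \int[leb]_(z in `[x, y]) (sigma z * (c * expR (c * tau z)) + (- (c * expR (c * tau x))) * sigma z).
      apply: eq_Rintegral => z _.
      by move: (sigma z) (expR (c * tau z)) (expR (c * tau x)) => p q v; ring.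
    rewrite (bounded01_intD bE (bounded01M (bounded01_cst _) bounded_sigma) x0 y1).
    rewrite (bounded01Z _ bounded_sigma x0 y1) -tauB //.
    have e : expR (c * tau x) * expR (c * tau y - c * tau x) = expR (c * tau y).
      by rewrite -expRD; congr expR; ring.
    rewrite /Phi !mulrBr e.
    move: (expR (c * tau x)) (expR (c * tau y)) (\int[leb]_(z in _) _) (tau x) (tau y) => p q v tx ty.
    by ring.
  have h1 := bounded01_norm_le bD (bounded01_cst (L * (`|c| * (`|c| * L * (y - x) * K ^+ 2)))) x0 y1.
  have {}h1 := h1 _.
  have h2 : `|expR (c * tau x) * (expR (c * tau y - c * tau x) - 1 - (c * tau y - c * tau x))| <=
      K * ((`|c| * L * (y - x)) ^+ 2 * K).
    have xyy : x <= y <= y by rewrite xy lexx.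
    rewrite normrM (ger0_norm (expR_ge0 _)); apply: ler_pM => //.
    apply: (le_trans (expR_sub2_bound (diffK y xyy))); rewrite ler_wpM2r //.
    rewrite -(real_normK (num_real (_ - _))) ler_sqr ?nnegrE ?diff //.
    by rewrite !mulr_ge0 ?(ltW L0) // subr_ge0.
  apply: (le_trans (ler_normB _ _)).
  have h3 : `|\int[leb]_(z in `[x, y]) (sigma z * (c * (expR (c * tau z) - expR (c * tau x))))| <=
     L * (`|c| * (`|c| * L * (y - x) * K ^+ 2)) * (y - x).
    rewrite -Rintegral_itv_cst //; apply: h1 => z xzy.
    have z01 : 0 <= z <= 1 by case/andP: xzy => xz zy; rewrite (le_trans x0 xz) (le_trans zy y1).
    rewrite !normrM (ger0_norm (sigma_ge0 z01)).
    apply: ler_pM; rewrite ?sigma_ge0 ?mulr_ge0 //; first by have /andP[] := sigmaL z01.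
    rewrite ler_wpM2l //.
    have -> : expR (c * tau z) - expR (c * tau x) = expR (c * tau x) * (expR (c * tau z - c * tau x) - 1).
      have e : expR (c * tau x) * expR (c * tau z - c * tau x) = expR (c * tau z).
        by rewrite -expRD; congr expR; ring.
      by rewrite mulrBr e mulr1.
    rewrite normrM (ger0_norm (expR_ge0 _)) expr2 mulrCA -mulrA.
    have -> : K * (`|c| * (L * (y - x)) * K) = K * (`|c| * L * (y - x) * K) by ring.
    apply: ler_pM => //; apply: (le_trans (expR_sub_bound (diffK z xzy))).
    by rewrite ler_wpM2r // diff.
  apply: (le_trans (lerD h3 h2)); apply: le_of_eq; ring.
move=> {a0 ab b1} x y z x0 xy yz z1.
rewrite /Phi (bounded01_chasles bE x0 xy yz z1).
move: (\int[leb]_(y0 in `[x, y]) _) (\int[leb]_(y0 in `[y, z]) _) => p q.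
by move: (expR (c * tau x)) (expR (c * tau y)) (expR (c * tau z)) => e1 e2 e3; ring.
Qed.

(** Here t = 1 / mu. [psi] is the angular flux driven by the source [g] in the direction mu or -mu,
    and [slab] is the sum of the two. *)
Definition ker x t y := t * expR (- (t * `|tau x - tau y|)).
Definition psi (b : bool) g x t :=
  if b then \int[leb]_(y in `[0, x]) (ker x t y * g y)
  else \int[leb]_(y in `[x, 1]) (ker x t y * g y).
Definition slab g x t := \int[leb]_(y in `[0, 1]) (ker x t y * g y).

Lemma ker_ge0 x t y : 0 <= t -> 0 <= ker x t y.
Proof. by move=> t0; rewrite mulr_ge0 ?expR_ge0. Qed.

Lemma bounded_ker x t : 0 <= t -> bounded01 t (ker x t).
Proof.
move=> t0; split.
  apply: measurable_funM => //; apply: measurableT_comp; first exact: measurable_expR.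
  apply: measurableT_comp => //; apply: measurable_funM => //; apply: measurableT_comp => //.
  by apply: measurable_funB => //; exact: measurable_tau.
move=> y _; rewrite ger0_norm ?ker_ge0 // ler_piMr // -[leRHS](@expR0 R) ler_expR.
by rewrite oppr_le0 mulr_ge0.
Qed.

Lemma ker_le x y t : 0 <= y -> y <= x -> x <= 1 ->
  ker x t y = t * expR (- (t * tau x)) * expR (t * tau y).
Proof.
move=> y0 yx x1; rewrite /ker ger0_norm ?subr_ge0 ?tau_le // -mulrA -expRD.
by congr (_ * expR _); ring.
Qed.

Lemma ker_ge x y t : 0 <= x -> x <= y -> y <= 1 ->
  ker x t y = t * expR (t * tau x) * expR (- t * tau y).
Proof.
move=> x0 xy y1; rewrite /ker ler0_norm ?subr_le0 ?tau_le // -mulrA -expRD.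
by congr (_ * expR _); ring.
Qed.

Lemma psiD g G x t : bounded01 G g -> 0 <= t -> 0 <= x <= 1 ->
  slab g x t = psi true g x t + psi false g x t.
Proof.
move=> bg t0 /andP[x0 x1]; rewrite /slab /psi.
exact: (bounded01_chasles (bounded01M (bounded_ker x t0) bg) (lexx 0) x0 x1 (lexx 1)).
Qed.

Lemma psi_step_true g G a b t : bounded01 G g -> 0 <= t -> 0 <= a -> a <= b -> b <= 1 ->
  psi true g b t = expR (- (t * (tau b - tau a))) * psi true g a t +
    \int[leb]_(y in `[a, b]) (ker b t y * g y).
Proof.
move=> bg t0 a0 ab b1; rewrite /psi.
rewrite (bounded01_chasles (bounded01M (bounded_ker b t0) bg) (lexx 0) a0 ab b1); congr (_ + _).
rewrite -(bounded01Z _ (bounded01M (bounded_ker a t0) bg) (lexx 0) (le_trans ab b1)).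
apply: eq_Rintegral => y; rewrite inE /= in_itv /= => /andP[y0 ya].
rewrite mulrA !ker_le ?(le_trans ya ab) ?(le_trans ab b1) //; congr (_ * _).
rewrite mulrA [_ * (t * _)]mulrCA -expRD; congr (t * expR _ * _); ring.
Qed.

Lemma psi_step_false g G a b t : bounded01 G g -> 0 <= t -> 0 <= a -> a <= b -> b <= 1 ->
  psi false g a t = expR (- (t * (tau b - tau a))) * psi false g b t +
    \int[leb]_(y in `[a, b]) (ker a t y * g y).
Proof.
move=> bg t0 a0 ab b1; rewrite /psi.
rewrite (bounded01_chasles (bounded01M (bounded_ker a t0) bg) a0 ab b1 (lexx 1)) addrC; congr (_ + _).
rewrite -(bounded01Z _ (bounded01M (bounded_ker b t0) bg) (le_trans a0 ab) (lexx 1)).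
apply: eq_Rintegral => y; rewrite inE /= in_itv /= => /andP[yb y1].
rewrite mulrA !ker_ge ?(le_trans a0 ab) ?(le_trans ab yb) //; congr (_ * _).
rewrite mulrA [_ * (t * _)]mulrCA -expRD; congr (t * expR _ * _); ring.
Qed.

(** The response to the source [sigma] is explicit because the kernel times [sigma] is a derivative.
    Through [dominated_by_sigma] it is a majorant for every bounded source, uniformly in t. *)
Lemma psi_sigma x t : 0 <= t -> 0 <= x <= 1 ->
  psi true sigma x t = 1 - expR (- (t * tau x)) /\
  psi false sigma x t = 1 - expR (- (t * (tau 1 - tau x))).
Proof.
move=> t0 /andP[x0 x1]; rewrite /psi; split.
- transitivity (\int[leb]_(y in `[0, x]) (expR (- (t * tau x)) * (sigma y * (t * expR (t * tau y))))).
    apply: eq_Rintegral => y; rewrite inE /= in_itv /= => /andP[y0 yx].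
    by rewrite ker_le //; move: (expR _) (expR _) (sigma y) => p q r; ring.
  rewrite (bounded01Z _ (bounded01M bounded_sigma (bounded01M (bounded01_cst _) (bounded_expR_tau _))) (lexx 0) x1).
  rewrite exp_tau_integral // tau0 mulr0 expR0 mulrBr -expRD addNr expR0 mulr1.
  by [].
- transitivity (\int[leb]_(y in `[x, 1]) (- expR (t * tau x) * (sigma y * (- t * expR (- t * tau y))))).
    apply: eq_Rintegral => y; rewrite inE /= in_itv /= => /andP[xy y1].
    by rewrite ker_ge //; move: (expR _) (expR _) (sigma y) => p q r; ring.
  rewrite (bounded01Z _ (bounded01M bounded_sigma (bounded01M (bounded01_cst _) (bounded_expR_tau _))) x0 (lexx 1)).
  rewrite exp_tau_integral // mulNr mulrBr opprB -!expRD; congr (_ - expR _); last by ring.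
  by rewrite mulNr subrr expR0.
Qed.

Lemma dominated_by_sigma g G y : (forall z, 0 <= z <= 1 -> `|g z| <= G) -> 0 <= y <= 1 ->
  `|g y| <= L * G * sigma y.
Proof.
move=> gG y01; have L0 := L_gt0; have /andP[s1 _] := sigmaL y01.
have G0 : 0 <= G by apply: le_trans (gG y y01).
apply: (le_trans (gG y y01)); rewrite -mulrA mulrCA ler_peMr //.
by have := ler_wpM2l (ltW L0) s1; rewrite divff ?gt_eqF.
Qed.

Lemma psi_bound (b : bool) g G x t : bounded01 G g -> 0 <= t -> 0 <= x <= 1 ->
  `|psi b g x t| <= L * G.
Proof.
move=> bg t0 x01; have /andP[x0 x1] := x01; have [_ gG] := bg; have L0 := L_gt0.
have G0 : 0 <= G by apply: le_trans (gG x x01).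
have bk := bounded_ker x t0; have bkg := bounded01M bk bg.
have bks := bounded01M (bounded01_cst (L * G)) (bounded01M bk bounded_sigma).
have dom y : 0 <= y <= 1 -> `|ker x t y * g y| <= L * G * (ker x t y * sigma y).
  move=> y01; rewrite normrM (ger0_norm (ker_ge0 _ _ t0)) mulrCA.
  by rewrite ler_wpM2l ?ker_ge0 // dominated_by_sigma.
have [p1 p2] := psi_sigma t0 x01.
have LG : 0 <= L * G by rewrite mulr_ge0 // ltW.
case: b.
- apply: (le_trans (bounded01_norm_le bkg bks (lexx 0) x1 _)).
    by move=> y /andP[y0 yx]; rewrite dom // y0 (le_trans yx).
  rewrite (bounded01Z _ (bounded01M bk bounded_sigma) (lexx 0) x1) -/(psi true sigma x t) p1.
  by rewrite ler_piMr // gerBl expR_ge0.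
- apply: (le_trans (bounded01_norm_le bkg bks x0 (lexx 1) _)).
    by move=> y /andP[xy y1]; rewrite dom // y1 (le_trans x0).
  rewrite (bounded01Z _ (bounded01M bk bounded_sigma) x0 (lexx 1)) -/(psi false sigma x t) p2.
  by rewrite ler_piMr // gerBl expR_ge0.
Qed.

Lemma slab_bound g G x t : bounded01 G g -> 0 <= t -> 0 <= x <= 1 -> `|slab g x t| <= 2 * (L * G).
Proof.
move=> bg t0 x01; rewrite (psiD bg) // (le_trans (ler_normD _ _)) //.
have := psi_bound true bg t0 x01; have := psi_bound false bg t0 x01; lra.
Qed.

Lemma slab_sigma x t : 0 <= t -> 0 <= x <= 1 ->
  slab sigma x t = 2 - expR (- (t * tau x)) - expR (- (t * (tau 1 - tau x))).
Proof.
move=> t0 x01; rewrite (psiD bounded_sigma) //; have [-> ->] := psi_sigma t0 x01.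
by move: (expR _) (expR _) => p q; ring.
Qed.

Lemma slab_sigma_le2 x t : 0 <= t -> 0 <= x <= 1 -> slab sigma x t <= 2.
Proof.
move=> t0 x01; rewrite slab_sigma //.
have := expR_ge0 (- (t * tau x)); have := expR_ge0 (- (t * (tau 1 - tau x))); lra.
Qed.

(** With q = t / t', the kernels differ by at most ker_t + (1 - 2q) ker_t'. Against [sigma] both
    integrals are explicit, increasing in t and at most 2, so the total is at most (2 - 2q) times
    2. *)
Lemma slab_lip_t g G x t t' : bounded01 G g -> 0 < t -> t <= t' -> 0 <= x <= 1 ->
  `|slab g x t - slab g x t'| <= 4 * (L * G) * (1 - t / t').
Proof.
move=> bg t0 tt x01; have [_ gG] := bg; have L0 := L_gt0.
have G0 : 0 <= G by apply: le_trans (gG x x01).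
have t0' : 0 < t' by lra.
have bk := bounded_ker x (ltW t0); have bk' := bounded_ker x (ltW t0').
have bkg := bounded01M bk bg; have bkg' := bounded01M bk' bg.
have bN : bounded01 (t' * G) (fun y => -1 * (ker x t' y * g y)).
  by have := bounded01M (bounded01_cst (-1)) bkg'; rewrite normrN normr1 mul1r.
have -> : slab g x t - slab g x t' = \int[leb]_(y in `[0, 1]) (ker x t y * g y + -1 * (ker x t' y * g y)).
  by rewrite (bounded01_intD bkg bN) // (bounded01Z _ bkg') // mulN1r.
set q := t / t'; have q1 : q <= 1 by rewrite ler_pdivrMr // mul1r.
have q0 : 0 < q by rewrite divr_gt0.
have bs := bounded01M bk bounded_sigma; have bs' := bounded01M bk' bounded_sigma.
have bs2 := bounded01M (bounded01_cst (1 - 2 * q)) bs'.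
have bsum := bounded01M (bounded01_cst (L * G)) (bounded01D bs2 bs).
apply: (le_trans (bounded01_norm_le (bounded01D bkg bN) bsum (lexx 0) (lexx 1) _)).
  move=> y y01; have dom := dominated_by_sigma gG y01.
  have -> : ker x t y * g y + -1 * (ker x t' y * g y) = (ker x t y - ker x t' y) * g y.
    by rewrite mulrBl mulN1r.
  rewrite normrM.
  have -> : L * G * ((1 - 2 * q) * (ker x t' y * sigma y) + ker x t y * sigma y) =
     ((1 - 2 * q) * ker x t' y + ker x t y) * (L * G * sigma y).
    by move: (ker _ _ _) (ker _ _ _) (sigma y) => k k' sg; ring.
  apply: ler_pM => //.
  rewrite /ker; have : 0 <= `|tau x - tau y| by []; move: `|tau x - tau y| => d d0.
  have ee : expR (- (t' * d)) <= expR (- (t * d)) by rewrite ler_expR lerN2 ler_wpM2r.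
  have e0 := expR_ge0 (- (t' * d)).
  have -> : t * expR (- (t * d)) - t' * expR (- (t' * d)) =
     t * (expR (- (t * d)) - expR (- (t' * d))) - (t' - t) * expR (- (t' * d)).
    by move: (expR _) (expR _) => p r; ring.
  have -> : (1 - 2 * q) * (t' * expR (- (t' * d))) + t * expR (- (t * d)) =
     t * (expR (- (t * d)) - expR (- (t' * d))) + (t' - t) * expR (- (t' * d)).
    by move: (expR _) (expR _) => p r; rewrite /q; field; rewrite gt_eqF.
  rewrite (le_trans (ler_normB _ _)) // !ger0_norm // mulr_ge0 ?subr_ge0 //; exact: ltW.
rewrite (bounded01Z _ (bounded01D bs2 bs)) // (bounded01_intD bs2 bs) // (bounded01Z _ bs') //.
rewrite -!/(slab _ _ _).
have A2 := slab_sigma_le2 (ltW t0') x01.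
have AA : slab sigma x t <= slab sigma x t'.
  rewrite !slab_sigma // ?(ltW t0) ?(ltW t0') //.
  have /andP[x0 x1] := x01.
  have tx : 0 <= tau x by have /andP[] := tau_range x01.
  have tx1 : 0 <= tau 1 - tau x by rewrite subr_ge0 tau_le.
  have a1 : expR (- (t' * tau x)) <= expR (- (t * tau x)) by rewrite ler_expR lerN2 ler_wpM2r.
  have a2 : expR (- (t' * (tau 1 - tau x))) <= expR (- (t * (tau 1 - tau x))).
    by rewrite ler_expR lerN2 ler_wpM2r.
  move: a1 a2; move: (expR _) (expR _) (expR _) (expR _) => p1 p2 p3 p4; lra.
have LG : 0 <= L * G by rewrite mulr_ge0 // ltW.
have -> : 4 * (L * G) * (1 - q) = L * G * (4 * (1 - q)) by ring.
rewrite ler_wpM2l //.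
have : (1 - q) * slab sigma x t' <= (1 - q) * 2 by rewrite ler_wpM2l // subr_ge0.
move: AA; move: (slab _ _ _) (slab _ _ _) => p1 p2; nra.
Qed.

(** [expRN_lip] keeps both exponentials on its right side, so the integral against [sigma] costs 4
    and no second factor t. *)
Lemma slab_lip_x g G x x' t : bounded01 G g -> 0 <= t -> 0 <= x <= 1 -> 0 <= x' <= 1 ->
  `|slab g x t - slab g x' t| <= 4 * (L ^+ 2 * G) * (t * `|x - x'|).
Proof.
move=> bg t0 x01 x01'; have [_ gG] := bg; have L0 := L_gt0.
have G0 : 0 <= G by apply: le_trans (gG x x01).
have bk := bounded_ker x t0; have bk' := bounded_ker x' t0.
have bkg := bounded01M bk bg; have bkg' := bounded01M bk' bg.
have bN : bounded01 (t * G) (fun y => -1 * (ker x' t y * g y)).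
  by have := bounded01M (bounded01_cst (-1)) bkg'; rewrite normrN normr1 mul1r.
have -> : slab g x t - slab g x' t = \int[leb]_(y in `[0, 1]) (ker x t y * g y + -1 * (ker x' t y * g y)).
  by rewrite (bounded01_intD bkg bN) // (bounded01Z _ bkg') // mulN1r.
have bs := bounded01M bk bounded_sigma; have bs' := bounded01M bk' bounded_sigma.
set c := L ^+ 2 * G * (t * `|x - x'|).
have c0 : 0 <= c by rewrite !mulr_ge0 ?exprn_ge0 // ltW.
have bsum := bounded01M (bounded01_cst c) (bounded01D bs bs').
apply: (le_trans (bounded01_norm_le (bounded01D bkg bN) bsum (lexx 0) (lexx 1) _)).
  move=> y y01; have dom := dominated_by_sigma gG y01.
  have -> : ker x t y * g y + -1 * (ker x' t y * g y) = (ker x t y - ker x' t y) * g y.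
    by rewrite mulrBl mulN1r.
  rewrite normrM.
  have -> : c * (ker x t y * sigma y + ker x' t y * sigma y) =
     ((t * (L * `|x - x'|)) * (ker x t y + ker x' t y)) * (L * G * sigma y).
    by rewrite /c; move: (ker _ _ _) (ker _ _ _) (sigma y) `|_| => k k' sg d; ring.
  apply: ler_pM => //; rewrite /ker -mulrBr normrM (ger0_norm t0) -mulrDr mulrCA ler_wpM2l //.
  apply: (le_trans (expRN_lip _ _)); apply: ler_wpM2r; first by rewrite addr_ge0 ?expR_ge0.
  rewrite -mulrBr normrM (ger0_norm t0) ler_wpM2l //.
  apply: (le_trans (ler_dist_dist _ _)).
  by rewrite (_ : tau x - tau y - (tau x' - tau y) = tau x - tau x') ?tau_lip //; ring.
rewrite (bounded01Z _ (bounded01D bs bs')) // (bounded01_intD bs bs') //.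
have -> : 4 * (L ^+ 2 * G) * (t * `|x - x'|) = c * (2 + 2) by rewrite /c; ring.
rewrite ler_wpM2l //; apply: lerD; exact: slab_sigma_le2.
Qed.

(** First-order expansion of the transmission through a cell. Together with [cell_source] it
    supplies, at t = 1 / m, the bounds on [er] and [sr] assumed by the sweep estimate. *)
Lemma cell_decay a b (s H D : R) t : 0 <= a -> a <= b -> b <= 1 -> b - a <= H -> 0 <= t ->
  (forall y, a < y < b -> `|sigma y - s| <= D) ->
  `|expR (- (t * (tau b - tau a))) - (1 - (b - a) * s * t)| <=
    (b - a) * t * (L ^+ 2 * (H * t) + D).
Proof.
move=> a0 ab b1 bH t0 sD; have L0 := L_gt0.
have ba : 0 <= b - a by rewrite subr_ge0.
have h1 : `|(tau b - tau a) - (b - a) * s| <= D * (b - a).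
  rewrite tauB // [(b - a) * s]mulrC -!Rintegral_itv_cst // .
  have bN := bounded01M (bounded01_cst (-1)) (bounded01_cst s).
  rewrite -mulN1r -(bounded01Z _ (bounded01_cst s) a0 b1) -(bounded01_intD bounded_sigma bN a0 b1).
  apply: (bounded01_norm_le_oo (bounded01D bounded_sigma bN) (bounded01_cst D) a0 b1) => y yab.
  by rewrite mulN1r sD.
set u := t * (tau b - tau a).
have u0 : 0 <= u by rewrite mulr_ge0 // subr_ge0 tau_le.
have uL : u <= t * (L * (b - a)).
  by rewrite ler_wpM2l //; have /andP[] := tau_bounds a0 ab b1.
have h2 : `|expR (- u) - (1 - u)| <= u ^+ 2.
  have g1 := expR_ge1Dx (- u); have g2 := ler_wpM2l (expR_ge0 (- u)) (expR_ge1Dx u).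
  rewrite -expRD addNr expR0 in g2; rewrite ger0_norm; last by lra.
  by move: g1 g2; move: (expR _) => p g1 g2; nra.
have -> : expR (- u) - (1 - (b - a) * s * t) =
   (expR (- u) - (1 - u)) - t * ((tau b - tau a) - (b - a) * s).
  by move: (expR (- u)) => p; rewrite /u; move: (tau b) (tau a) => q r; ring.
apply: (le_trans (ler_normB _ _)); rewrite [`|t * _|]normrM (ger0_norm t0).
have h3 : u ^+ 2 <= t * (L * (b - a)) * (t * (L * H)).
  rewrite expr2; apply: ler_pM => //; apply: (le_trans uL).
  by rewrite ler_wpM2l // ler_wpM2l // ltW.
have h4 := ler_wpM2l t0 h1.
have -> : (b - a) * t * (L ^+ 2 * (H * t) + D) = t * (L * (b - a)) * (t * (L * H)) + t * (D * (b - a)) by ring.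
by apply: lerD => //; exact: le_trans h2 h3.
Qed.

Lemma cell_source a b x g G (gj H D : R) t : bounded01 G g -> 0 <= a -> a <= b -> b <= 1 ->
  b - a <= H -> 0 <= t -> a <= x <= b ->
  (forall y, a < y < b -> `|g y - gj| <= G * D) ->
  `|\int[leb]_(y in `[a, b]) (ker x t y * g y) - (b - a) * gj * t| <=
    (b - a) * t * (G * (L * (H * t) + D)).
Proof.
move=> bg a0 ab b1 bH t0 /andP[ax xb] gD; have L0 := L_gt0; have [_ gG] := bg.
have x01 : 0 <= x <= 1 by rewrite (le_trans a0 ax) (le_trans xb b1).
have G0 : 0 <= G by apply: le_trans (gG x x01).
have bk := bounded01M (bounded_ker x t0) bg; have bc := bounded01_cst (- (gj * t)).
have -> : \int[leb]_(y in `[a, b]) (ker x t y * g y) - (b - a) * gj * t =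
   \int[leb]_(y in `[a, b]) (ker x t y * g y + - (gj * t)).
  rewrite (bounded01_intD bk bc a0 b1) Rintegral_itv_cst //; congr (_ + _); ring.
have -> : (b - a) * t * (G * (L * (H * t) + D)) = t * (G * (L * (H * t) + D)) * (b - a) by ring.
rewrite -Rintegral_itv_cst //.
apply: (bounded01_norm_le_oo (bounded01D bk bc) (bounded01_cst _) a0 b1) => y /andP[ay yb].
have y01 : 0 <= y <= 1 by rewrite (le_trans a0 (ltW ay)) (le_trans (ltW yb) b1).
have -> : ker x t y * g y + - (gj * t) = (ker x t y - t) * g y + t * (g y - gj).
  by move: (ker _ _ _) (g y) => p q; ring.
apply: (le_trans (ler_normD _ _)).
have h1 : `|ker x t y - t| <= t * (t * (L * H)).
  rewrite /ker (_ : t * expR _ - t = t * (expR (- (t * `|tau x - tau y|)) - 1)); last first.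
    by rewrite mulrBr mulr1.
  rewrite normrM (ger0_norm t0) ler_wpM2l //.
  set d := t * _; have d0 : 0 <= d by rewrite mulr_ge0.
  have e1 : expR (- d) <= 1 by rewrite -[leRHS](@expR0 R) ler_expR oppr_le0.
  have e2 := expR_ge1Dx (- d).
  rewrite ler0_norm; last by rewrite subr_le0.
  apply: (@le_trans _ _ d); first by move: e2; move: (expR _) => p; lra.
  rewrite ler_wpM2l //; apply: (le_trans (tau_lip x01 y01)); rewrite ler_wpM2l ?(ltW L0) //.
  by apply: le_trans bH; rewrite ler_norml; apply/andP; split; lra.
have h2 : `|(ker x t y - t) * g y| <= t * (t * (L * H)) * G.
  by rewrite normrM; apply: ler_pM => //; exact: gG.
have h3 : `|t * (g y - gj)| <= t * (G * D).
  by rewrite normrM (ger0_norm t0) ler_wpM2l // gD // ay.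
apply: (le_trans (lerD h2 h3)); apply: le_of_eq; ring.
Qed.

(** Fubini's theorem applied to the integral representation of [E1]; the majorant 2 L G t^-2 comes
    from domination by [sigma]. *)
Lemma flux_slab g G x : bounded01 G g -> 0 <= x <= 1 ->
  leb.-integrable `[1%R, +oo[ (EFin \o (fun t => (t^-1) ^+ 2 * slab g x t)) /\
  \int[leb]_(y in `[0, 1]) (E1 (optical_depth sigma x y) * g y) =
  \int[leb]_(t in `[1, +oo[) ((t^-1) ^+ 2 * slab g x t).
Proof.
move=> bg x01; have [mg gG] := bg; have L0 := L_gt0.
have G0 : 0 <= G by apply: le_trans (gG x x01).
pose k t y := expR (- (t * `|tau x - tau y|)) / t * g y.
have kE t y : 0 < t -> k t y = (t^-1) ^+ 2 * (ker x t y * g y).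
  by move=> t0; rewrite /k /ker; move: (expR _) (g y) => p q; field; rewrite gt_eqF.
have pos t : t \in `[1, +oo[ -> 0 < t by rewrite in_itv /= andbT; exact: lt_le_trans.
have minv : measurable_fun `[(1 : R), +oo[ (fun t : R => t^-1).
  apply: subspace_continuous_measurable_fun => //.
  apply/subspace_continuousP => t /= t1; apply: cvg_within_filter.
  by apply: cvgV; [rewrite gt_eqF // pos|exact: cvg_id].
have [||||||i1 i2] := @Rfubini R `[1, +oo[ `[0, 1] k (fun t => 2 * (L * G) * t `^ (- (1 + 1))).
- by [].
- by [].
- have m1 : measurable_fun (`[(1 : R), +oo[ `*` `[(0 : R), 1]) (fun p : R * R => `|tau x - tau p.2|).
    apply: measurableT_comp => //; apply: measurable_funB => //.
    apply: (@measurable_comp _ _ _ _ _ _ `[(0 : R), 1]) => //; last first.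
      by apply: measurable_funTS; exact: measurable_snd.
      exact: measurable_tau.
    by move=> _ [p [_ p2] <-].
  have m2 : measurable_fun (`[(1 : R), +oo[ `*` `[(0 : R), 1]) (fun p : R * R => g p.2).
    apply: (@measurable_comp _ _ _ _ _ _ `[(0 : R), 1]) => //; last first.
      by apply: measurable_funTS; exact: measurable_snd.
    by move=> _ [p [_ p2] <-].
  have m3 : measurable_fun (`[(1 : R), +oo[ `*` `[(0 : R), 1]) (fun p : R * R => p.1^-1).
    apply: (@measurable_comp _ _ _ _ _ _ `[(1 : R), +oo[) => //; last first.
      by apply: measurable_funTS; exact: measurable_fst.
    by move=> _ [p [p1 _] <-].
  apply: measurable_funM => //; apply: measurable_funM => //.
  apply: measurableT_comp; first exact: measurable_expR.
  apply: measurableT_comp => //; apply: measurable_funM => //.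
  by apply: measurable_funTS; exact: measurable_fst.
- move=> t /pos t0; apply: (bounded01_integrable (B := t^-1 ^+ 2 * (t * G))) => //.
  have := bounded01M (bounded01_cst (t^-1 ^+ 2)) (bounded01M (bounded_ker x (ltW t0)) bg).
  rewrite ger0_norm ?sqr_ge0 // => -[m1 m2]; split.
    by apply: eq_measurable_fun m1 => y _; rewrite kE.
  by move=> y y01; rewrite kE // m2.
- move=> t tt; have t0 := pos t tt.
  have bk := bounded_ker x (ltW t0).
  have bkg := bounded01M bk bg; have bn := bounded01_norm bkg.
  have -> : \int[leb]_(y in `[0, 1]) `|k t y| = \int[leb]_(y in `[0, 1]) (t^-1 ^+ 2 * `|ker x t y * g y|).
    by apply: eq_Rintegral => y _; rewrite kE // normrM ger0_norm // sqr_ge0.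
  have -> : t `^ (- (1 + 1)) = t^-1 ^+ 2.
    by rewrite -(_ : 2%:R = 1 + 1 :> R) // powR_invn ?(ltW t0) // exprVn.
  rewrite (bounded01Z _ bn) // mulrC ler_wpM2r ?sqr_ge0 //.
  have bs := bounded01M (bounded01_cst (L * G)) (bounded01M bk bounded_sigma).
  apply: (le_trans (bounded01_le bn bs _ _ _)) => //.
    move=> y y01; rewrite normrM (ger0_norm (ker_ge0 _ _ (ltW t0))) mulrCA.
    by rewrite ler_wpM2l ?ker_ge0 ?(ltW t0) // dominated_by_sigma.
  rewrite (bounded01Z _ (bounded01M bk bounded_sigma)) // -/(slab sigma x t) mulrC.
  by rewrite ler_wpM2r ?mulr_ge0 ?(ltW L0) // slab_sigma_le2 // ltW.
- by apply: integrable_EFinZ => //; exact: integrable_powR_tail.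
have eS : {in `[1, +oo[, forall t, \int[leb]_(y in `[0, 1]) k t y = (t^-1) ^+ 2 * slab g x t}.
  move=> t tt; have t0 := pos t tt.
  rewrite /slab -(bounded01Z _ (bounded01M (bounded_ker x (ltW t0)) bg)) //.
  by apply: eq_Rintegral => y _; rewrite kE.
split.
  by apply: eq_integrable i1 => // t; rewrite inE /= => tt; rewrite eS.
transitivity (\int[leb]_(y in `[0, 1]) \int[leb]_(t in `[1, +oo[) k t y); last first.
  by rewrite i2; apply: eq_Rintegral => t; rewrite inE /= => tt; rewrite eS.
apply: eq_Rintegral => y; rewrite inE /= in_itv /= => y01.
rewrite optical_depthE // /E1 /k; symmetry; apply: Rintegral_ge0Zr => //.
- apply: measurable_funM => //; apply: measurableT_comp; first exact: measurable_expR.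
  by apply: measurableT_comp => //; exact: measurable_funM.
- by move=> t /pos t0; rewrite divr_ge0 ?expR_ge0 // ltW.
Qed.

End Fixed.
End Transport.

(** * Meshes and finite elements *)

Section Meshes.
Context {R : realType}.
Implicit Types (x y : R) (xs cs : seq R).

Section OnePartition.
Variable xs : seq R.
Hypothesis part : itv_partition 0 1 xs.

Lemma left_pt0 : left_pt xs 0 = 0. Proof. by []. Qed.

Lemma left_ptS j : left_pt xs j.+1 = right_pt xs j. Proof. by []. Qed.

Lemma left_pt_size : left_pt xs (size xs) = 1.
Proof. exact: itv_partition_nth_size part. Qed.

Lemma partition_size_gt0 : (0 < size xs)%N.
Proof.
rewrite lt0n; apply/negP => /eqP e; have := left_pt_size; rewrite e left_pt0 => /eqP.
by rewrite eq_sym oner_eq0.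
Qed.

Lemma left_pt_lt i j : (i < j <= size xs)%N -> left_pt xs i < left_pt xs j.
Proof.
move=> /andP[ij jM]; have [p _] := part.
apply: (@sorted_ltn_nth _ <%R lt_trans 0 (0 :: xs)) => //; rewrite inE /= ltnS //.
exact: leq_trans (ltnW ij) jM.
Qed.

Lemma left_pt_le i j : (i <= j <= size xs)%N -> left_pt xs i <= left_pt xs j.
Proof.
move=> /andP[]; rewrite leq_eqVlt => /predU1P[-> //|ij] jM.
by rewrite ltW // left_pt_lt // ij.
Qed.

Lemma left_pt_ltE i j : (i <= size xs)%N -> (j <= size xs)%N ->
  left_pt xs i < left_pt xs j -> (i < j)%N.
Proof.
move=> iM jM; apply: contraTT; rewrite -leqNgt -leNgt => ji.
by apply: left_pt_le; rewrite ji.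
Qed.

Lemma left_pt01 j : (j <= size xs)%N -> 0 <= left_pt xs j <= 1.
Proof.
move=> jM; apply/andP; split; first by rewrite -left_pt0 left_pt_le.
by rewrite -left_pt_size left_pt_le // jM leqnn.
Qed.

Lemma cell_length_gt0 j : (j < size xs)%N -> 0 < cell_length xs j.
Proof. by move=> jM; rewrite subr_gt0 (@left_pt_lt j j.+1) // ltnSn. Qed.

Lemma sum_cell_length : \sum_(j < size xs) cell_length xs j = 1.
Proof.
rewrite -(big_mkord xpredT (cell_length xs)).
by rewrite (telescope_sumr (left_pt xs)) // left_pt_size left_pt0 subr0.
Qed.

Lemma cell_length_le_diameter j : (j < size xs)%N -> cell_length xs j <= diameter xs.
Proof. by move=> jM; apply: (le_bigmax _ (fun j : 'I__ => cell_length xs j) (Ordinal jM)). Qed.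

Lemma diameter_gt0 : 0 < diameter xs.
Proof.
have M0 := partition_size_gt0.
exact: lt_le_trans (cell_length_gt0 M0) (cell_length_le_diameter M0).
Qed.

Lemma diameter_le1 : diameter xs <= 1.
Proof.
apply: bigmax_le => // i _.
have /andP[_ h1] := left_pt01 (ltn_ord i); have /andP[h2 _] := left_pt01 (ltnW (ltn_ord i)).
by rewrite /cell_length -left_ptS; lra.
Qed.

Lemma partition_locate x : 0 <= x < 1 ->
  exists2 j, (j < size xs)%N & left_pt xs j <= x < left_pt xs j.+1.
Proof.
move=> /andP[x0 x1].
have ex : exists j, x < left_pt xs j by exists (size xs); rewrite left_pt_size.
have hj := ex_minnP ex; case: hj => -[|j] xj minj.
  by rewrite left_pt0 ltNge x0 in xj.
exists j; last by rewrite xj andbT leNgt; apply/negP => /minj; rewrite ltnn.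
by apply: minj; rewrite left_pt_size.
Qed.

Lemma partition_locate_cc x : 0 <= x <= 1 ->
  exists2 j, (j < size xs)%N & left_pt xs j <= x <= left_pt xs j.+1.
Proof.
move=> /andP[x0]; rewrite le_eqVlt => /predU1P[->|x1].
  have M0 := partition_size_gt0; exists (size xs).-1; first by rewrite prednK.
  rewrite prednK // left_pt_size lexx andbT.
  by have /andP[] := left_pt01 (leq_pred (size xs)).
have [|j jM /andP[h1 /ltW h2]] := @partition_locate x; first by rewrite x0.
by exists j => //; rewrite h1.
Qed.

Lemma midpoint_cell j : (j < size xs)%N -> cell xs j (midpoint xs j).
Proof.
move=> jM; have := cell_length_gt0 jM; rewrite /cell /midpoint /cell_length /= in_itv /=.
by move=> h; apply/andP; split; lra.
Qed.

Lemma cell01 j x : (j < size xs)%N -> cell xs j x -> 0 <= x <= 1.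
Proof.
move=> jM; rewrite /cell /= in_itv /= => /andP[h1 h2].
have /andP[a1 _] := left_pt01 (ltnW jM); have /andP[_ b1] := left_pt01 jM.
by rewrite (le_trans a1 (ltW h1)) (le_trans (ltW h2) b1).
Qed.

End OnePartition.

Section Refinement.
Variables cs xs : seq R.
Hypotheses (pcs : itv_partition 0 1 cs) (pxs : itv_partition 0 1 xs)
  (sub : {subset cs <= xs}).

(** Every breakpoint is a mesh node, so none can lie inside a mesh cell. *)
Lemma cell_refines j : (j < size xs)%N -> exists2 l, (l < size cs)%N &
  left_pt cs l <= left_pt xs j /\ right_pt xs j <= right_pt cs l.
Proof.
move=> jM; have /andP[x0 _] := left_pt01 pxs (ltnW jM).
have x1 : left_pt xs j < 1 by rewrite -(left_pt_size pxs) left_pt_lt // jM leqnn.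
have [|l lJ /andP[h1 h2]] := partition_locate pcs (_ : 0 <= left_pt xs j < 1); first by rewrite x0.
exists l => //; split => //.
have /sub/(nthP 0)[i iM e] : left_pt cs l.+1 \in cs by exact: mem_nth.
rewrite -!left_ptS -e; rewrite -e in h2.
have ji : (j < i.+1)%N by apply: (left_pt_ltE pxs (ltnW jM) iM).
by apply: (@left_pt_le _ pxs j.+1 i.+1); rewrite ji.
Qed.

Lemma adjacent_cells_refine j : (j.+1 < size xs)%N -> right_pt xs j \notin cs ->
  exists2 l, (l < size cs)%N & left_pt cs l <= left_pt xs j /\ right_pt xs j.+1 <= right_pt cs l.
Proof.
move=> jM nj; have [l lJ [h1 h2]] := cell_refines (ltnW jM); exists l => //; split => //.
have mem : right_pt cs l \in cs by exact: mem_nth.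
have lt : right_pt xs j < right_pt cs l.
  by rewrite lt_neqAle h2 andbT; apply: contra nj => /eqP ->.
have /sub/(nthP 0)[i iM e] := mem.
rewrite -e; rewrite -e in lt.
have ji : (j.+1 < i.+1)%N by apply: (left_pt_ltE pxs (ltnW jM) iM).
by rewrite -left_ptS; apply: (@left_pt_le _ pxs j.+2 i.+1); rewrite ji.
Qed.

Lemma sum_breakpoints : (\sum_(j < (size xs).-1) (right_pt xs j \in cs) <= size cs)%N.
Proof.
have ux : uniq xs.
  have [p _] := pxs; have s : sorted <%R xs by exact: path_sorted p.
  by rewrite (lt_sorted_uniq s).
apply: (@leq_trans (\sum_(j < size xs) (right_pt xs j \in cs))).
  have := partition_size_gt0 pxs; case: (size xs) => [//|M] _ /=.
  by rewrite big_ord_recr /= leq_addr.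
rewrite -(big_mkord xpredT (fun j => (xs`_j \in cs : nat))) -(big_nth 0 xpredT (fun x => (x \in cs : nat))).
rewrite -big_mkcond /= sum1_count -size_filter.
by apply: uniq_leq_size; rewrite ?filter_uniq // => x; rewrite mem_filter => /andP[].
Qed.

End Refinement.
End Meshes.

(** * Piecewise linear functions and the nodal form of the scheme *)

Section FiniteElements.
Context {R : realType}.
Local Notation leb := (@lebesgue_measure R).
Variable xs : seq R.
Hypothesis part : itv_partition 0 1 xs.
Implicit Types (v u sigma gam : R -> R) (U : nat -> R).

Local Notation node := (left_pt xs).

(** [Vh] makes v affine on the open cell only; the two nodal values are recovered as one-sided
    limits. *)
Lemma Vh_interp v j x : Vh xs v -> (j < size xs)%N -> node j <= x <= node j.+1 ->
  v x = v (node j) + (x - node j) / cell_length xs j * (v (node j.+1) - v (node j)).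
Proof.
move=> [cv av] jM; have h0 := cell_length_gt0 part jM; have [a [b vE]] := av j jM.
have lt : node j < node j.+1 by rewrite left_pt_lt // ltnSn.
have cv' : {within `[node j, node j.+1], continuous v}.
  apply: continuous_subspaceW cv => z /=; rewrite !in_itv /= => /andP[z1 z2].
  have /andP[a1 _] := left_pt01 part (ltnW jM); have /andP[_ b1] := left_pt01 part jM.
  by rewrite (le_trans a1 z1) (le_trans z2 b1).
have [_ cl cr] := (continuous_within_itvP v lt).1 cv'.
have aff z (F : set_system R) : ProperFilter F -> F --> z -> v x @[x --> F] --> v z ->
    (\forall x \near F, cell xs j x) -> v z = a + b * z.
  move=> PF Fz vz near; apply/esym; apply: (@cvg_unique _ _ (v x @[x --> F])) => //.
  have : a + b * x @[x --> F] --> a + b * z.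
    by apply: cvgD; [exact: cvg_cst|apply: cvgM; [exact: cvg_cst|exact: Fz]].
  apply: cvg_trans; apply: near_eq_cvg.
  by apply: filterS near => y yj; rewrite /= vE.
have ea : v (node j) = a + b * node j.
  apply: (aff _ _ _ _ cl); first exact: cvg_within.
  near=> z; rewrite /cell /= in_itv /=; apply/andP; split; first by near: z; exact: nbhs_right_gt.
  by near: z; exact: nbhs_right_lt.
have eb : v (node j.+1) = a + b * node j.+1.
  apply: (aff _ _ _ _ cr); first exact: cvg_within.
  near=> z; rewrite /cell /= in_itv /=; apply/andP; split; last by near: z; exact: nbhs_left_lt.
  by near: z; exact: nbhs_left_gt.
have fin : forall z, z = node j \/ z = node j.+1 \/ cell xs j z -> v z = a + b * z.
  by move=> z [->|[->|/vE]].
move=> /andP[x1 x2]; rewrite fin; last first.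
  move: x1 x2; rewrite !le_eqVlt => /predU1P[->|x1]; first by left.
  move=> /predU1P[->|x2]; first by right; left.
  by right; right; rewrite /cell /= in_itv /= x1 x2.
by rewrite ea eb /cell_length -left_ptS; field; rewrite subr_eq0 gt_eqF.
Unshelve. all: by end_near. Qed.

Lemma Vh_midpoint v j : Vh xs v -> (j < size xs)%N ->
  v (midpoint xs j) = (v (node j) + v (node j.+1)) / 2.
Proof.
move=> vh jM; have h0 := cell_length_gt0 part jM.
rewrite (Vh_interp vh jM); last first.
  by have := midpoint_cell part jM; rewrite /cell /= in_itv /= => /andP[/ltW -> /ltW ->].
have -> : (midpoint xs j - node j) / cell_length xs j = 2^-1.
  rewrite /midpoint /cell_length; move: h0; rewrite /cell_length => h0.
  by field; rewrite gt_eqF.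
by field.
Qed.

Lemma Ph_cell gam j x : (j < size xs)%N -> cell xs j x -> Ph xs gam x = gam (midpoint xs j).
Proof.
move=> jM xj; rewrite /Ph (bigD1 (Ordinal jM)) //= indicE mem_set // mulr1 big1 ?addr0 //.
move=> i ij; rewrite indicE memNset ?mulr0 // => xi; move: ij; rewrite -val_eqE /=.
move: xi xj; rewrite /cell /= !in_itv /= -!left_ptS => /andP[i1 i2] /andP[j1 j2].
case: ltngtP => // ij _.
- have : node i.+1 <= node j by apply: left_pt_le => //; rewrite ij ltnW.
  by rewrite leNgt (lt_trans j1 i2).
- have : node j.+1 <= node i by apply: left_pt_le => //; rewrite ij ltnW.
  by rewrite leNgt (lt_trans i1 j2).
Qed.

Lemma Rintegral_cell_cst c j : (j < size xs)%N -> \int[leb]_(x in cell xs j) c = c * cell_length xs j.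
Proof.
move=> jM; have lt : node j < node j.+1 by rewrite left_pt_lt // ltnSn.
rewrite Rintegral_cst; last exact: measurable_itv.
congr (_ * _); transitivity (fine (lebesgue_measure (cell xs j) : \bar R)); first by [].
by rewrite /cell lebesgue_measure_itv /= lte_fin lt.
Qed.

Lemma Rintegral_cell_affine a b j : (j < size xs)%N ->
  \int[leb]_(x in cell xs j) (a + b * x) = (a + b * midpoint xs j) * cell_length xs j.
Proof.
move=> jM; have lt : node j < node j.+1 by rewrite left_pt_lt // ltnSn.
have caff : continuous (fun x : R => a + b * x).
  by move=> x; apply: cvgD; [exact: cvg_cst|apply: cvgM; [exact: cvg_cst|exact: cvg_id]].
have ii := @continuous_integrable R _ (node j) (node j.+1) (fun x _ => caff x).
transitivity (\int[leb]_(x in `[node j, node j.+1]) (a + b * x)).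
  rewrite /cell -left_ptS -Rintegral_itv_bndo_bndc; last first.
    by apply: integrableS ii => // x /=; rewrite !in_itv /= => /andP[-> /ltW ->].
  rewrite Rintegral_itv_obnd_cbnd //.
  by apply: integrableS ii => // x /=; rewrite !in_itv /= => /andP[/ltW -> /ltW ->].
pose F x := a * x + b / 2 * x ^+ 2.
transitivity (F (node j.+1) - F (node j)); last first.
  by rewrite /F /midpoint /cell_length -left_ptS; field.
apply: FTC_C1 => [|x _|x _]; [exact: ltW| |exact: caff].
apply: is_derive_eq; rewrite /GRing.scale /=.
by field.
Qed.

Lemma derive1_affine_cell v a b j x : (forall x, cell xs j x -> v x = a + b * x) ->
  cell xs j x -> derive1 v x = b.
Proof.
move=> vE xj; rewrite derive1E (@near_eq_derive _ _ _ v (fun x => a + b * x)).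
- have d : is_derive x 1 (fun x : R => a + b * x) b.
    by apply: is_derive_eq; rewrite /GRing.scale /=; ring.
  by rewrite derive_val.
- near=> z; apply: vE; near: z; exact: open_nbhs_nbhs.
Unshelve. all: by end_near. Qed.

(** On a cell the integrand is affine, so the midpoint rule is exact and turns the integral
    equations into the diamond-difference relations. *)
Lemma is_Sh_nodal sigma m gam u : is_Sh xs sigma m (Ph xs gam) u <->
  [/\ Vh xs u, forall j, (j < size xs)%N ->
     m * (u (node j.+1) - u (node j)) +
     cell_length xs j * sigma (midpoint xs j) * ((u (node j) + u (node j.+1)) / 2) =
     cell_length xs j * gam (midpoint xs j), 0 < m -> u 0 = 0 & m < 0 -> u 1 = 0].
Proof.
have lhs j : Vh xs u -> (j < size xs)%N ->
    \int[leb]_(x in cell xs j) (m * derive1 u x + Ph xs sigma x * u x) =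
    m * (u (node j.+1) - u (node j)) +
     cell_length xs j * sigma (midpoint xs j) * ((u (node j) + u (node j.+1)) / 2).
  move=> vu jM; have h0 := cell_length_gt0 part jM.
  pose b := (u (node j.+1) - u (node j)) / cell_length xs j.
  pose a := u (node j) - node j * b.
  have uE x : cell xs j x -> u x = a + b * x.
    rewrite /cell /= in_itv /= => /andP[x1 x2]; rewrite (Vh_interp vu jM) ?(ltW x1) ?(ltW x2) //.
    by rewrite /a /b; field; rewrite gt_eqF.
  transitivity (\int[leb]_(x in cell xs j)
      ((m * b + sigma (midpoint xs j) * a) + (sigma (midpoint xs j) * b) * x)).
    apply: eq_Rintegral => x; rewrite inE => xj.
    by rewrite (derive1_affine_cell uE xj) (Ph_cell _ jM xj) (uE _ xj); ring.
  rewrite Rintegral_cell_affine // -(Vh_midpoint vu jM) (uE _ (midpoint_cell part jM)).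
  have -> : u (node j.+1) - u (node j) = b * cell_length xs j by rewrite /b divfK // gt_eqF.
  by ring.
have rhs j : (j < size xs)%N -> \int[leb]_(x in cell xs j) Ph xs gam x =
    cell_length xs j * gam (midpoint xs j).
  move=> jM; rewrite mulrC -Rintegral_cell_cst //; apply: eq_Rintegral => x; rewrite inE => xj.
  by rewrite (Ph_cell _ jM xj).
split=> -[vu eqs u0 u1]; split => // j jM; first by rewrite -lhs // eqs // rhs.
by rewrite lhs // eqs // rhs.
Qed.

(** The piecewise linear interpolant written as a sum of clipped ramps, one per cell, which makes
    its continuity immediate. *)
Definition pl U x : R := U 0%N + \sum_(j < size xs)
  (U j.+1 - U j) / cell_length xs j * Num.min (Num.max (x - node j) 0) (cell_length xs j).

Lemma pl_cell U j x : (j < size xs)%N -> node j <= x <= node j.+1 ->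
  pl U x = U j + (x - node j) / cell_length xs j * (U j.+1 - U j).
Proof.
move=> jM /andP[x1 x2].
pose c (i : nat) := Num.min (Num.max (x - node i) 0) (cell_length xs i).
have c1 i : (i < j)%N -> c i = cell_length xs i.
  move=> ij; have iM := ltn_trans ij jM; have hi := cell_length_gt0 part iM.
  have le : node i.+1 <= node j by apply: left_pt_le => //; rewrite ij ltnW.
  have h : cell_length xs i <= x - node i by rewrite /cell_length -left_ptS; lra.
  by rewrite /c max_l ?min_r //; lra.
have c2 : c j = x - node j.
  by rewrite /c max_l ?subr_ge0 // min_l // /cell_length -left_ptS; lra.
have c3 i : (j < i < size xs)%N -> c i = 0.
  move=> /andP[ji iM]; have hi := cell_length_gt0 part iM.
  have le : node j.+1 <= node i by apply: left_pt_le => //; rewrite ji ltnW.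
  by rewrite /c max_r ?subr_le0 ?(le_trans x2) // min_l // ltW.
rewrite /pl -(big_mkord xpredT (fun i => (U i.+1 - U i) / cell_length xs i * c i)).
rewrite (big_cat_nat (leq0n j) (ltnW jM)) /= (big_ltn jM) c2.
have -> : \sum_(j.+1 <= i < size xs) (U i.+1 - U i) / cell_length xs i * c i = 0.
  by rewrite big_nat big1 // => i ij; rewrite c3 ?mulr0.
rewrite (eq_big_nat _ _ (F2 := fun i => U i.+1 - U i)); last first.
  move=> i /andP[_ ij]; rewrite c1 // divfK // gt_eqF // (cell_length_gt0 part) //.
  exact: ltn_trans ij jM.
by rewrite (telescope_sumr U) //; field; rewrite gt_eqF // (cell_length_gt0 part).
Qed.

Lemma pl_node U j : (j <= size xs)%N -> pl U (node j) = U j.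
Proof.
case: j => [|j] jM.
  have M0 := partition_size_gt0 part; rewrite (pl_cell _ M0) ?subrr ?mul0r ?addr0 //.
  by rewrite lexx left_pt_le.
have h0 := cell_length_gt0 part jM.
rewrite (pl_cell _ jM); last by rewrite lexx andbT left_pt_le // leqnSn.
by rewrite left_ptS divff ?gt_eqF // mul1r addrC subrK.
Qed.

Lemma pl_Vh U : Vh xs (pl U).
Proof.
split.
  apply: continuous_subspaceT => x; apply: cvgD; first exact: cvg_cst.
  apply: cvg_big => [|i _]; first exact: add_continuous.
  apply: cvgM; first exact: cvg_cst.
  have c1 : {for x, continuous (fun y : R => y - node i)}.
    by apply: cvgB; [exact: cvg_id|exact: cvg_cst].
  have c0 (c : R) : {for x, continuous (fun _ : R => c)} by exact: cvg_cst.
  exact: continuous_min (continuous_max c1 (c0 0)) (c0 _).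
move=> j jM; exists (U j - node j / cell_length xs j * (U j.+1 - U j)).
exists ((U j.+1 - U j) / cell_length xs j) => x; rewrite /cell /= in_itv /= => /andP[x1 x2].
rewrite (pl_cell _ jM) ?(ltW x1) ?(ltW x2) //.
have h0 := cell_length_gt0 part jM; by field; rewrite gt_eqF.
Qed.

Lemma Vh_eq v v' : Vh xs v -> Vh xs v' ->
  (forall j, (j <= size xs)%N -> v (node j) = v' (node j)) ->
  forall x, 0 <= x <= 1 -> v x = v' x.
Proof.
move=> vh vh' e x x01; have [j jM xj] := partition_locate_cc part x01.
by rewrite (Vh_interp vh jM xj) (Vh_interp vh' jM xj) !e // ltnW.
Qed.

Lemma is_Sh_dsweep sigma m gam u (b : bool) : 0 < m ->
  is_Sh xs sigma (if b then m else - m) (Ph xs gam) u <->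
  Vh xs u /\ dsweep (size xs) m (cell_length xs) (fun j => sigma (midpoint xs j))
    (fun j => gam (midpoint xs j)) b (fun j => u (node j)).
Proof.
move=> m0; rewrite is_Sh_nodal; case: b; split.
- by move=> [vu eqs u0 _]; split => //; split => [|j jM]; [exact: u0|exact: eqs].
- by move=> [vu [u0 eqs]]; split => //; rewrite ltNge (ltW m0).
- move=> [vu eqs _ u1]; split => //; apply: dsweep_false => //.
  by rewrite left_pt_size // u1 // oppr_lt0.
- move=> [vu /dsweep_falseE[u1 eqs]]; split => //.
    by rewrite oppr_gt0 ltNge (ltW m0).
  by rewrite -(left_pt_size part).
Qed.

End FiniteElements.

(** * Well-posedness and stability of the discrete problem *)

Section DiscreteSolution.
Context {R : realType}.
Variables (xs : seq R) (N : nat) (mu w : nat -> nat -> R) (sigma sigmaS : R -> R) (kappa L : R).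
Hypotheses (part : itv_partition 0 1 xs)
  (mu0 : forall k, (k < N)%N -> 0 < mu N k) (w0 : forall k, (k < N)%N -> 0 <= w N k)
  (w1 : \sum_(k < N) w N k = 1) (k01 : 0 < kappa < 1)
  (sL : forall j, (j < size xs)%N -> 0 < sigma (midpoint xs j) <= L)
  (sSk : forall j, (j < size xs)%N ->
     `|sigmaS (midpoint xs j)| <= kappa * sigma (midpoint xs j)).

Local Notation node := (left_pt xs).
Local Notation M := (size xs).
Local Notation h := (cell_length xs).
Local Notation s := (fun j => sigma (midpoint xs j)).
Local Notation Kh := (discrete_Kh M N h s (mu N) (w N)).
Local Notation Ksol := (Kh_sol M N h s (mu N) (w N)).

Let h0 j : (j < M)%N -> 0 < h j. Proof. exact: cell_length_gt0. Qed.
Let s0 j : (j < M)%N -> 0 < s j. Proof. by move=> /sL/andP[]. Qed.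

Lemma discrete_solution_nodal f v : discrete_solution mu w xs N sigma sigmaS f v ->
  Kh (fun j => (sigmaS \* v \+ f) (midpoint xs j)) (fun j => v (node j)).
Proof.
move=> [vh [u [hu vE]]]; exists (fun b k j => u b k (node j)); split.
  move=> k b kN; have m0 := mu0 kN; have [h1 h2] := hu k kN.
  have := (is_Sh_dsweep part sigma (sigmaS \* v \+ f) (u b k) b m0).1.
  by case: b => /= hb; apply hb.
by move=> i iM; apply: vE; rewrite in_itv /=; exact: left_pt01.
Qed.

Lemma discrete_solution_fixpoint f v : discrete_solution mu w xs N sigma sigmaS f v ->
  forall i, (i <= M)%N -> v (node i) =
    Ksol (fun j => sigmaS (midpoint xs j) * ((v (node j) + v (node j.+1)) / 2) + f (midpoint xs j)) i.
Proof.
move=> dv; have [vh _] := dv; have hK := discrete_solution_nodal dv.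
move=> i iM; rewrite (Kh_sol_unique h0 s0 mu0 hK iM).
by apply: (Kh_sol_ext (w N) h0 s0 mu0) => // j jM /=; rewrite (Vh_midpoint part vh jM).
Qed.

Lemma discrete_solution_unique f v v' : discrete_solution mu w xs N sigma sigmaS f v ->
  discrete_solution mu w xs N sigma sigmaS f v' -> forall x, x \in `[0, 1] -> v' x = v x.
Proof.
move=> dv dv' x; rewrite in_itv /= => x01.
have [vh _] := dv; have [vh' _] := dv'; apply: (Vh_eq part) => //.
exact: (discrete_fixpoint_unique h0 s0 mu0 w0 w1 k01 sSk
  (discrete_solution_fixpoint dv') (discrete_solution_fixpoint dv)).
Qed.

Lemma discrete_solution_exists f : exists v, discrete_solution mu w xs N sigma sigmaS f v.
Proof.
have [W hW] := discrete_fixpoint_exists h0 s0 mu0 w0 w1 (fun j => f (midpoint xs j)) k01 sSk.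
pose g j := sigmaS (midpoint xs j) * ((W j + W j.+1) / 2) + f (midpoint xs j).
pose U b k := dsweep_sol M h s (mu N k) g b.
exists (pl xs W); split; first exact: pl_Vh.
exists (fun b k => pl xs (U b k)); split=> [k kN|x]; last first.
  (* [is_Kh] asks for the identity at every x; it extends from the nodes because both sides are
     affine on a cell. *)
  rewrite in_itv /= => x01; have [j jM xj] := partition_locate_cc part x01.
  rewrite (pl_cell part W jM xj); set th := (x - node j) / h j.
  rewrite (eq_bigr (fun k : 'I_N => (1 - th) * (w N k * (U true k j + U false k j)) +
     th * (w N k * (U true k j.+1 + U false k j.+1)))); last first.
    by move=> k _; rewrite !(pl_cell part _ jM xj) -/th; ring.
  rewrite big_split /= -!mulr_sumr !hW ?(ltnW jM) // /Ksol -/g -/(U _ _).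
  by rewrite -/(Kh_sol _ _ _ _ _ _); ring.
have gE j : (j < M)%N -> (sigmaS \* pl xs W \+ f) (midpoint xs j) = g j.
  by move=> jM /=; rewrite (Vh_midpoint part (pl_Vh part W) jM) !pl_node // ltnW.
have key b : is_Sh xs sigma (if b then mu N k else - mu N k) (Ph xs (sigmaS \* pl xs W \+ f)) (pl xs (U b k)).
  apply/(is_Sh_dsweep part) => //; first exact: mu0.
  split; first exact: pl_Vh.
  have := @dsweep_solP R M h s h0 s0 (mu N k) g b (mu0 kN).
  case: b => [[u0 hu]|/dsweep_falseE[u1 hu]].
    split=> [|j jM]; rewrite !pl_node ?(ltnW jM) //.
    by rewrite gE // hu.
  apply: dsweep_false => [|j jM]; rewrite !pl_node ?(ltnW jM) //.
  by rewrite gE // hu.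
by split; [exact: (key true)|exact: (key false)].
Qed.

(** [V] is the discrete operator applied to the exact source. The midpoint error phi - v solves the
    discrete equation with the consistency error as residual, so the contraction bounds it in l2.
    One more application of the operator, through [discrete_Kh_sup], bounds V - v at the nodes. *)
Lemma discrete_solution_stable f v phi (r0 Cq : R) i : 0 <= r0 -> 1 <= L ->
  discrete_solution mu w xs N sigma sigmaS f v -> (i <= M)%N ->
  \sum_(k < N) w N k * mu N k `^ (- 2^-1) <= Cq ->
  let V := Ksol (fun j => sigmaS (midpoint xs j) * phi (midpoint xs j) + f (midpoint xs j)) in
  (forall j, (j < M)%N -> `|phi (midpoint xs j) - (V j + V j.+1) / 2| <= r0) ->
  `|V i - v (node i)| <= Cq * (L * r0 / (1 - kappa)).
Proof.
move=> r00 L1 dv iM hC V hr; have [vh _] := dv; have /andP[k0 k1] := k01.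
have k1' : 0 < 1 - kappa by rewrite subr_gt0.
pose W j := v (node j); pose d j := phi (midpoint xs j) - v (midpoint xs j).
pose g j := sigmaS (midpoint xs j) * d j; pose D := Ksol g.
have DE j : (j <= M)%N -> V j - W j = D j.
  move=> jM; rewrite /W (discrete_solution_fixpoint dv jM); apply/eqP; rewrite subr_eq addrC; apply/eqP.
  rewrite /D -Kh_solD; apply: (Kh_sol_ext (w N) h0 s0 mu0) => // l lM.
  by rewrite /g /d (Vh_midpoint part vh lM); ring.
have KD : Kh g D by exact: Kh_solP.
pose r j := d j - (D j + D j.+1) / 2.
have rE j : (j < M)%N -> r j = phi (midpoint xs j) - (V j + V j.+1) / 2.
  move=> jM; rewrite /r /d -!DE ?(ltnW jM) // (Vh_midpoint part vh jM) /W; by field.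
have gd j : (j < M)%N -> `|g j| <= kappa * s j * `|d j|.
  by move=> jM; rewrite normrM ler_wpM2r ?sSk.
have h1 : (1 - kappa) ^+ 2 * \sum_(j < M) h j * s j * d j ^+ 2 <= \sum_(j < M) h j * s j * r j ^+ 2.
  apply: (discrete_Kh_contraction h0 s0 mu0 w0 w1 k01 KD gd) => j jM.
  by rewrite /r; ring.
have h2 : \sum_(j < M) h j * s j * r j ^+ 2 <= L * r0 ^+ 2.
  rewrite -[leRHS]mul1r -(sum_cell_length part) mulr_suml; apply: ler_sum => j _.
  have jM := ltn_ord j; have /andP[_ sl] := sL jM.
  rewrite -mulrA ler_wpM2l ?(ltW (h0 jM)) //; apply: ler_pM => //; rewrite ?sqr_ge0 ?(ltW (s0 jM)) //.
  by rewrite rE // -(real_normK (num_real (_ - _))) ler_sqr ?nnegrE // hr.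
have h3 : \sum_(j < M) h j * g j ^+ 2 / s j <= \sum_(j < M) h j * s j * d j ^+ 2.
  apply: ler_sum => j _; have jM := ltn_ord j; have sj := s0 jM; have hj := h0 jM.
  have -> : h j * s j * d j ^+ 2 = h j * (s j * d j) ^+ 2 / s j by field; rewrite gt_eqF.
  rewrite ler_pM2r ?invr_gt0 // ler_pM2l // -(real_normK (num_real (g j))) -(real_normK (num_real (_ * d j))).
  have h4 : `|g j| <= s j * `|d j|.
    by apply: (le_trans (gd j jM)); rewrite ler_wpM2r // ler_piMl // ltW.
  by rewrite ler_sqr ?nnegrE // [leRHS]normrM (ger0_norm (ltW sj)).
have h5 : Num.sqrt (\sum_(j < M) h j * g j ^+ 2 / s j) <= L * r0 / (1 - kappa).
  have p : 0 <= L * r0 / (1 - kappa) by rewrite divr_ge0 ?mulr_ge0 // ?(ltW k1'); lra.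
  rewrite -[leRHS]ger0_norm // -sqrtr_sqr ler_sqrt ?sqr_ge0 //.
  apply: (le_trans h3); rewrite expr_div_n ler_pdivlMr ?exprn_gt0 // mulrC.
  apply: (le_trans h1); apply: (le_trans h2); rewrite exprMn ler_wpM2r ?sqr_ge0 //.
  by rewrite expr2 ler_peMr //; lra.
rewrite -/(W i) DE //; apply: (le_trans (discrete_Kh_sup h0 s0 mu0 w0 KD iM)).
apply: ler_pM => //; rewrite ?sqrtr_ge0 //.
by apply: sumr_ge0 => k _; rewrite mulr_ge0 ?powR_ge0 ?w0.
Qed.

End DiscreteSolution.

(** * The pathwise error estimate *)

Section PiecewiseHolder.
Context {R : realType}.
Implicit Types (B x y eta : R) (g : R -> R) (cs : seq R).

Lemma inf01_le g x : 0 < inf01 g -> 0 <= x <= 1 -> inf01 g <= g x.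
Proof.
move=> g0 x01; apply: ge_inf; last by exists x => //; rewrite /= in_itv.
apply: contrapT => nb; move: g0; rewrite /inf01 inf_out ?ltxx // => -[_ b].
exact: nb b.
Qed.

Lemma holder_normP eta a b g B : a < b -> (holder_norm eta `]a, b[ g <= B%:E)%E ->
  (forall x, a < x < b -> `|g x| <= B) /\
  (forall x y, a < x < b -> a < y < b -> `|g x - g y| <= B * `|x - y| `^ eta).
Proof.
move=> ab; rewrite /holder_norm.
set E1 := [set _ | x in `]a, b[]; set E2 := [set _ | z in _].
have in1 x : a < x < b -> (`|g x|%:E <= ereal_sup E1)%E.
  by move=> xab; apply: ereal_sup_ubound; exists x => //; rewrite /= in_itv.
have in2 x y : a < x < b -> a < y < b -> x != y ->
    ((`|g x - g y| / `|x - y| `^ eta)%:E <= ereal_sup E2)%E.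
  move=> xab yab xy; apply: ereal_sup_ubound; by exists (x, y).
have m1 : a < (a + b) / 2 < b by apply/andP; split; lra.
have m2 : a < (a + (a + b) / 2) / 2 < b by apply/andP; split; lra.
have p1 : (0 <= ereal_sup E1)%E by apply: le_trans (in1 _ m1); rewrite lee_fin.
have p2 : (0 <= ereal_sup E2)%E.
  apply: le_trans (in2 _ _ m1 m2 _); last by apply/eqP; lra.
  by rewrite lee_fin divr_ge0 ?powR_ge0.
move=> hB; split=> [x xab|x y xab yab].
  by rewrite -lee_fin (le_trans (in1 x xab)) // (le_trans _ hB) // leeDl.
have [->|xy] := eqVneq x y.
  rewrite !subrr normr0 mulr_ge0 ?powR_ge0 // -lee_fin (le_trans _ hB) // adde_ge0 //.
rewrite -ler_pdivrMr ?powR_gt0 ?normr_gt0 ?subr_eq0 //.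
by rewrite -lee_fin (le_trans (in2 x y xab yab xy)) // (le_trans _ hB) // leeDr.
Qed.

Lemma cell_holder eta cs g B l x y : itv_partition 0 1 cs -> (pw_norm eta cs g <= B%:E)%E ->
  (l < size cs)%N -> cell cs l x -> cell cs l y -> `|g x - g y| <= B * `|x - y| `^ eta.
Proof.
move=> part gB lJ; rewrite /cell /= !in_itv /= => xl yl.
have lt : left_pt cs l < right_pt cs l by rewrite -left_ptS left_pt_lt // ltnSn.
apply: (holder_normP lt _).2 => //; apply: le_trans gB.
exact: (le_bigmax _ (fun j : 'I__ => holder_norm eta (cell cs j) g) (Ordinal lJ)).
Qed.

Lemma cell_bounded eta cs g B l x : itv_partition 0 1 cs -> (pw_norm eta cs g <= B%:E)%E ->
  (l < size cs)%N -> cell cs l x -> `|g x| <= B.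
Proof.
move=> part gB lJ; rewrite /cell /= !in_itv /= => xl.
have lt : left_pt cs l < right_pt cs l by rewrite -left_ptS left_pt_lt // ltnSn.
apply: (holder_normP lt _).1 => //; apply: le_trans gB.
exact: (le_bigmax _ (fun j : 'I__ => holder_norm eta (cell cs j) g) (Ordinal lJ)).
Qed.

(** The norm sees only the open cells; the bound reaches the breakpoints through the one-sided
    limits that define the values there. *)
Lemma Cpw_bounded eta cs g B x : itv_partition 0 1 cs -> Cpw eta cs g ->
  (pw_norm eta cs g <= B%:E)%E -> 0 <= x <= 1 -> `|g x| <= B.
Proof.
move=> part [_ gl g1] gB x01.
have lim (F : set_system R) y : ProperFilter F -> g z @[z --> F] --> g y ->
    (\forall z \near F, `|g z| <= B) -> `|g y| <= B.
  move=> PF /cvg_norm gy near; rewrite -(cvg_lim _ gy) //; apply: limr_le => //.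
  by apply: cvgP gy.
have [x1|x1] := eqVneq x 1.
  rewrite x1; apply: lim g1 _; have J0 := partition_size_gt0 part.
  have lJ : ((size cs).-1 < size cs)%N by rewrite prednK.
  near=> z; apply: (cell_bounded part gB lJ); rewrite /cell /= in_itv /=.
  have -> : right_pt cs (size cs).-1 = 1 by rewrite -left_ptS prednK // left_pt_size.
  apply/andP; split; last by near: z; exact: nbhs_left_lt.
  near: z; apply: nbhs_left_gt; rewrite -(left_pt_size part) left_pt_lt //.
  by rewrite prednK ?leqnn.
have [|l lJ /andP[lx xr]] := partition_locate part (_ : 0 <= x < 1).
  by have /andP[-> h] := x01; rewrite lt_neqAle x1.
have [xl|xl] := eqVneq x (left_pt cs l).
  rewrite xl; apply: lim (gl l lJ) _.
  near=> z; apply: (cell_bounded part gB lJ); rewrite /cell /= in_itv /=.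
  apply/andP; split; first by near: z; exact: nbhs_right_gt.
  by near: z; apply: nbhs_right_lt; rewrite -left_ptS left_pt_lt // ltnSn.
apply: (cell_bounded part gB lJ); rewrite /cell /= in_itv /= xr andbT.
by rewrite lt_neqAle eq_sym xl.
Unshelve. all: by end_near. Qed.

Lemma cell_continuous eta cs g l x : 0 < eta -> itv_partition 0 1 cs ->
  (pw_norm eta cs g < +oo)%E -> (l < size cs)%N -> cell cs l x -> {for x, continuous g}.
Proof.
move=> eta0 part gfin lJ xl; set B := fine (pw_norm eta cs g).
have pw0 : (0 <= pw_norm eta cs g)%E by rewrite /pw_norm; exact: bigmax_ge_id.
have gB : (pw_norm eta cs g <= B%:E)%E by rewrite fineK // ge0_fin_numE.
have B0 : 0 <= B by exact: fine_ge0.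
apply/cvgrPdist_lt => e e0; pose d := (e / (B + 1)) `^ eta^-1.
have d0 : 0 < d by rewrite powR_gt0 // divr_gt0 //; lra.
have nb : \forall y \near x, cell cs l y.
  by apply: open_nbhs_nbhs; split => //; exact: interval_open.
near=> y; have yl : cell cs l y.
  by near: y.
apply: (le_lt_trans (cell_holder part gB lJ xl yl)).
have xy : `|x - y| < d by near: y; exact: cvgr_dist_lt.
have h : `|x - y| `^ eta <= e / (B + 1).
  have -> : e / (B + 1) = d `^ eta.
    by rewrite /d -powRrM mulVf ?gt_eqF // powRr1 // divr_ge0 ?(ltW e0) //; lra.
  by rewrite ge0_ler_powR ?nnegrE ?powR_ge0 ?(ltW eta0) ?(ltW xy).
apply: (@le_lt_trans _ _ (B * (e / (B + 1)))); first exact: ler_wpM2l.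
by rewrite mulrA ltr_pdivrMr; last lra; nra.
Unshelve. all: by end_near. Qed.

Lemma Cpw_measurable eta cs g : 0 < eta -> itv_partition 0 1 cs -> Cpw eta cs g ->
  measurable_fun `[(0 : R), 1] g.
Proof.
move=> eta0 part [gfin _ _].
(* A countable cover: the first indices give the open cells, and size cs + j gives the breakpoint
   j. *)
pose A i := if (i < size cs)%N then cell cs i else [set left_pt cs (i - size cs)].
have mA i : measurable (A i) by rewrite /A; case: ifP => _; [exact: measurable_itv|exact: measurable_set1].
have mU : measurable_fun (\bigcup_i A i) g.
  apply/measurable_fun_bigcup => // i; rewrite /A; case: ifP => [iJ|_]; last exact: measurable_fun_set1.
  apply: open_continuous_measurable_fun; first exact: interval_open.
  by move=> x; rewrite inE => xi; exact: (cell_continuous eta0 part gfin iJ xi).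
apply: measurable_funS mU => //; first exact: bigcupT_measurable.
move=> x; rewrite /= in_itv /= => x01; have [j jJ /andP[h1 h2]] := partition_locate_cc part x01.
have [e|n1] := eqVneq x (left_pt cs j).
  by exists (size cs + j)%N => //; rewrite /A ltnNge leq_addr /= addKn.
have [e|n2] := eqVneq x (left_pt cs j.+1).
  by exists (size cs + j.+1)%N => //; rewrite /A ltnNge leq_addr /= addKn.
exists j => //; rewrite /A jJ /cell /= in_itv /= -left_ptS.
by rewrite !lt_neqAle h1 h2 n2 eq_sym n1.
Qed.

End PiecewiseHolder.

Section DirectedSweepError.
Context {R : realType}.
Variables (M n : nat) (m L G rho H eta sig : R) (h s g u psi er sr : nat -> R) (jump : nat -> bool).
Hypotheses (L1 : 1 <= L) (rho1 : 1 <= rho) (H01 : 0 < H <= 1) (m01 : 0 < m <= 1)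
  (eta01 : 0 < eta < 1) (sig_eta : eta <= sig) (sig_half : 2^-1 <= sig) (G0 : 0 <= G)
  (hH : forall j, (j < M)%N -> 0 < h j <= H /\ H <= rho * h j)
  (h1 : \sum_(j < M) h j = 1)
  (sL : forall j, (j < M)%N -> L^-1 <= s j <= L)
  (gG : forall j, (j < M)%N -> `|g j| <= G)
  (s_holder : forall j, (j.+1 < M)%N -> ~~ jump j -> `|s j.+1 - s j| <= L * H `^ eta)
  (g_holder : forall j, (j.+1 < M)%N -> ~~ jump j -> `|g j.+1 - g j| <= G * H `^ eta)
  (jump_n : (\sum_(j < M.-1) jump j <= n)%N)
  (psiG : forall j, (j <= M)%N -> `|psi j| <= L * G)
  (erE : forall j, (j < M)%N ->
     `|er j - (1 - h j * s j / m)| <= h j / m * (L ^+ 2 * (H / m) + L * H `^ eta))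
  (srE : forall j, (j < M)%N ->
     `|sr j - h j * g j / m| <= h j / m * (G * (L * (H / m) + H `^ eta))).

Lemma dsweep_error (b : bool) j : (j <= M)%N -> dsweep M m h s g b u ->
  (if b then psi 0%N else psi M) = 0 ->
  (forall j, (j < M)%N ->
     if b then psi j.+1 = er j * psi j + sr j else psi j = er j * psi j.+1 + sr j) ->
  `|psi j - u j| <= (20 + 2 * n%:R + 2 * rho) * L ^+ 5 * G * (H `^ eta * m `^ (- sig)).
Proof.
case: b => /= jM uP psi0 psiE.
  exact: (sweep_error L1 rho1 H01 m01 eta01 sig_eta sig_half G0 hH h1 sL gG s_holder g_holder
    jump_n uP psi0 psiE psiG erE srE).
have lt i : (i < M)%N -> (M.-1 - i < M)%N by clear; lia.
(* The other direction is the reversed problem. M cells have M.-1 interfaces, so [jump] is reversed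
   about M.-1.-1. *)
have hr := (@sweep_error R M n m L G rho H eta sig (revn M h) (revn M s) (revn M g)
  (fun j => u (M - j)%N) (fun j => psi (M - j)%N) (revn M er) (revn M sr)
  (fun j => jump (M.-1.-1 - j)%N)).
rewrite -(subKn jM); apply: hr => //; rewrite /revn.
- by move=> i /lt; exact: hH.
- by rewrite sum_revn.
- by move=> i /lt; exact: sL.
- by move=> i /lt; exact: gG.
- move=> i iM jj; rewrite distrC.
  have e1 : (M.-1 - i.+1 = M.-1.-1 - i)%N by clear; lia.
  have e2 : (M.-1 - i = (M.-1.-1 - i).+1)%N by clear -iM; lia.
  by rewrite e1 e2; apply: s_holder jj; clear -iM; lia.
- move=> i iM jj; rewrite distrC.
  have e1 : (M.-1 - i.+1 = M.-1.-1 - i)%N by clear; lia.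
  have e2 : (M.-1 - i = (M.-1.-1 - i).+1)%N by clear -iM; lia.
  by rewrite e1 e2; apply: g_holder jj; clear -iM; lia.
- apply: leq_trans jump_n; rewrite leq_eqVlt; apply/orP; left; apply/eqP.
  rewrite [RHS](reindex_inj rev_ord_inj) /=; apply: eq_bigr => i _.
  by congr (nat_of_bool (jump _)); clear; lia.
- by rewrite subn0.
- move=> i iM; have e1 : (M - i.+1 = M.-1 - i)%N by clear; lia.
  have e2 : (M - i = (M.-1 - i).+1)%N by clear -iM; lia.
  by rewrite e1 e2; apply: psiE; exact: lt.
- by move=> i iM; apply: psiG; exact: leq_subr.
- by move=> i /lt; exact: erE.
- by move=> i /lt; exact: srE.
- exact: leq_subr.
Qed.

End DirectedSweepError.

(** * Bounds and regularity of the flux, in space and in the direction *)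

Section FluxBounds.
Context {R : realType}.
Local Notation leb := (@lebesgue_measure R).
Implicit Types (x y t a b A G : R) (g : R -> R).

Lemma unit_le_powR (y eta : R) : 0 <= y <= 1 -> 0 < eta < 1 -> y <= y `^ eta.
Proof.
move=> /andP[y0 y1] /andP[eta0 eta1]; have [->|yn] := eqVneq y 0; first exact: powR_ge0.
rewrite -[X in X <= _]powRr1 //; apply: ger_powR; last exact: ltW.
by rewrite y1 andbT lt_neqAle eq_sym yn.
Qed.

Lemma tail_integral_bound (q : R -> R) a b : 0 < a ->
  leb.-integrable `[1, +oo[ (EFin \o q) ->
  (forall t, 1 <= t -> `|q t| <= b * t `^ (- (1 + a))) ->
  `|\int[leb]_(t in `[1, +oo[) q t| <= b / a.
Proof.
move=> a0 iq qb; rewrite -(Rintegral_powR_tail a0).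
have ip := integrable_powR_tail a0.
rewrite -RintegralZl //; apply: (le_trans (le_normr_Rintegral _ iq)) => //.
apply: le_Rintegral => //.
- exact: integrable_norm.
- exact: integrable_EFinZ.
- by move=> t; rewrite /= in_itv /= andbT; exact: qb.
Qed.

Lemma tail_integral_sub_bound (p q : R -> R) a b : 0 < a ->
  leb.-integrable `[1, +oo[ (EFin \o p) -> leb.-integrable `[1, +oo[ (EFin \o q) ->
  (forall t, 1 <= t -> `|p t - q t| <= b * t `^ (- (1 + a))) ->
  `|\int[leb]_(t in `[1, +oo[) p t - \int[leb]_(t in `[1, +oo[) q t| <= b / a.
Proof.
move=> a0 ip iq pq; rewrite -RintegralB //; apply: tail_integral_bound => //.
exact: integrable_EFinB.
Qed.

Variables (sigma : R -> R) (L : R).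
Hypotheses (L1 : 1 <= L) (msigma : measurable_fun `[(0 : R), 1] sigma)
  (sigmaL : forall x, 0 <= x <= 1 -> L^-1 <= sigma x <= L).

Lemma slab_dom g G A x t : bounded01 G g -> (forall y, 0 <= y <= 1 -> `|g y| <= A * sigma y) ->
  0 <= t -> 0 <= x <= 1 -> `|slab sigma g x t| <= A * 2.
Proof.
move=> bg gA t0 x01; have bk := bounded_ker L1 msigma sigmaL x t0.
have bs := bounded_sigma L1 msigma sigmaL.
have A0 : 0 <= A.
  have := le_trans (normr_ge0 _) (gA x x01); have /andP[s1 _] := sigmaL x01.
  by rewrite pmulr_lge0 // (lt_le_trans _ s1) // invr_gt0 (lt_le_trans _ L1).
have bd := bounded01M (bounded01_cst A) (bounded01M bk bs).
rewrite /slab; apply: (le_trans (bounded01_norm_le (bounded01M bk bg) bd _ _ _)) => //.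
  move=> y y01; rewrite normrM (ger0_norm (ker_ge0 _ _ _ t0)) mulrCA.
  by rewrite ler_wpM2l ?gA // ker_ge0.
by rewrite (bounded01Z _ (bounded01M bk bs)) // ler_wpM2l // (slab_sigma_le2 L1 msigma sigmaL).
Qed.

Lemma sqr_invE t : 0 < t -> t^-1 ^+ 2 = t `^ (- (1 + 1)).
Proof.
by move=> t0; rewrite -(_ : 2%:R = 1 + 1 :> R) // powR_invn ?(ltW t0) // exprVn.
Qed.

(** The slab response to [sigma] is at most 2, the angular weight t^-2 has mass 1, and the factor
    1/2 normalises: the exact operator is nonexpansive in the sup norm of g / sigma. *)
Lemma flux_dom g G A x : bounded01 G g -> (forall y, 0 <= y <= 1 -> `|g y| <= A * sigma y) ->
  0 <= x <= 1 -> `|2^-1 * \int[leb]_(y in `[0, 1]) (E1 (optical_depth sigma x y) * g y)| <= A.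
Proof.
move=> bg gA x01; have [i1 ->] := flux_slab L1 msigma sigmaL bg x01.
have h : `|\int[leb]_(t in `[1, +oo[) (t^-1 ^+ 2 * slab sigma g x t)| <= A * 2 / 1.
  apply: tail_integral_bound => // t t1; have t0 : 0 < t by rewrite (lt_le_trans _ t1).
  rewrite normrM ger0_norm ?sqr_ge0 // sqr_invE // mulrC ler_wpM2r ?powR_ge0 //.
  exact: (slab_dom bg gA (ltW t0) x01).
rewrite normrM gtr0_norm ?invr_gt0 // ler_pdivrMl // mulrC.
by apply: (le_trans h); rewrite divr1.
Qed.

(** With d = |x - x'|, the Lipschitz bound in t d and the constant bound combine into (t d)^eta. The
    angular integral of t^(eta - 2) then converges, to 1 / (1 - eta). *)
Lemma flux_holder g G eta x x' : 0 < eta < 1 -> bounded01 G g -> 0 <= x <= 1 -> 0 <= x' <= 1 ->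
  `|2^-1 * \int[leb]_(y in `[0, 1]) (E1 (optical_depth sigma x y) * g y) -
    2^-1 * \int[leb]_(y in `[0, 1]) (E1 (optical_depth sigma x' y) * g y)| <=
  2 / (1 - eta) * L ^+ 2 * G * `|x - x'| `^ eta.
Proof.
have aux (p q : R) : p <= q -> 2 * p + 2 * p <= 4 * q by lra.
move=> /andP[eta0 eta1] bg x01 x01'; have [_ gG] := bg.
have G0 : 0 <= G by apply: le_trans (gG x x01).
have [i1 e1] := flux_slab L1 msigma sigmaL bg x01.
have [i2 e2] := flux_slab L1 msigma sigmaL bg x01'.
suff h p q : p = \int[leb]_(t in `[1, +oo[) (t^-1 ^+ 2 * slab sigma g x t) ->
    q = \int[leb]_(t in `[1, +oo[) (t^-1 ^+ 2 * slab sigma g x' t) ->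
    `|2^-1 * p - 2^-1 * q| <= 2 / (1 - eta) * L ^+ 2 * G * `|x - x'| `^ eta.
  exact: h e1 e2.
move=> pE qE; rewrite -mulrBr normrM gtr0_norm ?invr_gt0 // ler_pdivrMl // pE qE {p q pE qE e1 e2}.
set d := `|x - x'|; have d0 : 0 <= d := normr_ge0 _.
have -> : 2 * (2 / (1 - eta) * L ^+ 2 * G * d `^ eta) = 4 * (L ^+ 2 * G) * d `^ eta / (1 - eta).
  by ring.
apply: (tail_integral_sub_bound _ i1 i2) => [|t t1]; first by rewrite subr_gt0.
 have t0 : 0 < t by rewrite (lt_le_trans _ t1).
have LG : 0 <= L ^+ 2 * G by rewrite mulr_ge0 ?sqr_ge0.
have key : `|slab sigma g x t - slab sigma g x' t| <= 4 * (L ^+ 2 * G) * (t * d) `^ eta.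
  have td : 0 <= t * d by rewrite mulr_ge0 // ltW.
  have [td1|/ltW td1] := leP (t * d) 1.
    apply: (le_trans (slab_lip_x L1 msigma sigmaL bg (ltW t0) x01 x01')).
    rewrite ler_wpM2l ?(mulr_ge0 _ LG) //; apply: unit_le_powR; last by rewrite eta0.
    by rewrite td.
  have h1 : 1 <= (t * d) `^ eta by rewrite -(@powRr0 R (t * d)) ler_powR // ltW.
  apply: (@le_trans _ _ (4 * (L ^+ 2 * G))); last by rewrite ler_peMr // mulr_ge0.
  have b1 := slab_bound L1 msigma sigmaL bg (ltW t0) x01.
  have b2 := slab_bound L1 msigma sigmaL bg (ltW t0) x01'.
  have b3 : L * G <= L ^+ 2 * G by rewrite ler_wpM2r // expr2 ler_peMr // (le_trans _ L1).
  apply: (le_trans (ler_normB _ _)); apply: (le_trans (lerD b1 b2)).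
  exact: aux.
rewrite -mulrBr normrM ger0_norm ?sqr_ge0 // sqr_invE //.
apply: (le_trans (ler_wpM2l (powR_ge0 _ _) key)).
rewrite (powRM _ (ltW t0) d0); apply: le_of_eq.
have -> : - (1 + (1 - eta)) = - (1 + 1) + eta by ring.
rewrite powRD; last by apply/implyP => _; rewrite gt_eqF.
by move: (t `^ _) (t `^ _) (d `^ _) => p q r; ring.
Qed.

(** For p < q the square roots of the two directions, [slab_lip_t] gives the factor 1 - p^2 / q^2 =
    (q - p)(q + p) / q^2, and a weight of at most q reduces it to 2 (q - p). *)
Lemma slab_sqrt_lip g G x mu nu : bounded01 G g -> 0 <= x <= 1 -> 0 < mu <= 1 -> 0 <= nu <= 1 ->
  Num.sqrt mu * `|slab sigma g x mu^-1 - slab sigma g x nu^-1| <=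
  8 * (L * G) * `|Num.sqrt mu - Num.sqrt nu|.
Proof.
have aux (c : R) : 0 <= c -> 2 * c + 2 * c <= 8 * c by lra.
move=> bg x01 /andP[mu0 mu1] /andP[nu0 nu1]; have [_ gG] := bg.
have G0 : 0 <= G by apply: le_trans (gG x x01).
have LG : 0 <= L * G by rewrite mulr_ge0 // (le_trans _ L1).
have LG4 : 0 <= 4 * (L * G) by rewrite mulr_ge0.
have sm : 0 < Num.sqrt mu by rewrite sqrtr_gt0.
have minv : 0 <= mu^-1 by rewrite invr_ge0 ltW.
(* As 0^-1 = 0, the value at nu = 0 is the slab at t = 0. Boundedness is enough here, since the
   right side keeps the full sqrt mu. *)
have [->|nun] := eqVneq nu 0.
  rewrite invr0 sqrtr0 subr0 (ger0_norm (ltW sm)) [leRHS]mulrC ler_wpM2l ?(ltW sm) //.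
  have b1 := slab_bound L1 msigma sigmaL bg minv x01.
  have b2 := slab_bound L1 msigma sigmaL bg (lexx 0) x01.
  apply: (le_trans (ler_normB _ _)); apply: (le_trans (lerD b1 b2)); exact: aux.
have {nun} nu0' : 0 < nu by rewrite lt_neqAle eq_sym nun.
have sn : 0 < Num.sqrt nu by rewrite sqrtr_gt0.
have esm : Num.sqrt mu ^+ 2 = mu by rewrite sqr_sqrtr // ltW.
have esn : Num.sqrt nu ^+ 2 = nu by rewrite sqr_sqrtr.
have [mn|/ltW nm] := leP mu nu.
  have tt : nu^-1 <= mu^-1 by rewrite lef_pV2 ?posrE.
  have ninv : 0 < nu^-1 by rewrite invr_gt0.
  have h : `|slab sigma g x mu^-1 - slab sigma g x nu^-1| <= 4 * (L * G) * (1 - nu^-1 / mu^-1).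
    by rewrite distrC; exact: slab_lip_t tt x01.
  rewrite invrK in h.
  apply: (le_trans (ler_wpM2l (ltW sm) h)).
  have -> : Num.sqrt mu * (4 * (L * G) * (1 - nu^-1 * mu)) = 4 * (L * G) * (Num.sqrt mu * (1 - nu^-1 * mu)).
    by ring.
  have -> : 8 * (L * G) * `|Num.sqrt mu - Num.sqrt nu| = 4 * (L * G) * (2 * `|Num.sqrt mu - Num.sqrt nu|).
    by ring.
  rewrite ler_wpM2l //.
  have le : Num.sqrt mu <= Num.sqrt nu by rewrite ler_sqrt.
  have -> : nu^-1 * mu = (Num.sqrt nu ^+ 2)^-1 * Num.sqrt mu ^+ 2 by rewrite esm esn.
  rewrite distrC ger0_norm ?subr_ge0 // {esm esn}; move: (Num.sqrt mu) (Num.sqrt nu) sm sn le => p q p0 q0 pq.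
  have -> : p * (1 - (q ^+ 2)^-1 * p ^+ 2) = p * (q + p) * (q - p) / q ^+ 2.
    by field; rewrite gt_eqF.
  rewrite ler_pdivrMr ?exprn_gt0 // (mulrAC 2) ler_wpM2r ?subr_ge0 //; nra.
have tt : mu^-1 <= nu^-1 by rewrite lef_pV2 ?posrE.
have ninv : 0 < mu^-1 by rewrite invr_gt0.
have h := slab_lip_t L1 msigma sigmaL bg ninv tt x01; rewrite invrK in h.
apply: (le_trans (ler_wpM2l (ltW sm) h)).
have -> : Num.sqrt mu * (4 * (L * G) * (1 - mu^-1 * nu)) = 4 * (L * G) * (Num.sqrt mu * (1 - mu^-1 * nu)).
  by ring.
have -> : 8 * (L * G) * `|Num.sqrt mu - Num.sqrt nu| = 4 * (L * G) * (2 * `|Num.sqrt mu - Num.sqrt nu|).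
  by ring.
rewrite ler_wpM2l //.
have le : Num.sqrt nu <= Num.sqrt mu by rewrite ler_sqrt // ltW.
have -> : mu^-1 * nu = (Num.sqrt mu ^+ 2)^-1 * Num.sqrt nu ^+ 2 by rewrite esm esn.
rewrite ger0_norm ?subr_ge0 // {esm esn}; move: (Num.sqrt mu) (Num.sqrt nu) sm sn le => p q p0 q0 pq.
have -> : p * (1 - (p ^+ 2)^-1 * q ^+ 2) = (p + q) * (p - q) / p.
  by field; rewrite gt_eqF.
rewrite ler_pdivrMr // (mulrAC 2) ler_wpM2r ?subr_ge0 //; nra.
Qed.

End FluxBounds.

(** * The pathwise error for fixed data: regularity, consistency and stability combined *)

Section ErrorEstimate.
Context {R : realType}.
Local Notation leb := (@lebesgue_measure R).
Implicit Types (x y t : R).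
Variables (eta L F : R) (cs : seq R) (sigma sigmaS f phi : R -> R).
Hypotheses (pcs : itv_partition 0 1 cs) (eta01 : 0 < eta < 1) (L1 : 1 < L)
  (Csigma : Cpw eta cs sigma) (CsigmaS : Cpw eta cs sigmaS) (Cf : Cpw eta cs f)
  (nsigma : (pw_norm eta cs sigma <= L%:E)%E) (nsigmaS : (pw_norm eta cs sigmaS <= L%:E)%E)
  (nf : (pw_norm eta cs f <= F%:E)%E)
  (sigma_ge : forall x, 0 <= x <= 1 -> L^-1 <= sigma x)
  (sigmaS_ge0 : forall x, 0 <= x <= 1 -> 0 <= sigmaS x)
  (sigmaA_ge : forall x, 0 <= x <= 1 -> L^-1 <= sigma x - sigmaS x)
  (flux : scalar_flux sigma sigmaS f phi).

Local Notation g := (fun y => sigmaS y * phi y + f y).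
Local Notation G := (6 / (1 - eta) * L ^+ 7 * F).

Let eta0 : 0 < eta. Proof. by have /andP[] := eta01. Qed.
Let L1' : 1 <= L. Proof. exact: ltW. Qed.
Let L0 : 0 < L. Proof. exact: lt_trans ltr01 L1. Qed.
Let msigma : measurable_fun `[(0 : R), 1] sigma.
Proof. exact: Cpw_measurable Csigma. Qed.
Let sigmaL x : 0 <= x <= 1 -> L^-1 <= sigma x <= L.
Proof.
move=> x01; rewrite sigma_ge //=; apply: le_trans (Cpw_bounded pcs Csigma nsigma x01).
exact: ler_norm.
Qed.
Let F0 : 0 <= F.
Proof.
by apply: le_trans (Cpw_bounded pcs Cf nf (_ : 0 <= (0 : R) <= 1)); rewrite ?lexx ?ler01.
Qed.

Lemma scattering_ratio x : 0 <= x <= 1 -> `|sigmaS x| <= (1 - L ^- 2) * sigma x.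
Proof.
move=> x01; rewrite ger0_norm ?sigmaS_ge0 //.
have h1 := sigmaA_ge x01; have /andP[_ h2] := sigmaL x01.
have h3 : L ^- 2 * sigma x <= L^-1.
  rewrite mulrC ler_pdivrMr ?exprn_gt0 //; apply: (le_trans h2).
  by rewrite expr2 mulrA mulVf ?mul1r // gt_eqF.
by rewrite mulrBl mul1r; lra.
Qed.

(** The boundedness contained in [scalar_flux] makes the supremum S finite, so S <= (1 - L^-2) S + L
    F can be solved for S. *)
Lemma flux_sup_bound x : 0 <= x <= 1 -> `|phi x| <= L ^+ 3 * F.
Proof.
have [mphi [B phiB] phiE] := flux.
pose Sset := [set `|phi y| | y in `[0, 1]].
have sup_ub' y : 0 <= y <= 1 -> `|phi y| <= sup Sset.
  move=> y01; apply: ub_le_sup; last by exists y => //; rewrite /= in_itv.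
  by exists B => _ [z z01 <-]; apply: phiB; rewrite in_itv in z01 *.
set S := sup Sset in sup_ub'.
have bg : bounded01 (L * S + F) g.
  apply: bounded01D; last by split; [exact: Cpw_measurable Cf|move=> y; exact: Cpw_bounded Cf nf].
  apply: bounded01M; first by split; [exact: Cpw_measurable CsigmaS|move=> y; exact: Cpw_bounded CsigmaS nsigmaS].
  by split.
have gA y : 0 <= y <= 1 -> `|g y| <= ((1 - L ^- 2) * S + L * F) * sigma y.
  move=> y01; apply: (le_trans (ler_normD _ _)); rewrite mulrDl; apply: lerD.
    rewrite normrM mulrAC; apply: ler_pM => //; [exact: scattering_ratio|exact: sup_ub'].
  apply: (dominated_by_sigma L1' sigmaL _ y01) => z; exact: Cpw_bounded Cf nf.
have key y : 0 <= y <= 1 -> `|phi y| <= (1 - L ^- 2) * S + L * F.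
  by move=> y01; rewrite phiE ?in_itv //; exact: (flux_dom L1' msigma sigmaL bg gA y01).
have SS : S <= (1 - L ^- 2) * S + L * F.
  apply: ge_sup; first by exists `|phi 0|, 0 => //; rewrite /= in_itv /= lexx ler01.
  by move=> _ [y + <-]; rewrite /= in_itv /=; exact: key.
move=> x01; apply: (le_trans (sup_ub' x x01)).
have h : S * L ^- 2 <= L * F by move: SS; rewrite mulrBl mul1r mulrC; lra.
rewrite ler_pdivrMr ?exprn_gt0 // in h; apply: (le_trans h).
by apply: le_of_eq; ring.
Qed.

Let Lpow (a b : nat) : (a <= b)%N -> L ^+ a * F <= L ^+ b * F.
Proof. by move=> ab; rewrite ler_wpM2r // ler_weXn2l. Qed.

Lemma source_bounded : bounded01 (2 * (L ^+ 4 * F)) g.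
Proof.
have [mphi _ _] := flux.
have b1 : bounded01 L sigmaS.
  by split; [exact: Cpw_measurable CsigmaS|move=> y; exact: Cpw_bounded CsigmaS nsigmaS].
have b2 : bounded01 (L ^+ 3 * F) phi by split => // y; exact: flux_sup_bound.
have b3 : bounded01 F f.
  by split; [exact: Cpw_measurable Cf|move=> y; exact: Cpw_bounded Cf nf].
have [m1 m2] := bounded01D (bounded01M b1 b2) b3; split => // x x01.
apply: (le_trans (m2 x x01)); have := @Lpow 0 4 isT; rewrite expr0 mul1r mulrA -exprS; lra.
Qed.

Lemma flux_is_holder x x' : 0 <= x <= 1 -> 0 <= x' <= 1 ->
  `|phi x - phi x'| <= 4 / (1 - eta) * (L ^+ 6 * F) * `|x - x'| `^ eta.
Proof.
move=> x01 x01'; have [_ _ phiE] := flux; rewrite !phiE ?in_itv //.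
apply: (le_trans (flux_holder L1' msigma sigmaL eta01 source_bounded x01 x01')).
by apply: le_of_eq; move: (_ `^ _) => p; ring.
Qed.

Let inv1eta : 1 <= (1 - eta)^-1.
Proof. by have /andP[? ?] := eta01; rewrite invf_ge1 ?subr_gt0 //; lra. Qed.

(** The three terms of the product rule contribute 4, 1 and 1 to the constant 6; the power L^7 is
    the L^6 of the flux times the bound L of [sigmaS]. *)
Lemma source_holder l x y : (l < size cs)%N -> cell cs l x -> cell cs l y ->
  `|g x - g y| <= G * `|x - y| `^ eta.
Proof.
move=> lJ xl yl; have x01 := cell01 pcs lJ xl; have y01 := cell01 pcs lJ yl.
have p0 : 0 <= `|x - y| `^ eta by exact: powR_ge0.
have -> : sigmaS x * phi x + f x - (sigmaS y * phi y + f y) =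
   sigmaS x * (phi x - phi y) + phi y * (sigmaS x - sigmaS y) + (f x - f y) by ring.
have h1 : `|sigmaS x * (phi x - phi y)| <= L * (4 / (1 - eta) * (L ^+ 6 * F) * `|x - y| `^ eta).
  by rewrite normrM; apply: ler_pM => //; [exact: Cpw_bounded CsigmaS nsigmaS x01|exact: flux_is_holder].
have h2 : `|phi y * (sigmaS x - sigmaS y)| <= L ^+ 3 * F * (L * `|x - y| `^ eta).
  by rewrite normrM; apply: ler_pM => //; [exact: flux_sup_bound|exact: cell_holder nsigmaS lJ xl yl].
have h3 : `|f x - f y| <= F * `|x - y| `^ eta by exact: cell_holder nf lJ xl yl.
apply: (le_trans (ler_normD _ _)); apply: (le_trans (lerD (ler_normD _ _) h3)).
apply: (le_trans (lerD (lerD h1 h2) (lexx _))).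
move: p0; move: (_ `^ _) => p p0.
have -> : L * (4 / (1 - eta) * (L ^+ 6 * F) * p) + L ^+ 3 * F * (L * p) + F * p =
   (4 / (1 - eta) * (L ^+ 7 * F) + L ^+ 4 * F + L ^+ 0 * F) * p by ring.
rewrite ler_wpM2r // -mulrA (_ : G = 6 * ((1 - eta)^-1 * (L ^+ 7 * F))); last by ring.
have e1 := @Lpow 4 7 isT; have e2 := @Lpow 0 7 isT.
have e3 : 0 <= L ^+ 7 * F by rewrite mulr_ge0 // exprn_ge0 // ltW.
have e4 := ler_wpM2r e3 inv1eta.
by move: e1 e2 e3 e4; move: (L ^+ 7 * F) (L ^+ 4 * F) (L ^+ 0 * F) (1 - eta)^-1 => A B C D; nra.
Qed.

Let LF0 k : 0 <= L ^+ k * F. Proof. by rewrite mulr_ge0 // exprn_ge0 // ltW. Qed.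

Lemma source_bound : bounded01 G g.
Proof.
have [m1 m2] := source_bounded; split => // x x01; apply: (le_trans (m2 x x01)).
rewrite (_ : G = 6 * ((1 - eta)^-1 * (L ^+ 7 * F))); last by ring.
have e1 := @Lpow 4 7 isT; have e3 := LF0 7; have e4 := ler_wpM2r e3 inv1eta.
by move: e1 e3 e4; move: (L ^+ 7 * F) (L ^+ 4 * F) (1 - eta)^-1 => A B D; nra.
Qed.

Section OnMesh.
Variables (rho c0 : R) (xs : seq R) (N : nat) (mu w : nat -> nat -> R) (Cg Cs Cq : R) (v : R -> R).
Hypotheses (rho1 : 1 <= rho) (c00 : 0 < c0) (mxs : mesh rho cs xs) (N0 : (0 < N)%N)
  (gl : gauss_legendre N (mu N) (w N))
  (Cg0 : 0 <= Cg) (angular : forall Fn A, 0 <= A ->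
     (forall x y : R, 0 < x <= 1 -> 0 <= y <= 1 ->
        Num.sqrt x * `|Fn x - Fn y| <= A * `|Num.sqrt x - Num.sqrt y|) ->
     leb.-integrable `[1%R, +oo[ (EFin \o (fun t => (t^-1) ^+ 2 * Fn t^-1)) ->
     `|\sum_(k < N) w N k * Fn (mu N k) - \int[leb]_(t in `[1, +oo[) ((t^-1) ^+ 2 * Fn t^-1)| <=
       Cg * (A / N%:R))
  (Cs0 : 0 <= Cs) (hCs : \sum_(k < N) w N k * mu N k `^ (- (Num.max eta 2^-1)) <= Cs)
  (hCq : \sum_(k < N) w N k * mu N k `^ (- 2^-1) <= Cq)
  (hN : N%:R^-1 <= diameter xs `^ eta / c0)
  (dv : discrete_solution mu w xs N sigma sigmaS f v).

Local Notation node := (left_pt xs).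
Local Notation M := (size xs).
Local Notation h := (cell_length xs).
Local Notation H := (diameter xs).
Local Notation s := (fun j => sigma (midpoint xs j)).
Local Notation sig := (Num.max eta 2^-1).
Local Notation V := (Kh_sol M N h s (mu N) (w N) (fun j => g (midpoint xs j))).

Let pxs : itv_partition 0 1 xs. Proof. by have [] := mxs. Qed.
Let sub_cs : {subset cs <= xs}. Proof. by have [] := mxs. Qed.
Let G0 : 0 <= G.
Proof.
have [_ gG] := source_bound.
by apply: le_trans (gG 0 _); rewrite ?lexx ?ler01.
Qed.
Let mid01 j : (j < M)%N -> 0 <= midpoint xs j <= 1.
Proof. by move=> jM; exact: (cell01 pxs jM (midpoint_cell pxs jM)). Qed.
Let mu01 k : (k < N)%N -> 0 < mu N k < 1. Proof. by have [h1 _ _] := gl; exact: h1. Qed.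
Let w0 k : (k < N)%N -> 0 <= w N k. Proof. exact: (gauss_weight_ge0 gl). Qed.
Let w1 : \sum_(k < N) w N k = 1. Proof. exact: (gauss_weight_sum N0 gl). Qed.

Lemma dist_in_cell j x y : (j < M)%N -> node j <= x <= node j.+1 -> node j <= y <= node j.+1 ->
  `|x - y| `^ eta <= H `^ eta.
Proof.
move=> jM /andP[x1 x2] /andP[y1 y2]; have hj := cell_length_le_diameter jM.
rewrite ge0_ler_powR ?nnegrE ?(ltW eta0) ?(ltW (diameter_gt0 pxs)) //.
apply: le_trans hj; rewrite /cell_length -left_ptS ler_norml.
by move: x1 x2 y1 y2; move: (node j.+1) (node j) => a b *; apply/andP; split; lra.
Qed.

Lemma in_cell_midpoint j (q : R -> R) B : (j < M)%N -> 0 <= B ->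
  (forall l x y, (l < size cs)%N -> cell cs l x -> cell cs l y -> `|q x - q y| <= B * `|x - y| `^ eta) ->
  (forall y, node j < y < node j.+1 -> `|q y - q (midpoint xs j)| <= B * H `^ eta) /\
  ((j.+1 < M)%N -> right_pt xs j \notin cs ->
   `|q (midpoint xs j.+1) - q (midpoint xs j)| <= B * H `^ eta).
Proof.
move=> jM B0 qB; have mj := midpoint_cell pxs jM; split=> [y yj|jM' nj].
  have [l lJ [l1 l2]] := cell_refines pcs pxs sub_cs jM.
  have sub z : cell xs j z -> cell cs l z.
    by rewrite /cell /= !in_itv /= => /andP[z1 z2]; rewrite (le_lt_trans l1 z1) (lt_le_trans z2 l2).
  have yj' : cell xs j y by rewrite /cell /= in_itv.
  apply: (le_trans (qB l _ _ lJ (sub _ yj') (sub _ mj))); rewrite ler_wpM2l //.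
  move: mj yj; rewrite /cell /= in_itv /= => /andP[/ltW m1 /ltW m2] /andP[/ltW y1 /ltW y2].
  by apply: (dist_in_cell jM); rewrite ?m1 ?m2 ?y1 ?y2.
have mj' := midpoint_cell pxs jM'.
have [l lJ [l1 l2]] := adjacent_cells_refine pcs pxs sub_cs jM' nj.
have lt : node j < node j.+1 by rewrite left_pt_lt // ltnSn.
have lt' : node j.+1 < node j.+2 by rewrite left_pt_lt // ltnSn.
have s1 : cell cs l (midpoint xs j).
  move: mj; rewrite /cell /= !in_itv /= -!left_ptS => /andP[z1 z2].
  by rewrite (le_lt_trans l1 z1) (lt_le_trans (lt_trans z2 lt') l2).
have s2 : cell cs l (midpoint xs j.+1).
  move: mj'; rewrite /cell /= !in_itv /= -!left_ptS => /andP[z1 z2].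
  by rewrite (le_lt_trans l1 (lt_trans lt z1)) (lt_le_trans z2 l2).
apply: (le_trans (qB l _ _ lJ s2 s1)); rewrite ler_wpM2l //.
rewrite ge0_ler_powR ?nnegrE ?(ltW eta0) ?(ltW (diameter_gt0 pxs)) //.
have h1 := cell_length_le_diameter jM; have h2 := cell_length_le_diameter jM'.
move: h1 h2 lt lt'; rewrite /midpoint /cell_length -!left_ptS.
move: (node j) (node j.+1) (node j.+2) => a b c *.
by rewrite ger0_norm; lra.
Qed.

Lemma direction_error k (b : bool) i : (k < N)%N -> (i <= M)%N ->
  `|psi sigma b g (node i) (mu N k)^-1 - dsweep_sol M h s (mu N k) (fun j => g (midpoint xs j)) b i| <=
  (20 + 2 * (size cs)%:R + 2 * rho) * L ^+ 5 * G * (H `^ eta * mu N k `^ (- sig)).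
Proof.
move=> kN iM; have /andP[m0 m1] := mu01 kN; set m := mu N k in m0 m1 *; set t := m^-1.
have t0 : 0 <= t by rewrite invr_ge0 ltW.
have bg := source_bound.
have s0 j : (j < M)%N -> 0 < s j.
  by move=> jM; apply: lt_le_trans (sigma_ge (mid01 jM)); rewrite invr_gt0.
have sH l x y : (l < size cs)%N -> cell cs l x -> cell cs l y -> `|sigma x - sigma y| <= L * `|x - y| `^ eta.
  by move=> lJ; exact: cell_holder nsigma lJ.
have gH l x y : (l < size cs)%N -> cell cs l x -> cell cs l y -> `|g x - g y| <= G * `|x - y| `^ eta.
  by exact: source_holder.
have endp j : (j < M)%N -> [/\ 0 <= node j, node j <= node j.+1 & node j.+1 <= 1].
  move=> jM; have /andP[a1 _] := left_pt01 pxs (ltnW jM); have /andP[_ b1] := left_pt01 pxs jM.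
  by split => //; apply: left_pt_le; rewrite ?leqnSn.
have lenH j : (j < M)%N -> node j.+1 - node j <= H by move=> jM; exact: (cell_length_le_diameter jM).
pose er j := expR (- (t * (tau sigma (node j.+1) - tau sigma (node j)))).
pose sr j := \int[leb]_(y in `[node j, node j.+1])
  (ker sigma (if b then node j.+1 else node j) t y * g y).
apply: (dsweep_error (n := size cs) (m := m) (L := L) (G := G) (rho := rho) (H := H) (h := h) (s := s)
  (g := fun j => g (midpoint xs j)) (u := dsweep_sol M h s m (fun j => g (midpoint xs j)) b)
  (psi := fun i => psi sigma b g (node i) t)
  (er := er) (sr := sr) (jump := fun j => right_pt xs j \in cs)
  L1' rho1 _ _ eta01 _ _ G0 _ _ _ _ _ _ _ _ _ _ (b := b) iM _ _ _).
- by rewrite (diameter_gt0 pxs) (diameter_le1 pxs).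
- by rewrite m0 ltW.
- by rewrite le_max lexx.
- by rewrite le_max lexx orbT.
- move=> j jM; rewrite (cell_length_gt0 pxs jM) (cell_length_le_diameter jM); split => //.
  by have [_ _] := mxs; apply.
- exact: sum_cell_length.
- by move=> j jM; apply: sigmaL; exact: mid01.
- by move=> j jM; have [_ gG] := bg; apply: gG; exact: mid01.
- move=> j jM; have [_ hj] := in_cell_midpoint (ltnW jM) (ltW L0) sH; exact: hj.
- move=> j jM; have [_ hj] := in_cell_midpoint (ltnW jM) G0 gH; exact: hj.
- exact: sum_breakpoints.
- by move=> j jM; apply: (psi_bound L1' msigma sigmaL b bg t0); exact: left_pt01.
- move=> j jM; have [a0 ab b1] := endp j jM; have [hj _] := in_cell_midpoint jM (ltW L0) sH.
  exact: (cell_decay L1' msigma sigmaL a0 ab b1 (lenH j jM) t0 hj).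
- move=> j jM; have [a0 ab b1] := endp j jM; have [hj _] := in_cell_midpoint jM G0 gH.
  apply: (cell_source L1' msigma sigmaL bg a0 ab b1 (lenH j jM) t0 _ hj).
  by case: (b); rewrite ?lexx ?ab.
- by apply: dsweep_solP => //; exact: cell_length_gt0.
- rewrite /psi; case: (b); last by rewrite (left_pt_size pxs) set_itv1 Rintegral_set1.
  by rewrite left_pt0 set_itv1 Rintegral_set1.
- move=> j jM; have [a0 ab b1] := endp j jM; rewrite /er /sr; case: (b).
    exact: (psi_step_true L1' msigma sigmaL bg t0 a0 ab b1).
  exact: (psi_step_false L1' msigma sigmaL bg t0 a0 ab b1).
Qed.

Local Notation K := (4 * Cg / c0 + (20 + 2 * (size cs)%:R + 2 * rho) * Cs).

Let K0 : 0 <= K.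
Proof.
apply: addr_ge0; first by rewrite divr_ge0 ?mulr_ge0 // ltW.
by rewrite mulr_ge0 // !addr_ge0 ?mulr_ge0 // (le_trans ler01).
Qed.

Let He0 : 0 <= H `^ eta. Proof. exact: powR_ge0. Qed.

(** The consistency error for the exact source. The intermediate quantity is the Gauss sum of exact
    angular fluxes: its distance to [phi] is the quadrature error, and its distance to [V] a
    weighted sum of sweep errors. *)
Lemma node_error i : (i <= M)%N -> `|phi (node i) - V i| <= K * (L ^+ 5 * G) * H `^ eta.
Proof.
move=> iM; have x01 := left_pt01 pxs iM; have [_ _ phiE] := flux.
have bg := source_bound; rewrite phiE ?in_itv //.
have [i1 ->] := flux_slab L1' msigma sigmaL bg x01.
set x := node i in x01 i1 *; set T := \int[leb]_(t in _) _.
have LG : 0 <= L * G by rewrite mulr_ge0 // ltW.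
have a1 : `|\sum_(k < N) w N k * slab sigma g x (mu N k)^-1 - T| <= Cg * (8 * (L * G) / N%:R).
  have := angular (Fn := fun m => slab sigma g x m^-1) (mulr_ge0 (ler0n R 8) LG).
  have ef : (fun t : R => t^-1 ^+ 2 * slab sigma g x t^-1^-1) = (fun t => t^-1 ^+ 2 * slab sigma g x t).
    by apply/funext => t; rewrite invrK.
  rewrite ef -/T; apply; first by move=> m n; exact: (slab_sqrt_lip L1' msigma sigmaL bg x01).
  exact: i1.
pose ds b k := dsweep_sol M h s (mu N k) (fun j => g (midpoint xs j)) b i.
have a2 : `|\sum_(k < N) w N k * slab sigma g x (mu N k)^-1 - \sum_(k < N) w N k * (ds true k + ds false k)| <=
    2 * ((20 + 2 * (size cs)%:R + 2 * rho) * L ^+ 5 * G * H `^ eta) * Cs.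
  rewrite -sumrB; apply: (le_trans (ler_norm_sum _ _ _)).
  have EG : 0 <= 2 * ((20 + 2 * (size cs)%:R + 2 * rho) * L ^+ 5 * G * H `^ eta).
    rewrite mulr_ge0 // mulr_ge0 // mulr_ge0 // mulr_ge0 ?exprn_ge0 ?(ltW L0) //.
    by rewrite !addr_ge0 ?mulr_ge0 // (le_trans ler01).
  apply: (@le_trans _ _ (2 * ((20 + 2 * (size cs)%:R + 2 * rho) * L ^+ 5 * G * H `^ eta) *
      \sum_(k < N) w N k * mu N k `^ (- sig))); last exact: ler_wpM2l.
  rewrite mulr_sumr; apply: ler_sum => k _; have kN := ltn_ord k.
  have m0 : 0 <= (mu N k)^-1 by have /andP[m0 _] := mu01 kN; rewrite invr_ge0 ltW.
  rewrite -mulrBr normrM (ger0_norm (w0 kN)) mulrCA ler_wpM2l ?w0 //.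
  rewrite (psiD L1' msigma sigmaL bg m0 x01) opprD addrACA.
  apply: (le_trans (ler_normD _ _)).
  apply: (le_trans (lerD (direction_error true kN iM) (direction_error false kN iM))).
  by apply: le_of_eq; move: (_ `^ _) (_ `^ _) => p q; ring.
rewrite /Kh_sol -/(ds _ _) -mulrBr normrM gtr0_norm ?invr_gt0 // ler_pdivrMl //.
set A := \sum_(k < N) w N k * slab _ _ _ _ in a1 a2.
set B := \sum_(k < N) w N k * _ in a2 *.
have -> : T - B = (A - B) - (A - T) by ring.
apply: (le_trans (ler_normB _ _)).
have a3 : Cg * (8 * (L * G) / N%:R) <= 2 * (4 * Cg / c0 * (L ^+ 5 * G) * H `^ eta).
  have h1 : 8 * (L * G) / N%:R <= 8 * (L ^+ 5 * G) * (H `^ eta / c0).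
    apply: ler_pM; [exact: mulr_ge0|by rewrite invr_ge0| |exact: hN].
    by rewrite ler_wpM2l // ler_wpM2r // -[X in X <= _]expr1 ler_weXn2l.
  apply: (le_trans (ler_wpM2l Cg0 h1)); apply: le_of_eq.
  by move: (H `^ eta) => p; ring.
apply: (le_trans (lerD a2 (le_trans a1 a3))); apply: le_of_eq.
by move: (H `^ eta) => p; ring.
Qed.

(** K + 1 adds the oscillation of [phi] over a cell to the consistency error. Stability costs L / (1
    - kappa) = L^3, which turns L^5 into L^8. *)
Lemma discretisation_error x : 0 <= x <= 1 ->
  `|phi x - v x| <= (1 + Cq) * (K + 1) * (L ^+ 8 * G) * H `^ eta.
Proof.
move=> x01; have [vh _] := dv.
have LG : 0 <= L ^+ 5 * G by rewrite mulr_ge0 // exprn_ge0 // ltW.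
pose r0 := (K + 1) * (L ^+ 5 * G) * H `^ eta.
have r00 : 0 <= r0 by apply: mulr_ge0 He0; apply: mulr_ge0 LG; exact: addr_ge0 K0 ler01.
have holder j y z : (j < M)%N -> node j <= y <= node j.+1 -> node j <= z <= node j.+1 ->
    `|phi y - phi z| <= L ^+ 5 * G * H `^ eta.
  move=> jM yj zj; have in01 t : node j <= t <= node j.+1 -> 0 <= t <= 1.
    have /andP[a1 _] := left_pt01 pxs (ltnW jM); have /andP[_ b1] := left_pt01 pxs jM.
    by move=> /andP[t1 t2]; rewrite (le_trans a1 t1) (le_trans t2 b1).
  apply: (le_trans (flux_is_holder (in01 _ yj) (in01 _ zj))).
  apply: ler_pM => //; rewrite ?mulr_ge0 ?powR_ge0 ?exprn_ge0 ?invr_ge0 ?subr_ge0 ?(ltW L0) //.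
  - by have /andP[_ /ltW] := eta01.
  - apply: (@le_trans _ _ G); last by rewrite ler_peMl // exprn_ege1.
    rewrite (_ : G = 6 * ((1 - eta)^-1 * (L ^+ 7 * F))); last by ring.
    rewrite -mulrA; apply: ler_pM; rewrite ?mulr_ge0 ?exprn_ge0 ?(ltW L0) ?(le_trans ler01 inv1eta) //; first lra.
    by rewrite ler_wpM2l ?(le_trans ler01 inv1eta) // Lpow.
  - exact: (dist_in_cell jM yj zj).
have nodej j : (j < M)%N -> node j <= node j.+1 by move=> jM; apply: left_pt_le; rewrite ?leqnSn.
have nerr i : (i <= M)%N -> `|phi (node i) - V i| <= K * (L ^+ 5 * G) * H `^ eta by exact: node_error.
have mid j : (j < M)%N -> `|phi (midpoint xs j) - (V j + V j.+1) / 2| <= r0.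
  move=> jM; have mj := midpoint_cell pxs jM.
  have mj' : node j <= midpoint xs j <= node j.+1.
    by move: mj; rewrite /cell /= in_itv /= => /andP[/ltW -> /ltW ->].
  have e1 := holder j _ _ jM mj' (_ : node j <= node j <= node j.+1).
  have e2 := holder j _ _ jM mj' (_ : node j <= node j.+1 <= node j.+1).
  have n1 := nerr j (ltnW jM); have n2 := nerr j.+1 jM.
  rewrite lexx nodej // in e1; rewrite lexx nodej // in e2.
  move: (e1 isT) (e2 isT) n1 n2; rewrite /r0.
  move: (phi _) (phi _) (phi _) (V j) (V j.+1) => p q r V1 V2.
  rewrite !ler_norml => /andP[? ?] /andP[? ?] /andP[? ?] /andP[? ?]; apply/andP; split; lra.
have k01 : 0 < 1 - L ^- 2 < 1.
  apply/andP; split; last by rewrite ltrBlDr ltrDl invr_gt0 exprn_gt0.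
  by rewrite subr_gt0 invf_lt1 ?exprn_gt0 // exprn_egt1.
have sLm j : (j < M)%N -> 0 < sigma (midpoint xs j) <= L.
  move=> jM; have /andP[h1 ->] := sigmaL (mid01 jM); rewrite andbT.
  by apply: lt_le_trans h1; rewrite invr_gt0.
have sSk j : (j < M)%N -> `|sigmaS (midpoint xs j)| <= (1 - L ^- 2) * sigma (midpoint xs j).
  by move=> jM; exact: scattering_ratio (mid01 jM).
have m0 k : (k < N)%N -> 0 < mu N k by move=> /mu01/andP[].
have st i : (i <= M)%N -> `|V i - v (node i)| <= Cq * (L ^+ 3 * r0).
  move=> iM; have -> : L ^+ 3 * r0 = L * r0 / (1 - (1 - L ^- 2)).
    by rewrite (_ : 1 - (1 - L ^- 2) = L ^- 2) ?invrK; ring.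
  exact: (discrete_solution_stable pxs m0 w0 w1 k01 sLm sSk r00 L1' dv iM hCq mid).
have [j jM xj] := partition_locate_cc pxs x01.
have nd i : (i <= M)%N -> node j <= node i <= node j.+1 -> `|phi x - v (node i)| <= (1 + Cq) * (L ^+ 3 * r0).
  move=> iM nij; have e1 := holder j _ _ jM xj nij; have e2 := nerr i iM; have e3 := st i iM.
  have -> : phi x - v (node i) = (phi x - phi (node i)) + (phi (node i) - V i) + (V i - v (node i)) by ring.
  apply: (le_trans (ler_normD _ _)); apply: (le_trans (lerD (ler_normD _ _) (lexx _))).
  apply: (le_trans (lerD (lerD e1 e2) e3)); rewrite [X in _ <= X]mulrDl mul1r lerD2r.
  apply: (@le_trans _ _ r0); last by rewrite ler_peMl // exprn_ege1.
  by rewrite /r0; move: (L ^+ 5 * G) (H `^ eta) => p q; apply: le_of_eq; ring.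
have n1 := nd j (ltnW jM) _; have n2 := nd j.+1 jM _.
rewrite lexx nodej // in n1; rewrite lexx nodej // in n2.
have -> : (1 + Cq) * (K + 1) * (L ^+ 8 * G) * H `^ eta = (1 + Cq) * (L ^+ 3 * r0).
  by rewrite /r0; move: (H `^ eta) => p; ring.
rewrite (Vh_interp pxs vh jM xj); set th := (x - node j) / h j.
have hj := cell_length_gt0 pxs jM.
have /andP[x1 x2] := xj.
have th0 : 0 <= th by apply: divr_ge0; [rewrite subr_ge0|exact: ltW].
have th1 : th <= 1 by rewrite ler_pdivrMr // mul1r /cell_length -left_ptS lerB.
move: (n1 isT) (n2 isT) th0 th1; move: (phi x) (v _) (v _) th ((1 + Cq) * _) => p a b q B.
rewrite !ler_norml => /andP[? ?] /andP[? ?] q0 q1; apply/andP; split; nra.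
Qed.

End OnMesh.
End ErrorEstimate.

Section Deterministic.
Context {R : realType}.
Implicit Types (eta L F H x : R) (sigma sigmaS f : R -> R) (cs xs : seq R).

Lemma Nh_bounds eta (c0 : R) H : 0 < c0 -> 0 < H ->
  (0 < Nh eta c0 H)%N /\ ((Nh eta c0 H)%:R : R)^-1 <= H `^ eta / c0.
Proof.
move=> c00 H0; set a := c0 * H `^ (- eta).
have a0 : 0 < a by rewrite mulr_gt0 ?powR_gt0.
have c_gt0 : (0 < Num.ceil a)%R by rewrite ceil_gt0.
have aN : a <= (Nh eta c0 H)%:R.
  by rewrite /Nh -/a natr_absz gtr0_norm // ceil_ge.
have N0 : 0 < (Nh eta c0 H)%:R :> R by exact: lt_le_trans aN.
split; first by rewrite -(ltr0n R).
have -> : H `^ eta / c0 = a^-1 by rewrite /a powRN invfM invrK mulrC.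
by rewrite lef_pV2 ?posrE.
Qed.

(** The leading 1 makes the bound exceed 1, hence 1 - L^-2 positive. The minimum of [sigma] is
    controlled through that of sigma - sigmaS. *)
Definition data_bound eta cs sigma sigmaS : R :=
  1 + fine (pw_norm eta cs sigma) + fine (pw_norm eta cs sigmaS) +
  (inf01 sigmaS)^-1 + (inf01 (sigma \- sigmaS))^-1.

Lemma pw_norm_ge0 eta cs f : (0 <= pw_norm eta cs f)%E.
Proof. by rewrite /pw_norm; exact: bigmax_ge_id. Qed.

Lemma pw_norm_fineK eta cs f : Cpw eta cs f -> (fine (pw_norm eta cs f))%:E = pw_norm eta cs f.
Proof. by move=> [fin _ _]; rewrite fineK // ge0_fin_numE // pw_norm_ge0. Qed.

Lemma data_boundP eta cs sigma sigmaS : admissible eta cs sigma sigmaS ->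
  let L := data_bound eta cs sigma sigmaS in
  [/\ 1 < L, (pw_norm eta cs sigma <= L%:E)%E /\ (pw_norm eta cs sigmaS <= L%:E)%E,
      forall x, 0 <= x <= 1 -> L^-1 <= sigma x,
      forall x, 0 <= x <= 1 -> 0 <= sigmaS x &
      forall x, 0 <= x <= 1 -> L^-1 <= sigma x - sigmaS x].
Proof.
move=> [Cs CsS is0 isS isA] L.
have p1 : 0 <= fine (pw_norm eta cs sigma) by rewrite fine_ge0 // pw_norm_ge0.
have p2 : 0 <= fine (pw_norm eta cs sigmaS) by rewrite fine_ge0 // pw_norm_ge0.
have p3 : 0 < (inf01 sigmaS)^-1 by rewrite invr_gt0.
have p4 : 0 < (inf01 (sigma \- sigmaS))^-1 by rewrite invr_gt0.
have sS x : 0 <= x <= 1 -> 0 <= sigmaS x.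
  by move=> x01; apply: le_trans (inf01_le isS x01); exact: ltW.
have sA x : 0 <= x <= 1 -> L^-1 <= sigma x - sigmaS x.
  move=> x01; apply: (le_trans _ (inf01_le isA x01)); rewrite -[X in _ <= X]invrK lef_pV2 ?posrE //.
    by rewrite /L /data_bound; lra.
  by rewrite /L /data_bound; lra.
split => //.
- by rewrite /L /data_bound; lra.
- by rewrite -(pw_norm_fineK Cs) -(pw_norm_fineK CsS) !lee_fin /L /data_bound; split; lra.
- move=> x x01; apply: (le_trans (sA x x01)); rewrite lerBlDr lerDl; exact: sS.
Qed.

Lemma discrete_solution_wellposed eta rho cs xs N (mu w : nat -> nat -> R) sigma sigmaS f :
  itv_partition 0 1 cs -> mesh rho cs xs -> (0 < N)%N -> gauss_legendre N (mu N) (w N) ->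
  admissible eta cs sigma sigmaS ->
  exists v, discrete_solution mu w xs N sigma sigmaS f v /\
    forall v', discrete_solution mu w xs N sigma sigmaS f v' -> forall x, x \in `[0, 1] -> v' x = v x.
Proof.
move=> pcs [pxs _ _] N0 gl adm; have [L1 [nS _] sge sS sA] := data_boundP adm.
set L := data_bound _ _ _ _ in L1 nS sge sA.
have [Csigma _ _ _ _] := adm.
have L0 : 0 < L by lra.
have m01 j : (j < size xs)%N -> 0 <= midpoint xs j <= 1.
  by move=> jM; exact: (cell01 pxs jM (midpoint_cell pxs jM)).
have k01 : 0 < 1 - L ^- 2 < 1.
  apply/andP; split; last by rewrite ltrBlDr ltrDl invr_gt0 exprn_gt0.
  by rewrite subr_gt0 invf_lt1 ?exprn_gt0 // exprn_egt1.
have sL j : (j < size xs)%N -> 0 < sigma (midpoint xs j) <= L.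
  move=> jM; apply/andP; split; first by apply: lt_le_trans (sge _ (m01 j jM)); rewrite invr_gt0.
  by apply: le_trans (Cpw_bounded pcs Csigma nS (m01 j jM)); exact: ler_norm.
have sSk j : (j < size xs)%N -> `|sigmaS (midpoint xs j)| <= (1 - L ^- 2) * sigma (midpoint xs j).
  by move=> jM; exact: (scattering_ratio pcs L1 Csigma nS sge sS sA (m01 j jM)).
have mu0 k : (k < N)%N -> 0 < mu N k by have [h _ _] := gl; move=> /h/andP[].
have w0 k : (k < N)%N -> 0 <= w N k by exact: (gauss_weight_ge0 gl).
have w1 := gauss_weight_sum N0 gl.
have [v dv] := discrete_solution_exists pxs mu0 w0 w1 k01 sL sSk f.
exists v; split => // v' dv' x x01.
exact: (discrete_solution_unique pxs mu0 w0 w1 k01 sL sSk dv dv' x01).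
Qed.

(** L^15 is the L^8 of [discretisation_error] times the L^7 in the bound of the source. C is fixed
    before the data and the mesh, which is what allows taking moments. *)
Lemma deterministic_error eta rho c0 cs (mu w : nat -> nat -> R) :
  itv_partition 0 1 cs -> 0 < eta < 1 -> 1 <= rho -> 0 < c0 ->
  (forall N, (0 < N)%N -> gauss_legendre N (mu N) (w N)) ->
  exists2 C, 0 < C & forall L F sigma sigmaS f phi xs v, 1 < L ->
    Cpw eta cs sigma -> Cpw eta cs sigmaS -> Cpw eta cs f ->
    (pw_norm eta cs sigma <= L%:E)%E -> (pw_norm eta cs sigmaS <= L%:E)%E ->
    (pw_norm eta cs f <= F%:E)%E ->
    (forall x, 0 <= x <= 1 -> L^-1 <= sigma x) ->
    (forall x, 0 <= x <= 1 -> 0 <= sigmaS x) ->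
    (forall x, 0 <= x <= 1 -> L^-1 <= sigma x - sigmaS x) ->
    scalar_flux sigma sigmaS f phi -> mesh rho cs xs ->
    discrete_solution mu w xs (Nh eta c0 (diameter xs)) sigma sigmaS f v ->
    forall x, 0 <= x <= 1 -> `|phi x - v x| <= C * (L ^+ 15 * F) * diameter xs `^ eta.
Proof.
move=> pcs eta01 rho1 c00 gauss.
have [Cg Cg0 hCg] := @gauss_error R.
have s01 : 0 < Num.max eta 2^-1 < 1.
  by have /andP[e0 e1] := eta01; rewrite lt_max gt_max e0 e1 /=; lra.
have h01 : 0 < (2^-1 : R) < 1 by apply/andP; split; lra.
have [Cs Cs0 hCs] := gauss_powR s01.
have [Cq Cq0 hCq] := gauss_powR h01.
have i0 : 0 < 1 - eta by have /andP[_ e1] := eta01; rewrite subr_gt0.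
set K := 4 * Cg / c0 + (20 + 2 * (size cs)%:R + 2 * rho) * Cs.
have K0 : 0 <= K.
  apply: addr_ge0; first by rewrite divr_ge0 ?mulr_ge0 // ltW.
  by rewrite mulr_ge0 ?(ltW Cs0) // !addr_ge0 ?mulr_ge0 // (le_trans ler01).
exists ((1 + Cq) * (K + 1) * (6 / (1 - eta))).
  by apply: mulr_gt0; [apply: mulr_gt0; [rewrite addr_gt0|rewrite ltr_wpDl]|rewrite divr_gt0].
move=> L F sigma sigmaS f phi xs v L1 C1 C2 C3 n1 n2 n3 sg sS sA flux mxs dv x x01.
have [pxs _ _] := mxs.
have [N0 hN] := Nh_bounds eta c00 (diameter_gt0 pxs).
have gl := gauss _ N0.
have angular Fn A (A0 : 0 <= A) hF iF := hCg _ _ _ Fn A N0 gl A0 hF iF.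
have := discretisation_error pcs eta01 L1 C1 C2 C3 n1 n2 n3 sg sS sA flux rho1 c00 mxs N0 gl
  (ltW Cg0) angular (ltW Cs0) (hCs _ _ _ gl) (hCq _ _ _ gl) hN dv x01.
rewrite -/K => /le_trans; apply; apply: le_of_eq.
by move: (_ `^ eta) => p; ring.
Qed.

End Deterministic.

(** * Measurability and moments of the data *)

Section CountableSuprema.
Context {R : realType}.
Implicit Types (a b x y eta e : R) (g : R -> R).

(** An enumeration of the rationals of ]a, b[ that stays in the interval: an index decoding to a
    point outside gives the midpoint. *)
Definition rational_point a b (n : nat) : R :=
  let q := ratr (odflt 0 (unpickle n : option rat)) in
  if a < q < b then q else (a + b) / 2.

Lemma rational_point_itv a b n : a < b -> a < rational_point a b n < b.
Proof.
by move=> ab; rewrite /rational_point; case: ifP => // _; apply/andP; split; lra.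
Qed.

Lemma rational_point_dense a b x y : a <= x -> x < y -> y <= b ->
  exists n, x < rational_point a b n < y.
Proof.
move=> ax xy yb; have [q] := rat_in_itvoo xy; rewrite in_itv /= => /andP[xq qy].
exists (pickle q); rewrite /rational_point pickleK /=.
by rewrite (le_lt_trans ax xq) (lt_le_trans qy yb) /= xq qy.
Qed.

Lemma rational_point_right a b g x y e : a < x -> x < y -> y < b -> {for x, continuous g} -> 0 < e ->
  exists n, x < rational_point a b n < y /\ `|g x - g (rational_point a b n)| < e.
Proof.
move=> ax xy yb cg e0; have /cvgrPdist_lt/(_ e e0)[d /= d0 hd] := cg.
have [||n /andP[n1 n2]] := @rational_point_dense a b x (Num.min y (x + d)) (ltW ax).
- by rewrite lt_min xy ltrDl.
- by rewrite ge_min (ltW yb).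
exists n; move: n2; rewrite lt_min => /andP[n2 n3]; split; first by rewrite n1.
by apply: hd; rewrite /ball_ /= distrC gtr0_norm; lra.
Qed.

Lemma rational_point_left a b g x y e : a < x -> x < y -> y < b -> {for y, continuous g} -> 0 < e ->
  exists n, x < rational_point a b n < y /\ `|g y - g (rational_point a b n)| < e.
Proof.
move=> ax xy yb cg e0; have /cvgrPdist_lt/(_ e e0)[d /= d0 hd] := cg.
have [|||n /andP[n1 n2]] := @rational_point_dense a b (Num.max x (y - d)) y.
- by rewrite le_max (ltW ax).
- by rewrite gt_max xy ltrBlDr ltrDl.
- exact: ltW.
exists n; move: n1; rewrite gt_max => /andP[n1 n3]; split; first by rewrite n1.
by apply: hd; rewrite /ball_ /= gtr0_norm; lra.
Qed.

Definition rational_pair (n : nat) : nat * nat := odflt (0, 0)%N (unpickle n).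

Definition holder_quotient eta g x y : R := `|g x - g y| / `|x - y| `^ eta.

(** Continuity reduces both suprema to countably many points, from which the measurability of the
    norm in omega follows. *)
Lemma holder_norm_rational eta a b g : 0 < eta -> a < b -> (forall x, a < x < b -> {for x, continuous g}) ->
  holder_norm eta `]a, b[ g =
  (esups (fun n => `|g (rational_point a b n)|%:E) 0%N +
   esups (fun n => (holder_quotient eta g (rational_point a b (rational_pair n).1)
     (rational_point a b (rational_pair n).2))%:E) 0%N)%E.
Proof.
move=> eta0 ab cg; rewrite /holder_norm; set x_ := rational_point a b.
have xn n : a < x_ n < b by exact: rational_point_itv.
have up (u : (\bar R)^nat) n : (u n <= esups u 0%N)%E by apply: ereal_sup_ubound; exists n.
have lb (u : (\bar R)^nat) M : (forall n, (u n <= M)%E) -> (esups u 0%N <= M)%E.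
  by move=> h; apply: ge_ereal_sup => _ [n _ <-].
congr (_ + _)%E; apply/eqP; rewrite eq_le; apply/andP; split.
- apply: ge_ereal_sup => _ [x + <-]; rewrite /= in_itv /= => xab.
  set s := esups _ _; have : (0 <= s)%E by apply: le_trans (up _ 0%N); rewrite lee_fin.
  have sn n : (`|g (x_ n)|%:E <= s)%E := up (fun n => `|g (x_ n)|%:E) n.
  case: s sn => [s sn _|_ _|]; [|exact: leey|by []].
  rewrite lee_fin; apply/ler_addgt0Pr => e e0; have /andP[ax xb] := xab.
  have m1 : x < (x + b) / 2 by lra.
  have m2 : (x + b) / 2 < b by lra.
  have [n [_ hn]] := rational_point_right ax m1 m2 (cg _ xab) e0.
  have := sn n; rewrite lee_fin => h.
  have := ler_normD (g x - g (x_ n)) (g (x_ n)); rewrite subrK => /le_trans; apply.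
  by rewrite addrC lerD // ltW.
- by apply: lb => n; apply: ereal_sup_ubound; exists (x_ n) => //; rewrite /= in_itv /= xn.
- apply: ge_ereal_sup => _ [[x y] /= [+ + xny] <-]; rewrite /= !in_itv /= => xab yab.
  set s := esups _ _.
  have s0 : (0 <= s)%E by apply: le_trans (up _ 0%N); rewrite lee_fin divr_ge0 ?powR_ge0.
  have sn i j : ((holder_quotient eta g (x_ i) (x_ j))%:E <= s)%E.
    have := up (fun n => (holder_quotient eta g (x_ (rational_pair n).1) (x_ (rational_pair n).2))%:E)
      (pickle (i, j)).
    by rewrite /rational_pair pickleK.
  case: s s0 sn => [s s0 sn|_ _ *|]; [|exact: leey|by []].
  wlog xy : x y xab yab xny / x < y => [hw|].
    have [xy|yx|e] := ltgtP x y; first exact: hw.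
      by rewrite distrC (distrC x) hw // eq_sym.
    by rewrite e eqxx in xny.
  have /andP[ax xb] := xab; have /andP[ay yb] := yab.
  rewrite lee_fin ler_pdivrMr ?powR_gt0 ?normr_gt0 ?subr_eq0 //.
  apply/ler_addgt0Pr => e e0; have e2 : 0 < e / 2 by lra.
  (* Both approximants are taken strictly between x and y, so their distance, and with it the
     denominator of the quotient, can only decrease. *)
  have [i [/andP[i1 i2] hi]] := rational_point_right ax xy yb (cg _ xab) e2.
  have [j [/andP[j1 j2] hj]] := rational_point_left ax xy yb (cg _ yab) e2.
  have [i1' i2' j1' j2'] : [/\ x < x_ i, x_ i < y, x < x_ j & x_ j < y] by [].
  have hij : `|g (x_ i) - g (x_ j)| <= s * `|x - y| `^ eta.
    have [->|nij] := eqVneq (x_ i) (x_ j); first by rewrite subrr normr0 mulr_ge0 ?powR_ge0.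
    have := sn i j; rewrite lee_fin ler_pdivrMr ?powR_gt0 ?normr_gt0 ?subr_eq0 // => /le_trans; apply.
    rewrite ler_wpM2l // ge0_ler_powR ?nnegrE ?(ltW eta0) //.
    by rewrite (distrC x y) (gtr0_norm (_ : 0 < y - x)) ?subr_gt0 // ler_norml; apply/andP; split; lra.
  have -> : g x - g y = (g x - g (x_ i)) + (g (x_ i) - g (x_ j)) - (g y - g (x_ j)) by ring.
  apply: (le_trans (ler_normB _ _)); apply: (le_trans (lerD (ler_normD _ _) (lexx _))).
  move: hi hj hij; rewrite -/(x_ i) -/(x_ j).
  by move: (`|_|) (`|_|) (`|_|) (s * _) => p q r t; lra.
- apply: lb => n; set i := (rational_pair n).1; set j := (rational_pair n).2.
  (* A pair of equal points has quotient 0 and does not occur in the original supremum; it is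
     dominated by any genuine quotient. *)
  have [e|nij] := eqVneq (x_ i) (x_ j); last first.
    by apply: ereal_sup_ubound; exists (x_ i, x_ j) => //=; split; rewrite ?in_itv //= xn.
  rewrite /holder_quotient e subrr normr0 mul0r.
  have m1 : a < (a + b) / 2 < b by apply/andP; split; lra.
  have m2 : a < (a + (a + b) / 2) / 2 < b by apply/andP; split; lra.
  apply: (@le_trans _ _ (holder_quotient eta g ((a + b) / 2) ((a + (a + b) / 2) / 2))%:E).
    by rewrite lee_fin divr_ge0 ?powR_ge0.
  apply: ereal_sup_ubound; exists ((a + b) / 2, (a + (a + b) / 2) / 2) => //=.
  by split; rewrite ?in_itv //=; apply/eqP; lra.
Qed.

End CountableSuprema.

Section RandomNorms.
Context {R : realType} {d : measure_display} {Omega : measurableType d}.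
Implicit Types (s : Omega -> R -> R) (eta : R) (cs : seq R).

Lemma measurable_bigmaxe (n : nat) (f : nat -> Omega -> \bar R) :
  (forall j, (j < n)%N -> measurable_fun [set: Omega] (f j)) ->
  measurable_fun [set: Omega] (fun w => \big[maxe/0%E]_(j < n) f j w).
Proof.
elim: n f => [|n IH] f mf.
  by rewrite (_ : (fun w => _) = cst 0%E) //; apply/funext => w; rewrite big_ord0.
rewrite (_ : (fun w => _) = fun w => maxe (f 0%N w) (\big[maxe/0%E]_(j < n) f j.+1 w)); last first.
  by apply/funext => w; rewrite big_ord_recl.
by apply: measurable_maxe; [exact: mf|apply: (IH (fun j => f j.+1)) => j jn; exact: mf].
Qed.

Lemma measurable_pw_norm eta cs s : 0 < eta -> itv_partition 0 1 cs -> random_field s ->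
  (forall w, Cpw eta cs (s w)) -> measurable_fun [set: Omega] (fun w => pw_norm eta cs (s w)).
Proof.
move=> eta0 part rf cpw; apply: (@measurable_bigmaxe _ (fun j w => holder_norm eta (cell cs j) (s w))) => j jJ.
have lt : left_pt cs j < right_pt cs j by rewrite -left_ptS left_pt_lt // ltnSn.
have hE w : holder_norm eta (cell cs j) (s w) = _ := holder_norm_rational eta0 lt
  (fun x xj => cell_continuous eta0 part (let: And3 h _ _ := cpw w in h) jJ xj).
have in01 n : rational_point (left_pt cs j) (right_pt cs j) n \in `[0, 1].
  rewrite in_itv /=; apply: (cell01 part jJ); rewrite /cell /= in_itv /=.
  exact: rational_point_itv.
under eq_fun do rewrite hE.
apply: emeasurable_funD; apply: measurable_fun_esups => n; apply/measurable_EFinP.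
  by apply: measurableT_comp => //; exact: rf.
apply: measurable_funM => //; apply: measurableT_comp => //.
by apply: measurable_funB; exact: rf.
Qed.

End RandomNorms.

(** * Lebesgue norms on a probability space *)

Section LebesgueNorms.
Context {R : realType} {d : measure_display} {T : measurableType d}.
Variable P : probability T R.
Implicit Types (p q r : R).

(** The integral of a nonnegative function is a supremum over simple functions below it, hence
    monotone without measurability. The error norm as a function of omega is only known to be
    dominated. *)
Lemma ge0_le_integralW (f g : T -> \bar R) : (forall x, 0 <= f x)%E -> (forall x, f x <= g x)%E ->
  (\int[P]_x f x <= \int[P]_x g x)%E.
Proof.
move=> f0 fg; have g0 x : (0 <= g x)%E by exact: le_trans (fg x).
rewrite !ge0_integralTE //; apply: ge_ereal_sup => _ [h /= hf <-].
by apply: ereal_sup_ubound; exists h => // x; exact: le_trans (fg x).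
Qed.

Lemma poweR_le p (x y : \bar R) : 0 < p -> (0 <= x)%E -> (0 <= y)%E -> (x <= y)%E -> (x `^ p <= y `^ p)%E.
Proof.
by move=> p0 x0 y0; apply: (gt0_ler_poweR (ltW p0)); rewrite in_itv /= leey andbT.
Qed.

Lemma poweR_inj_le p (x y : \bar R) : 0 < p -> (0 <= x)%E -> (0 <= y)%E -> (x `^ p <= y `^ p)%E -> (x <= y)%E.
Proof.
move=> p0 x0 y0 h; have pV : p * p^-1 = 1 by rewrite divff // gt_eqF.
rewrite -(poweRe1 x0) -(poweRe1 y0) -pV !poweRrM.
by apply: poweR_le; rewrite ?invr_gt0 ?poweR_ge0.
Qed.

Lemma Lnorm_mono p (f g : T -> \bar R) : 0 < p -> (forall x, `|f x| <= `|g x|)%E ->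
  (Lnorm P p%:E f <= Lnorm P p%:E g)%E.
Proof.
move=> p0 fg; apply: (poweR_inj_le p0); rewrite ?Lnorm_ge0 // !poweR_Lnorm ?gt_eqF //.
apply: ge0_le_integralW => x; first exact: poweR_ge0.
by apply: poweR_le => //; exact: abse_ge0.
Qed.

(** The usual Hoelder inequality for |X|^p and |Y|^p, with the conjugate exponents q / p and r /
    p. *)
Lemma LnormM p q r (X Y : T -> R) : measurable_fun [set: T] X -> measurable_fun [set: T] Y ->
  0 < p -> 0 < q -> 0 < r -> p^-1 = q^-1 + r^-1 ->
  (Lnorm P p%:E (fun x => (X x * Y x)%:E) <= Lnorm P q%:E (EFin \o X) * Lnorm P r%:E (EFin \o Y))%E.
Proof.
move=> mX mY p0 q0 r0 e.
have pw (Z : T -> R) : measurable_fun [set: T] Z -> measurable_fun [set: T] (fun x => `|Z x| `^ p).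
  move=> mZ; apply: (@measurableT_comp _ _ _ _ _ _ (fun x : R => x `^ p)); first exact: measurable_powR.
  exact: measurableT_comp.
have key (Z : T -> R) s : 0 < s ->
    Lnorm P (s / p)%:E (EFin \o (fun x => `|Z x| `^ p)) = (Lnorm P s%:E (EFin \o Z) `^ p)%E.
  move=> s0; rewrite unlock -poweRrM.
  rewrite (_ : (s / p)^-1 = s^-1 * p); last by rewrite invfM invrK mulrC.
  apply: (congr1 (fun z => (z `^ (s^-1 * p))%E)).
  apply: eq_integral => x _ /=; congr (_%:E); rewrite ger0_norm ?powR_ge0 // -powRrM.
  by congr (_ `^ _); rewrite mulrC divfK // gt_eqF.
have h := @hoelder _ _ _ P _ _ (q / p) (r / p) (pw X mX) (pw Y mY).
apply: (poweR_inj_le p0); rewrite ?mule_ge0 ?Lnorm_ge0 // poweRM ?Lnorm_ge0 //.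
rewrite -(key X) // -(key Y) // poweR_Lnorm ?gt_eqF //.
apply: le_trans (h _ _ _); rewrite ?divr_gt0 //; last first.
  by rewrite !invfM !invrK -mulrDl -e mulVf // gt_eqF.
rewrite Lnorm1; apply: le_of_eq; apply: eq_integral => x _ /=.
by congr (_%:E); rewrite (ger0_norm (mulr_ge0 (powR_ge0 _ _) (powR_ge0 _ _))) normrM powRM.
Qed.

Lemma Lnorm_le_Linfty p (f : T -> \bar R) : measurable_fun [set: T] f -> 0 < p ->
  (Lnorm P p%:E f <= Lnorm P +oo%E f)%E.
Proof.
move=> mf p0; set M := Lnorm P +oo%E f.
have M0 : (0 <= M)%E by exact: Lnorm_ge0.
apply: (poweR_inj_le p0) => //; first exact: Lnorm_ge0.
rewrite poweR_Lnorm ?gt_eqF //.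
have -> : (M `^ p = \int[P]_x (M `^ p))%E.
  have PT : P [set: T] = 1%E := probability_setT P.
  by rewrite integral_cst // [X in (_ * X)%E]PT mule1.
apply: ae_ge0_le_integral => //.
- by move=> x _; exact: poweR_ge0.
- apply: (@measurableT_comp _ _ _ _ _ _ (fun x : \bar R => (x `^ p)%E)); first exact: measurable_poweR.
  exact: measurableT_comp.
- by move=> x _; exact: poweR_ge0.
have hM : M = ess_sup P (abse \o f).
  rewrite /M unlock ifT //.
  exact: (eq_ind_r (fun z => (0 < z)%E) lte01 (probability_setT P)).
have := ess_sup_ge P (abse \o f); rewrite -hM; apply: filterS => x fx _.
by apply: poweR_le => //; exact: abse_ge0.
Qed.

Lemma LnormZ_ge0 p (c : R) (X : T -> R) : 0 < p -> 0 <= c -> measurable_fun [set: T] X ->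
  Lnorm P p%:E (fun x => (c * X x)%:E) = (c%:E * Lnorm P p%:E (EFin \o X))%E.
Proof.
move=> p0 c0 mX; rewrite unlock /=.
have -> : (\int[P]_x (`|c * X x| `^ p)%:E = (c `^ p)%:E * \int[P]_x (`|X x| `^ p)%:E)%E.
  rewrite -ge0_integralZl ?lee_fin ?powR_ge0 //.
  - by apply: eq_integral => x _; rewrite -EFinM normrM (ger0_norm c0) powRM.
  - apply/measurable_EFinP; apply: (@measurableT_comp _ _ _ _ _ _ (fun x : R => x `^ p)); first exact: measurable_powR.
    exact: measurableT_comp.
rewrite poweRM ?lee_fin ?powR_ge0 //; last by apply: integral_ge0 => x _; rewrite lee_fin powR_ge0.
congr (_ * _)%E; rewrite poweR_EFin -powRrM divff ?gt_eqF // powRr1 //.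
Qed.

End LebesgueNorms.

Section Moments.
Context {R : realType} {d : measure_display} {T : measurableType d}.
Variable P : probability T R.
Implicit Types (q eta : R) (X Y : T -> R) (cs : seq R).

Lemma Linf01_le (g : R -> R) (B : R) : 0 <= B -> (forall x, 0 <= x <= 1 -> `|g x| <= B) ->
  (Linf01 g <= B%:E)%E.
Proof.
move=> B0 gB; rewrite /Linf01 unlock; case: ifP => _; last by rewrite lee_fin.
apply/ess_supP; apply: nearW => x /=; rewrite lee_fin /patch.
by case: ifP => [|_]; [rewrite inE /= in_itv; exact: gB|rewrite normr0].
Qed.

Definition finite_moment q X :=
  measurable_fun [set: T] X /\ (Lnorm P q%:E (EFin \o X) < +oo)%E.

Lemma finite_moment1 q : 0 < q -> finite_moment q (fun=> 1).
Proof.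
move=> q0; split; first exact: measurable_cst.
by rewrite (Lnorm_cst1 P q) (eq_ind_r (fun z => (z `^ q^-1 < +oo)%E) _ (probability_setT P)) // poweR1r ltry.
Qed.

Lemma finite_momentD q X Y : 1 <= q -> finite_moment q X -> finite_moment q Y ->
  finite_moment q (fun w => X w + Y w).
Proof.
move=> q1 [mX fX] [mY fY]; split; first exact: measurable_funD.
apply: (le_lt_trans (@eminkowski _ _ _ P X Y q%:E mX mY _)); first by rewrite lee_fin.
exact: lte_add_pinfty.
Qed.

Lemma finite_moment_Lfun q X : X \in Lfun P q%:E -> finite_moment q X.
Proof. by move=> /andP[mX fX]; rewrite inE in mX; rewrite inE in fX. Qed.

Lemma finite_momentX q n X : 0 < q -> finite_moment (n.+1%:R * q) X ->
  finite_moment q (fun w => X w ^+ n.+1).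
Proof.
move=> q0 [mX fX]; split; first exact: measurable_funX.
have nq : n.+1%:R * q != 0 by rewrite mulf_neq0 ?gt_eqF.
rewrite unlock; apply: poweR_lty.
have e x : `|X x ^+ n.+1| `^ q = `|X x| `^ (n.+1%:R * q).
  by rewrite powRrM powR_mulrn // normrX.
have := poweR_Lnorm P (EFin \o X) nq; rewrite /= => E.
under eq_integral => x _ do rewrite /= e.
rewrite -E; exact: poweR_lty.
Qed.

Lemma finite_moment_pw_norm q eta cs s : 0 < eta -> itv_partition 0 1 cs -> random_field s ->
  (forall w, Cpw eta cs (s w)) -> (bochner_norm P (pw_norm eta cs) q%:E s < +oo)%E ->
  finite_moment q (fun w => fine (pw_norm eta cs (s w))).
Proof.
move=> eta0 part rs cs_ bs.
have E : EFin \o (fun w => fine (pw_norm eta cs (s w))) = fun w => pw_norm eta cs (s w).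
  by apply/funext => w; exact: pw_norm_fineK (cs_ w).
split; last by rewrite E.
by apply/measurable_EFinP; rewrite E; exact: measurable_pw_norm.
Qed.

Lemma data_bound_moment q eta cs sigma sigmaS : 0 < eta -> itv_partition 0 1 cs -> 1 <= q ->
  random_cross_sections P eta cs sigma sigmaS ->
  finite_moment q (fun w => data_bound eta cs (sigma w) (sigmaS w)).
Proof.
move=> eta0 part q1 [[rs rsS] adm mom inv].
have [[_ b1] [_ b2]] := mom q q1; have [i1 i2] := inv q q1.
have c1 w : Cpw eta cs (sigma w) by have [] := adm w.
have c2 w : Cpw eta cs (sigmaS w) by have [] := adm w.
do ![apply: finite_momentD => //].
- by apply: finite_moment1; exact: lt_le_trans q1.
- exact: finite_moment_pw_norm b1.
- exact: finite_moment_pw_norm b2.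
- exact: finite_moment_Lfun.
- exact: finite_moment_Lfun.
Qed.

Lemma product_moment_bound p q r (c : R) X Y (err : T -> \bar R) : 0 < p -> 0 < q -> 0 < r ->
  p^-1 = q^-1 + r^-1 -> 0 <= c -> finite_moment q X -> measurable_fun [set: T] Y ->
  (forall w, 0 <= err w <= (c * (X w * Y w))%:E)%E ->
  (Lnorm P p%:E err <= (c * fine (Lnorm P q%:E (EFin \o X)))%:E * Lnorm P r%:E (EFin \o Y))%E.
Proof.
move=> p0 q0 r0 pqr c0 [mX fX] mY herr.
apply: (@le_trans _ _ (Lnorm P p%:E (fun w => (c * (X w * Y w))%:E))).
  apply: Lnorm_mono => // w; have /andP[e0 e1] := herr w.
  by rewrite !gee0_abs // (le_trans e0 e1).
rewrite LnormZ_ge0 //; last exact: measurable_funM.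
have -> : (c * fine (Lnorm P q%:E (EFin \o X)))%:E = (c%:E * Lnorm P q%:E (EFin \o X))%E.
  by rewrite EFinM fineK // ge0_fin_numE ?Lnorm_ge0.
by rewrite -muleA; apply: lee_wpmul2l; rewrite ?lee_fin //; exact: LnormM.
Qed.

End Moments.

Theorem theorem5p6 (R : realType) (d : measure_display)
    (Omega : measurableType d) (P : probability Omega R)
    (cs : seq R) (eta rho K c0 : R) (mu w : nat -> nat -> R)
    (sigma sigmaS : Omega -> R -> R) (pstar : \bar R)
    (partition_cs : itv_partition 0 1 cs)
    (eta01 : 0 < eta < 1)
    (rho_ge1 : 1 <= rho)
    (gauss : forall N, (0 < N)%N -> gauss_legendre N (mu N) (w N))
    (K_ge1 : 1 <= K)
    (K_stable : stability_constant mu w eta rho cs K)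
    (c0_gt0 : 0 < c0)
    (c0_large : forall h : R, 0 < h <= 1 -> 1 <= ln (Nh eta c0 h)%:R :> R)
    (cross_sections : random_cross_sections P eta cs sigma sigmaS)
    (pstar_gt1 : (1 < pstar)%E) :
  (forall (f : Omega -> R -> R) (h : R) (T : Omega -> seq R),
     random_source P eta cs pstar f ->
     0 < h < 1 ->
     mesh_choice eta rho K c0 cs sigma sigmaS h T ->
     forall omega, exists v : R -> R,
       sample_solution mu w eta K c0 cs sigma sigmaS f h T omega v /\
       forall v', sample_solution mu w eta K c0 cs sigma sigmaS f h T omega v' ->
         forall x, x \in `[0, 1] -> v' x = v x) /\
  (forall p r : \bar R, (1 <= p)%E -> (p < r)%E -> (r <= pstar)%E ->
     exists C : R, 0 < C /\
       forall (f phi Phi : Omega -> R -> R) (h : R) (T : Omega -> seq R),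
         random_source P eta cs pstar f ->
         (forall omega,
            scalar_flux (sigma omega) (sigmaS omega) (f omega) (phi omega)) ->
         0 < h < 1 ->
         mesh_choice eta rho K c0 cs sigma sigmaS h T ->
         (forall omega,
            sample_solution mu w eta K c0 cs sigma sigmaS f h T omega
              (Phi omega)) ->
         (bochner_norm P Linf01 p (fun omega => (phi omega \- Phi omega)%R) <=
          C%:E * bochner_norm P (pw_norm eta cs) r f * (h `^ eta)%:E)%E).
Proof.
have [eta0 eta1] := andP eta01.
have [_ adm _ _] := cross_sections.
(* A partition of [0,1] has positive diameter, so the mesh itself shows that h_omega > 0; h_omega <=
   h holds by the minimum. *)
have hw (h : R) (T : Omega -> seq R) : 0 < h -> mesh_choice eta rho K c0 cs sigma sigmaS h T ->
    forall omega, [/\ mesh rho cs (T omega),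
      diameter (T omega) = h_omega eta K c0 cs sigma sigmaS h omega &
      0 < diameter (T omega) <= h].
  move=> h0 mc omega; have [mT dT] := mc omega; split => //.
  by have [pT _ _] := mT; rewrite diameter_gt0 //= dT /h_omega ge_min lexx.
split=> [f h T _ /andP[h0 _] mc omega|p r p1 pr rp].
  have [mT dT /andP[d0 _]] := hw h T h0 mc omega; rewrite /sample_solution -dT.
  have [N0 _] := Nh_bounds eta c0_gt0 d0.
  have [v [dv vu]] := discrete_solution_wellposed (mu := mu) (w := w) (f omega) partition_cs mT N0 (gauss _ N0) (adm omega).
  by exists v; split => // v' dv' x x01; exact: vu dv' x x01.
have [c c_gt0 err] := deterministic_error partition_cs eta01 rho_ge1 c0_gt0 gauss.
case: p p1 pr => [p| |//]; last by move=> _; rewrite ltNge leey.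
rewrite lee_fin => p1 pr; have p0 : 0 < p by rewrite (lt_le_trans ltr01).
(* Hoelder's inequality is used with finite exponents: r itself if finite, otherwise p + 1, whose
   norm is below the essential supremum because the total mass is 1. *)
have [r' [pr' r'E]] : exists r', p < r' /\ forall F : Omega -> \bar R,
    measurable_fun [set: Omega] F -> (Lnorm P r'%:E F <= Lnorm P r F)%E.
  case: r pr {rp} => [r| |//]; first by rewrite lte_fin; exists r.
  move=> _; exists (p + 1); split; first by rewrite ltrDl.
  by move=> F mF; apply: Lnorm_le_Linfty => //; rewrite addr_gt0.
have r'0 : 0 < r' by exact: lt_trans pr'.
(* The exponent complementary to r' in Hoelder's inequality for L_p; it stays finite because p < r',
   and every finite moment of the data bound is available. *)
pose q := p * r' / (r' - p).
have rp0 : 0 < r' - p by rewrite subr_gt0.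
have pqr : p^-1 = q^-1 + r'^-1.
  by rewrite /q; field; rewrite !gt_eqF.
have q1 : 1 <= q.
  rewrite /q ler_pdivlMr // mul1r (le_trans (_ : r' - p <= r')) ?gerBl ?(ltW p0) //.
  by rewrite ler_peMl // ltW.
have q0 : 0 < q by exact: lt_le_trans q1.
pose D omega := data_bound eta cs (sigma omega) (sigmaS omega).
have fD : finite_moment P q (fun omega => D omega ^+ 15).
  apply: (@finite_momentX _ _ _ P q 14) => //; apply: (data_bound_moment eta0) cross_sections => //.
  by apply: (le_trans q1); rewrite ler_peMl ?ler1n // ltW.
(* The moment depends on the cross sections only, so C depends neither on f nor on h; adding 1 makes
   it positive. *)
exists (c * fine (Lnorm P q%:E (EFin \o (fun omega => D omega ^+ 15))) + 1); split.
  by rewrite ltr_wpDl // mulr_ge0 ?(ltW c_gt0) // fine_ge0 ?Lnorm_ge0.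
move=> f phi Phi h T [rf cf _] flux /andP[h0 h1] mc sol.
pose F omega := fine (pw_norm eta cs (f omega)).
have mpw := measurable_pw_norm eta0 partition_cs rf cf.
have FE : EFin \o F = fun omega => pw_norm eta cs (f omega).
  by apply/funext => omega; exact: pw_norm_fineK (cf omega).
have mF : measurable_fun [set: Omega] F by apply/measurable_EFinP; rewrite FE.
have h_ge0 : 0 <= c * h `^ eta by rewrite mulr_ge0 ?powR_ge0 // ltW.
have bound omega : (0 <= Linf01 (phi omega \- Phi omega)%R <= (c * h `^ eta * (D omega ^+ 15 * F omega))%:E)%E.
  have [mT dT /andP[d0 dh]] := hw h T h0 mc omega.
  have [L1 [n1 n2] sg sS sA] := data_boundP (adm omega).
  have [c1 c2 _ _ _] := adm omega.
  have F0 : 0 <= F omega by rewrite fine_ge0 // pw_norm_ge0.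
  have DF : 0 <= D omega ^+ 15 * F omega by rewrite mulr_ge0 // exprn_ge0 // (le_trans ler01) // ltW.
  apply/andP; split; first exact: Lnorm_ge0.
  apply: Linf01_le => [|x x01]; first exact: mulr_ge0.
  have n3 : (pw_norm eta cs (f omega) <= (F omega)%:E)%E by rewrite pw_norm_fineK.
  have := sol omega; rewrite /sample_solution -dT => dsol.
  apply: (le_trans (err _ _ _ _ _ _ _ _ L1 c1 c2 (cf omega) n1 n2 n3 sg sS sA (flux omega) mT dsol x x01)).
  rewrite mulrAC ler_wpM2r // ler_wpM2l ?(ltW c_gt0) //.
  by rewrite ge0_ler_powR ?nnegrE ?(ltW eta0) ?(ltW d0) ?(ltW h0).
have := product_moment_bound p0 q0 r'0 pqr h_ge0 fD mF bound.
rewrite FE => /le_trans; apply.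
set A := fine _; have A0 : 0 <= A by rewrite fine_ge0 ?Lnorm_ge0.
rewrite /bochner_norm; set N1 := Lnorm P r'%:E _; set N2 := Lnorm P r _.
have N12 : (N1 <= N2)%E by exact: r'E.
have N20 : (0 <= N2)%E by exact: Lnorm_ge0.
rewrite -muleA [(N2 * _)%E]muleC muleA -EFinM.
apply: lee_pmul => //.
- by rewrite lee_fin mulr_ge0.
- exact: Lnorm_ge0.
- by rewrite lee_fin mulrAC ler_wpM2r ?powR_ge0 // lerDl.
Qed.
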